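(* Let $\mathscr{T}(g)$ denote the number of troplanar graphs of genus $g$. Then $\mathscr{T}(g)=\Omega(\gamma^g)$ as $g\rightarrow\infty$, where $\gamma=\sqrt{\alpha}\approx 2.47$ is the square root of the unique real root $\alpha$ of $x^3-2x^2-13x-75$.
   Context: Graphs are finite; loops and multiple edges are allowed (a loop counts twice towards the degree). A graph is trivalent if every vertex has degree $3$. The genus of a connected graph is $|E|-|V|+1$. Graphs are counted up to isomorphism, where an isomorphism is a bijection of vertex sets preserving the number of edges between each pair of (possibly equal) vertices. $f(g)=\Omega(k(g))$ means $k(g)=O(f(g))$, i.e. for all sufficiently large $g$, $|k(g)|$ is at most a positive constant multiple of $f(g)$. Troplanar graphs. A lattice polygon is a (convex) polygon in $\mathbb{R}^2$ with vertices in $\mathbb{Z}^2$; its genus is its number of interior lattice points. A unimodular triangulation of a lattice polygon is a subdivision into lattice triangles of area $1/2$, any two meeting in a common face (edge, vertex or empty set). It is regular if there is a height function $(i,j)\mapsto a_{ij}\in\mathbb{R}$ on the lattice points of the polygon such that the triangulation is the projection of the lower faces of the convex hull of the points $(i,j,a_{ij})\in\mathbb{R}^3$. Let $\Delta$ be a lattice polygon of genus $g\ge 2$ with a regular unimodular triangulation $\mathcal{T}$. A smooth tropical plane curve dual to $\mathcal{T}$ has one vertex for each triangle of $\mathcal{T}$, an edge joining two vertices exactly when the triangles share an edge, and a ray for each boundary edge. Its skeleton is the graph obtained by removing all rays, iteratively removing $1$-valent vertices together with their edges, and then smoothing over all $2$-valent vertices; it is a connected trivalent planar graph of genus $g$.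 A graph is tropically planar (troplanar) if it is isomorphic to a skeleton obtained in this way. *)

(* Defs.v *)
From HB Require Import structures.
From mathcomp Require Import all_boot all_order all_algebra finmap.
From mathcomp Require Import all_classical all_reals all_analysis.

Set Implicit Arguments.
Unset Strict Implicit.
Unset Printing Implicit Defensive.

Import Order.TTheory GRing.Theory Num.Theory.
Import numFieldNormedType.Exports.

Local Open Scope classical_set_scope.
Local Open Scope card_scope.
Local Open Scope ring_scope.

(** * Multigraphs *)

(* [mult u v] is the number of edges between u and v; [mult v v] is the number
   of loops at v. *)
Record mgraph := MGraph {
  vertex :> finType;
  mult : vertex -> vertex -> nat;
  mult_sym : forall u v, mult u v = mult v u }.

Section Graphs.
Local Open Scope nat_scope.
Implicit Types G H K : mgraph.

Definition degree G (v : G) : nat := \sum_(u : G) mult v u + mult v v.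

(* Each unordered pair {u, v}, u = v included, is counted once by ordering the
   vertices according to their enumeration. *)
Definition num_edges G : nat :=
  \sum_(u : G) \sum_(v : G | enum_rank u <= enum_rank v) mult u v.

Definition connected_graph G : Prop :=
  0 < #|G| /\ forall u v : G, connect (fun x y : G => 0 < mult x y) u v.

(* |E| - |V| + 1 = g, without truncated subtraction. *)
Definition has_genus G (g : nat) : Prop :=
  connected_graph G /\ num_edges G + 1 = g + #|G|.

Definition graph_iso G H : Prop :=
  exists f : G -> H, bijective f /\ forall u v, mult (f u) (f v) = mult u v.

Lemma del_vertex_sym G (v : G) (x y : {u : G | u != v}) :
  mult (val x) (val y) = mult (val y) (val x).
Proof. exact: mult_sym. Qed.

Definition del_vertex G (v : G) : mgraph :=
  @MGraph {u : G | u != v} (fun x y => mult (val x) (val y))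
    (@del_vertex_sym G v).

Lemma smooth_vertex_sym G (v a b : G) (x y : {u : G | u != v}) :
  mult (val x) (val y) +
    (((val x == a) && (val y == b)) || ((val x == b) && (val y == a))) =
  mult (val y) (val x) +
    (((val y == a) && (val x == b)) || ((val y == b) && (val x == a))).
Proof.
by rewrite mult_sym orbC (andbC (val x == b)) (andbC (val x == a)).
Qed.

(* Delete v and add one edge between a and b (a loop if a = b). *)
Definition smooth_vertex G (v a b : G) : mgraph :=
  @MGraph {u : G | u != v}
    (fun x y => mult (val x) (val y) +
      (((val x == a) && (val y == b)) || ((val x == b) && (val y == a))))
    (@smooth_vertex_sym G v a b).

Inductive pruned : mgraph -> mgraph -> Prop :=
| pruned_refl G : pruned G G
| pruned_step G (v : G) H :
    degree v = 1 -> pruned (del_vertex v) H -> pruned G H.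

(* The hypotheses on v say that it carries no loop and that its two incident
   edges are va and vb (a double edge if a = b). *)
Inductive smoothed : mgraph -> mgraph -> Prop :=
| smoothed_refl G : smoothed G G
| smoothed_step G (v a b : G) H :
    a != v -> b != v -> (forall u : G, mult v u = (u == a) + (u == b)) ->
    smoothed (smooth_vertex v a b) H -> smoothed G H.

Definition is_skeleton G K : Prop :=
  exists M : mgraph,
    [/\ pruned G M, forall v : M, degree v <> 1,
        smoothed M K & forall v : K, degree v <> 2].

End Graphs.

(** * Lattice polygons and their triangulations *)

Section Polygons.
Variable R : realType.

Definition conv_hull (E : lmodType R) (A : set E) : set E :=
  [set x | exists (n : nat) (w : 'I_n -> R) (p : 'I_n -> E),
     [/\ forall i, 0 <= w i, \sum_i w i = 1, forall i, A (p i) &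
         x = \sum_i w i *: p i]].

Definition real_pt (p : 'rV[int]_2) : 'rV[R]_2 := map_mx intr p.

Definition lattice_hull (s : {fset 'rV[int]_2}) : set 'rV[R]_2 :=
  conv_hull [set real_pt p | p in [set` s]].

Definition lattice_polygon (D : set 'rV[R]_2) : Prop :=
  (exists s : {fset 'rV[int]_2}, D = lattice_hull s) /\ interior D !=set0.

Definition polygon_genus (D : set 'rV[R]_2) (g : nat) : Prop :=
  [set p : 'rV[int]_2 | interior D (real_pt p)] #= `I_g.

Definition triangle_area (a b c : 'rV[int]_2) : rat :=
  `|\det (col_mx (b - a) (c - a) : 'M[int]_2)|%:~R / 2.

Definition unimodular_triangle (t : {fset 'rV[int]_2}) : Prop :=
  exists a b c : 'rV[int]_2,
    t = [fset a; b; c]%fset /\ triangle_area a b c = 1 / 2.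

(* A triangle is given by its set of vertices; its faces are the hulls of the
   subsets of this set. *)
Definition unimodular_triangulation (D : set 'rV[R]_2)
    (T : {fset {fset 'rV[int]_2}}) : Prop :=
  [/\ forall t, t \in T -> unimodular_triangle t,
      \bigcup_(t in [set` T]) lattice_hull t = D &
      forall t1 t2, t1 \in T -> t2 \in T ->
        exists s : {fset 'rV[int]_2},
          [/\ (s `<=` t1)%fset, (s `<=` t2)%fset &
              lattice_hull t1 `&` lattice_hull t2 = lattice_hull s]].

Definition lifted_polytope (D : set 'rV[R]_2) (h : 'rV[int]_2 -> R) :
    set 'rV[R]_(2 + 1) :=
  conv_hull [set row_mx (real_pt p) (h p)%:M | p in
               [set p : 'rV[int]_2 | D (real_pt p)]].

(* The nonempty faces of P cut out by non-vertical supporting planes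
   z = x *m l + c lying below P. *)
Definition lower_face (P F : set 'rV[R]_(2 + 1)) : Prop :=
  F !=set0 /\
  exists (l : 'cV[R]_2) (c : R),
    (forall q, P q -> (lsubmx q *m l) 0 0 + c <= rsubmx q 0 0) /\
    F = [set q | P q /\ rsubmx q 0 0 = (lsubmx q *m l) 0 0 + c].

Definition regular_triangulation (D : set 'rV[R]_2)
    (T : {fset {fset 'rV[int]_2}}) : Prop :=
  exists h : 'rV[int]_2 -> R,
    [set lsubmx @` F | F in lower_face (lifted_polytope D h)] =
    [set C | exists t s : {fset 'rV[int]_2},
       [/\ t \in T, (s `<=` t)%fset, s != fset0 & C = lattice_hull s]].

End Polygons.

(** * Troplanar graphs *)

Lemma dual_graph_sym (T : {fset {fset 'rV[int]_2}}) (t1 t2 : T) :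
  (#|` (val t1 `&` val t2)%fset| == 2%N) = (#|` (val t2 `&` val t1)%fset| == 2%N)
    :> nat.
Proof. by rewrite fsetIC. Qed.

(* The bounded part of the dual curve: two triangles of a triangulation share
   an edge exactly when they have two common vertices (no loops arise, as a
   triangle has three vertices). *)
Definition dual_graph (T : {fset {fset 'rV[int]_2}}) : mgraph :=
  @MGraph T (fun t1 t2 => #|` (val t1 `&` val t2)%fset| == 2%N)
    (@dual_graph_sym T).

Definition troplanar (R : realType) (G : mgraph) : Prop :=
  exists (D : set 'rV[R]_2) (g : nat) (T : {fset {fset 'rV[int]_2}})
         (K : mgraph),
    [/\ lattice_polygon D, polygon_genus D g & (2 <= g)%N] /\
    [/\ unimodular_triangulation D T, regular_triangulation D T,
        is_skeleton (dual_graph T) K & graph_iso G K].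

(* There is a complete system of N pairwise non-isomorphic representatives of
   the graphs satisfying P. *)
Definition num_iso_classes (P : mgraph -> Prop) (N : nat) : Prop :=
  exists G : 'I_N -> mgraph,
    [/\ forall i, P (G i), forall i j, graph_iso (G i) (G j) -> i = j &
        forall H, P H -> exists i, graph_iso H (G i)].

(* The value 0 would be taken by default if there were infinitely many
   isomorphism classes. *)
Definition num_troplanar (R : realType) (g : nat) : nat :=
  xget 0%N [set N | num_iso_classes (fun G => troplanar R G /\ has_genus G g) N].

(* f = Omega(k). *)
Definition is_Omega (R : realType) (f k : nat -> R) : Prop :=
  exists c : R, 0 < c /\ \forall g \near \oo, `|k g| <= c * f g.

(* Main.v *)
Require Import Defs.
From mathcomp Require Import all_boot all_order all_algebra finmap.
From mathcomp Require Import all_classical all_reals all_analysis.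
From mathcomp Require Import zify ring lra.

Set Implicit Arguments.
Unset Strict Implicit.
Unset Printing Implicit Defensive.

Import Order.TTheory GRing.Theory Num.Theory.
Import numFieldNormedType.Exports.

(** The lower bound comes from an explicit family of strip-shaped polygons.

    A strip is the region between the x-axis and a concave function that is
    affine on each interval [i, i+1] and has integral values at the integers.
    Cutting it along the vertical lines x = i into columns, a unimodular
    triangulation is obtained by choosing for each column a word that tells,
    from bottom to top, on which of its two lines the next triangle stands.
    All these triangulations are regular (strip_certificate,
    strip_triangulation): take a steep convex function of x and add on every
    line a convex function of y, such that the slopes on two neighbouring lines
    are interleaved as the word of their column prescribes. The dual graph
    consists of one path for each column and of one edge across every vertical
    unit segment (dual_strip).

    Away from its ends the strip has height 3. If the word of a column puts all
    the triangles on one line before those on the other, its path contributes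
    a bridge. So these columns cut the dual graph into blocks, joined in a chain
    by bridges (chain_words_iso), and the skeleton is found block by block
    (chain_smooth, core_skeleton). A block with k lines contributes 2k to the
    genus. Among the blocks with 1, 2 and 3 lines one finds, by computation, at
    least 2, 13 and 75 that are distinguished by the number of closed walks of
    length 10 at the vertex where the block is entered (catalogueP). Hence
    the number a_n of sequences of blocks with n lines in all satisfies
    a_(n+3) >= 2 a_(n+2) + 13 a_(n+1) + 75 a_n, whose characteristic
    polynomial is the given cubic, and a_n is at least a multiple of alpha^n
    (codes_growth). Such a sequence is completed by a cap at either end, the
    right one in two versions, to a graph of genus 2n + 3 or 2n + 4;
    therefore the growth in terms of the genus has the rate sqrt alpha.

    Different sequences give non-isomorphic graphs (family_inj). The left cap
    carries the only loop of the graph, and the blocks have no bridges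
    themselves, so that the number of edge cuts of size one that separate
    a vertex from the loop tells the index of its block (cut_rank_chain). An
    isomorphism therefore matches the blocks in order, together with their
    entries, and preserves the walks inside (chain_iso_walks).

    A number of pairwise non-isomorphic troplanar graphs bounds num_troplanar
    from below only because there are finitely many classes of each genus,
    which holds since degrees at least 3 bound the size of a skeleton
    (num_troplanar_ge). *)

(** * Isomorphisms, smoothing and degrees *)

Section GraphIso.
Local Open Scope nat_scope.
Implicit Types G H K : mgraph.

Lemma graph_iso_refl G : graph_iso G G.
Proof. by exists id; split=> //; exists id. Qed.

Lemma graph_iso_sym G H : graph_iso G H -> graph_iso H G.
Proof.
move=> [f [[g fK gK] fm]]; exists g; split; first by exists f.
by move=> u v; rewrite -fm !gK.
Qed.

Lemma graph_iso_trans G H K : graph_iso G H -> graph_iso H K -> graph_iso G K.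
Proof.
move=> [f [bf fm]] [g [bg gm]]; exists (g \o f); split; first exact: bij_comp.
by move=> u v; rewrite /= gm fm.
Qed.

Lemma graph_iso_card G H : graph_iso G H -> #|G| = #|H|.
Proof. by move=> [f [bf _]]; exact: bij_eq_card bf. Qed.

Lemma degree_iso G H (f : G -> H) :
  bijective f -> (forall u v, mult (f u) (f v) = mult u v) ->
  forall v, degree (f v) = degree v.
Proof.
move=> bf fm v; rewrite /degree fm; congr (_ + _).
by rewrite (reindex f) /=; [apply: eq_bigr => u _; rewrite fm | exact: onW_bij].
Qed.

Lemma smooth_vertex_iso G H (f : G -> H) (v a b : G) :
  bijective f -> (forall u w, mult (f u) (f w) = mult u w) ->
  graph_iso (smooth_vertex v a b) (smooth_vertex (f v) (f a) (f b)).
Proof.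
move=> [g fK gK] fm; have injf := can_inj fK.
have F (x : {u : G | u != v}) : f (val x) != f v.
  by rewrite (inj_eq injf) (valP x).
have B (y : {u : H | u != f v}) : g (val y) != v.
  by rewrite -(inj_eq injf) gK (valP y).
exists (fun x : smooth_vertex v a b => (Sub (f (val x)) (F x) : smooth_vertex _ _ _)).
split.
  exists (fun y : smooth_vertex (f v) (f a) (f b) => (Sub (g (val y)) (B y) : smooth_vertex _ _ _)).
    by move=> x; apply: val_inj; rewrite /= fK.
  by move=> x; apply: val_inj; rewrite /= gK.
by move=> x y /=; rewrite fm !(inj_eq injf).
Qed.

Lemma smoothed_iso G K : smoothed G K -> forall G', graph_iso G G' ->
  exists2 K', smoothed G' K' & graph_iso K K'.
Proof.
elim=> {G K} [G|G v a b K av bv vm _ IH] G' [f [bf fm]].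
  by exists G'; [exact: smoothed_refl | exists f].
have injf := bij_inj bf.
have [K' sK' iK'] := IH _ (smooth_vertex_iso v a b bf fm).
exists K' => //; apply: smoothed_step sK'; rewrite ?(inj_eq injf) //.
by move=> u; have [g fK gK] := bf; rewrite -[u]gK fm vm !(inj_eq injf).
Qed.

Lemma smoothed_trans G H K : smoothed G H -> smoothed H K -> smoothed G K.
Proof.
elim=> // {G H} G v a b H av bv vm _ IH sK.
exact: smoothed_step av bv vm (IH sK).
Qed.

(** Smoothing is only functional up to isomorphism, so that composing
    smoothings of isomorphic copies requires this closure. *)
Definition smooths_to G K := exists2 K', smoothed G K' & graph_iso K' K.

Lemma smooths_to_trans G H K : smooths_to G H -> smooths_to H K -> smooths_to G K.
Proof.
move=> [H' sH iH] [K' sK iK].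
have [K'' sK'' iK''] := smoothed_iso sK (graph_iso_sym iH).
exists K''; first exact: smoothed_trans sH sK''.
exact: graph_iso_trans (graph_iso_sym iK'') iK.
Qed.

Lemma smooths_to_iso G H : graph_iso G H -> smooths_to G H.
Proof. by exists G => //; exact: smoothed_refl. Qed.

(** The new edge restores at a and at b the end that was lost with v, so
    smoothing never changes the degree of a surviving vertex. *)
Lemma smooth_vertex_degree G (v a b : G) (x : smooth_vertex v a b) :
  a != v -> b != v -> (forall u : G, mult v u = (u == a) + (u == b)) ->
  degree x = degree (val x).
Proof.
move=> av bv vm; rewrite /degree /= big_split /=.
have sumE (F : G -> nat) :
    \sum_(u : G) F u = F v + \sum_(i : {u : G | u != v}) F (val i).
  rewrite (bigD1 v) //=; congr (_ + _).
  rewrite (reindex_omap (val : {u : G | u != v} -> G) insub) /=; last first.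
    by move=> i iv; rewrite insubT.
  by apply: eq_bigl => y; rewrite valK eqxx (valP y).
rewrite [in RHS]sumE (mult_sym (val x) v) vm.
set S := \sum_(j : {u : G | u != v}) mult (val x) (val j).
suff : \sum_(i : {u : G | u != v})
   ((val x == a) && (val i == b) || (val x == b) && (val i == a) : nat)
   + (((val x == a) && (val x == b)) || ((val x == b) && (val x == a)))
   = (val x == a) + (val x == b).
  rewrite /= => E; rewrite addnACA E; lia.
have one c : c != v -> \sum_(i : {u : G | u != v}) (val i == c : nat) = 1.
  move=> cv; rewrite (bigD1 (Sub c cv : {u : G | u != v})) //= eqxx big1 ?addn0 //.
  by move=> i ic; apply/eqP; rewrite eqb0; apply: contra ic => /eqP ic; apply/eqP/val_inj.
have zero : \sum_(i : {u : G | u != v}) 0 = 0 by rewrite big1.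
case: (eqVneq (val x) a) => [xa|xa]; case: (eqVneq (val x) b) => [xb|xb] /=.
- rewrite (eq_bigr (fun i : {u : G | u != v} => (val i == a) : nat)) ?one //.
  by move=> i _; rewrite -xa -xb orbb.
- by rewrite (eq_bigr (fun i : {u : G | u != v} => (val i == b) : nat)) ?one // => i _; rewrite orbF.
- by rewrite one.
- by rewrite zero.
Qed.

Lemma smoothed_degree1 G K : smoothed G K ->
  (forall v : G, degree v <> 1) -> forall v : K, degree v <> 1.
Proof.
elim=> // {G K} G v a b K av bv vm _ IH dG; apply: IH => x.
by rewrite (smooth_vertex_degree _ av bv vm); exact: dG.
Qed.

(** The loops count once in the sum over all ordered pairs and once more in
    the degree; the other edges are counted from both ends. *)
Lemma handshake G : \sum_(v : G) degree v = (num_edges G).*2.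
Proof.
rewrite /degree big_split /= /num_edges.
set D := \sum_(i : G) mult i i.
set A := \sum_(u : G) _; set F := \sum_(i : G) _.
(* L counts the edges that are not loops *)
pose L := \sum_(u : G) \sum_(v : G | enum_rank u < enum_rank v) mult u v.
have FE : F = L + D.
  rewrite /F /L /D -big_split /=; apply: eq_bigr => u _.
  rewrite (bigD1 u) //= addnC; congr (_ + _); apply: eq_bigl => v.
  by rewrite /= ltn_neqAle andbC (inj_eq val_inj) (inj_eq enum_rank_inj) eq_sym.
have LE : L = \sum_(u : G) \sum_(v : G | enum_rank v < enum_rank u) mult u v.
  rewrite /L (exchange_big_dep xpredT) //=.
  by apply: eq_bigr => u _; apply: eq_bigr => v _; exact: mult_sym.
have FA : A = F + L.
  rewrite /A /F LE -big_split /=; apply: eq_bigr => u _.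
  rewrite (bigID (fun v : G => enum_rank u <= enum_rank v)) /=; congr (_ + _).
  by apply: eq_bigl => v; rewrite -ltnNge.
lia.
Qed.

(** Degrees 1 and 2 are excluded in a skeleton, and by connectedness a vertex
    of degree 0 would be the whole graph, of genus 0. *)
Lemma skeleton_degree_ge3 H G K g : is_skeleton H K -> graph_iso G K ->
  has_genus G g -> 2 <= g -> forall v : G, 3 <= degree v.
Proof.
move=> [M [_ dM sK d2]] [f [bf fm]] [[_ Gc] Gg] g2 v.
have d1 : degree (f v) <> 1 by exact: (smoothed_degree1 sK dM).
have {d2} d2 := d2 (f v); rewrite (degree_iso bf fm) in d1 d2.
case: (degree v =P 0) => [d0|]; last by move: d1 d2; case: (degree v) => [|[|[|]]].
have m0 u : mult v u = 0.
  by move/eqP: d0; rewrite addn_eq0 sum_nat_eq0 => /andP[/forallP/(_ u)/eqP].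
have all_v u : u = v.
  have /connectP[p] := Gc v u; case: p => [|x p] /= ; first by move=> _ ->.
  by rewrite m0.
have c1 : #|G| = 1 by apply/eqP/fintype1P; exists v => u; exact: all_v.
have : num_edges G = 0.
  by rewrite /num_edges big1 // => u _; rewrite big1 // => w _; rewrite (all_v u) m0.
lia.
Qed.

(** Minimal degree 3 gives 3|V| <= 2|E|, hence |V| <= 2(g-1) and |E| <= 3(g-1):
    all skeletons of a given genus are bounded in size and multiplicity. *)
Lemma skeleton_card H G K g : is_skeleton H K -> graph_iso G K ->
  has_genus G g -> 2 <= g -> #|G| <= g.*2 /\ forall u v : G, mult u v <= 6 * g.
Proof.
move=> skel iso hg g2; have d3 := skeleton_degree_ge3 skel iso hg g2.
have [_ Gg] := hg; have hs := handshake G.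
have le3 : #|G| * 3 <= (num_edges G).*2.
  by rewrite -hs -sum_nat_const; apply: leq_sum => v _; exact: d3.
have dle (v : G) : degree v <= (num_edges G).*2 by rewrite -hs (bigD1 v) //= leq_addr.
have cG : #|G| <= g.*2 by lia.
split=> // u v; have mle : mult u v <= degree u.
  by rewrite /degree (bigD1 v) //= -addnA leq_addr.
apply: leq_trans mle (leq_trans (dle u) _); lia.
Qed.

End GraphIso.

(** * Finitely many isomorphism classes in each genus *)

Section Counting.
Local Open Scope nat_scope.

Section Encoding.
Variable B : nat.

(** A graph with at most B vertices and multiplicities at most B is determined
    up to isomorphism by its adjacency table along the enumeration of its
    vertices, and there are finitely many such tables. *)
Definition encode (G : mgraph) : 'I_B.+1 * {ffun 'I_B * 'I_B -> 'I_B.+1} :=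
  (inord #|G|, [ffun p : 'I_B * 'I_B => inord
     (if (insub (p.1 : nat), insub (p.2 : nat)) is (Some i, Some j)
      then mult (enum_val (i : 'I_#|G|)) (enum_val (j : 'I_#|G|)) else 0)]).

Definition bounded (G : mgraph) := #|G| <= B /\ forall u v : G, mult u v <= B.

Lemma encode_iso G H : bounded G -> bounded H -> encode G = encode H ->
  graph_iso G H.
Proof.
move=> [cG mG] [cH mH] [e1 e2].
have e : #|G| = #|H| by move/(congr1 val): e1; rewrite /= !inordK.
exists (fun x => enum_val (cast_ord e (enum_rank x))); split.
  exists (fun y => enum_val (cast_ord (esym e) (enum_rank y))) => x.
    by rewrite enum_valK cast_ordK enum_rankK.
  by rewrite enum_valK cast_ordKV enum_rankK.
move=> u v.
have lt (x : G) : enum_rank x < B by apply: leq_trans cG; exact: ltn_ord.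
move/ffunP: e2 => /(_ (Ordinal (lt u), Ordinal (lt v))).
rewrite !ffunE /= !insubT; try (by rewrite -?e; exact: ltn_ord).
move=> h1 h2 h3 h4 /(congr1 val) /=.
rewrite !inordK ?ltnS //.
rewrite [X in mult X _ = _](_ : _ = u); last first.
  by apply/(canLR enum_rankK)/val_inj.
rewrite [X in mult _ X = _](_ : _ = v); last first.
  by apply/(canLR enum_rankK)/val_inj.
move=> ->; congr mult; congr enum_val; exact: val_inj.
Qed.

Lemma bounded_iso G H : bounded G -> graph_iso G H -> bounded H.
Proof.
move=> [cG mG] iso; split; first by rewrite -(graph_iso_card iso).
case: iso => f [[g fK gK] fm] u v; by rewrite -(gK u) -(gK v) fm.
Qed.

(** Different enumerations of one graph give different tables; the set of all
    tables of its copies is a complete invariant with finitely many values. *)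
Definition iso_codes (G : mgraph) :=
  [set x | `[< exists2 H, graph_iso G H & encode H = x >]].

Lemma iso_codes_eq G H : graph_iso G H -> iso_codes G = iso_codes H.
Proof.
move=> iso; apply/setP => x; rewrite !inE; apply/asboolP/asboolP => -[K iK <-];
  exists K => //; last exact: graph_iso_trans iK.
exact: graph_iso_trans (graph_iso_sym iso) iK.
Qed.

Lemma iso_codesP G H : bounded G -> bounded H -> iso_codes G = iso_codes H ->
  graph_iso G H.
Proof.
move=> bG bH /setP/(_ (encode G)); rewrite !inE.
have -> : `[< exists2 H0, graph_iso G H0 & encode H0 = encode G >] = true.
  by apply/asboolP; exists G => //; exact: graph_iso_refl.
move/esym/asboolP => [K iK eK].
have bK := bounded_iso bH iK.
exact: graph_iso_trans (encode_iso bG bK (esym eK)) (graph_iso_sym iK).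
Qed.

Lemma finite_iso_classes (P : mgraph -> Prop) :
  (forall G, P G -> bounded G) -> exists N, num_iso_classes P N.
Proof.
move=> bP.
pose A := [set y | `[< exists2 G, P G & iso_codes G = y >]].
have repr (i : 'I_#|A|) : exists G, P G /\ iso_codes G = enum_val i.
  by have := enum_valP i; rewrite inE => /asboolP[G PG eG]; exists G.
have [K KP] := choice repr.
exists #|A|, K; split.
- by move=> i; have [] := KP i.
- move=> i j /iso_codes_eq; have [_ ->] := KP i; have [_ ->] := KP j.
  exact: enum_val_inj.
- move=> H PH; have HA : iso_codes H \in A by rewrite inE; apply/asboolP; exists H.
  exists (enum_rank_in HA (iso_codes H)).
  have [PK eK] := KP (enum_rank_in HA (iso_codes H)).
  apply: iso_codesP; [exact: bP | exact: bP |].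
  by rewrite eK enum_rankK_in.
Qed.

End Encoding.

Lemma num_iso_classes_ge (P : mgraph -> Prop) N n (K : 'I_n -> mgraph) :
  num_iso_classes P N -> (forall i, P (K i)) ->
  (forall i j, graph_iso (K i) (K j) -> i = j) -> n <= N.
Proof.
move=> [G [_ _ GP]] PK injK.
have [f fP] := choice (fun i => GP _ (PK i)).
have injf : injective f.
  move=> i j fij; apply: injK; apply: graph_iso_trans (fP i) _.
  by rewrite fij; exact: graph_iso_sym.
by have := leq_card f injf; rewrite !card_ord.
Qed.

(** The value of num_troplanar is meaningful because skeleton_card leaves
    finitely many classes; otherwise it could be the default value. *)
Lemma num_troplanar_ge (R : realType) g n (K : 'I_n -> mgraph) : 2 <= g ->
  (forall i, troplanar R (K i) /\ has_genus (K i) g) ->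
  (forall i j, graph_iso (K i) (K j) -> i = j) -> n <= num_troplanar R g.
Proof.
move=> g2 PK injK.
apply: num_iso_classes_ge PK injK.
have [N NP] : exists N,
    num_iso_classes (fun G => troplanar R G /\ has_genus G g) N.
  (* 6 g bounds both the number of vertices and the multiplicities *)
  apply: (@finite_iso_classes (6 * g)) => G [[D [g' [T [K' [_ [_ _ skel iso]]]]]] hg].
  have [cG mG] := skeleton_card skel iso hg g2.
  by split=> //; apply: leq_trans cG _; lia.
exact: (xgetPex 0 (ex_intro _ N NP)).
Qed.

End Counting.

(** * Graphs given by a list of labels and a list of edges *)

Section ListGraphs.
Local Open Scope nat_scope.

Lemma map_uniq_inj (T T' : eqType) (f : T -> T') s : uniq (map f s) -> {in s &, injective f}.
Proof.
move=> u x y /(nthP x)[i il <-] /(nthP x)[j jl <-] e.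
congr nth; apply/eqP; rewrite -(nth_uniq (f x) _ _ u) ?size_map //.
by rewrite !(nth_map x) // e.
Qed.

Lemma inj_surj_bij (T T' : finType) (f : T -> T') :
  injective f -> (forall y, exists x, f x = y) -> bijective f.
Proof.
move=> injf surj; have ex y : exists x, f x == y by have [x fx] := surj y; exists x; apply/eqP.
apply: inj_card_bij => //; apply: (leq_card (fun y => xchoose (ex y))) => y y' e.
by rewrite -(eqP (xchooseP (ex y))) e (eqP (xchooseP (ex y'))).
Qed.

Section Joins.
Variable T : eqType.
Definition joins (e : T * T) (x y : T) : bool := (e == (x, y)) || (e == (y, x)).

Lemma joins_sym e x y : joins e x y = joins e y x.
Proof. exact: orbC. Qed.
End Joins.

Section EdgeSums.
Variable T : finType.
Implicit Types a b x y : T.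

Lemma joins_degree a b v :
  \sum_(u : T) joins (a, b) v u + joins (a, b) v v = (a == v) + (b == v).
Proof.
have one c : \sum_(u : T) (c == u : nat) = 1.
  by rewrite (bigD1 c) //= eqxx big1 // => i ic; rewrite eq_sym (negbTE ic).
rewrite /joins (eq_bigr (fun u => ((a == v) && (b == u)) || ((a == u) && (b == v)) : nat)); last first.
  by move=> u _; rewrite !xpair_eqE.
rewrite !xpair_eqE; case: (eqVneq a v) => [->|av]; case: (eqVneq b v) => [->|bv] /=.
- rewrite (eq_bigr (fun u => (v == u) : nat)) ?one // => u _.
  by rewrite andbT orbb.
- by rewrite (eq_bigr (fun u => (b == u) : nat)) ?one // => u _; rewrite andbF orbF.
- by rewrite (eq_bigr (fun u => (a == u) : nat)) ?one // => u _; rewrite andbT.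
- by rewrite big1 // => u _; rewrite andbF.
Qed.

(** A single edge contributes to a cut exactly when its ends are on
    different sides; cuts are then counted edge by edge. *)
Lemma joins_cut a b (S : {set T}) :
  \sum_(x in S) \sum_(y | y \notin S) joins (a, b) x y
  = ((a \in S) != (b \in S)) :> nat.
Proof.
have off x y : a \in S = (b \in S) -> x \in S -> y \notin S -> joins (a, b) x y = false.
  move=> ab xS yS; apply/negbTE/negP; rewrite /joins !xpair_eqE => /orP[]/andP[/eqP ea /eqP eb].
    by move: yS; rewrite -eb -ab ea xS.
  by move: yS; rewrite -ea ab eb xS.
case: (boolP (a \in S)) => aS; case: (boolP (b \in S)) => bS /=.
- rewrite big1 // => x xS; rewrite big1 // => y yS.
  by rewrite off // aS bS.
- rewrite (bigD1 a) //= (bigD1 b) //= {1}/joins eqxx /= !big1 //.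
    move=> x /andP[xS xa]; rewrite big1 // => y yS.
    rewrite /joins !xpair_eqE; apply/eqP; rewrite eqb0 negb_or !negb_and.
    rewrite eq_sym xa /=; apply/orP; left; apply: contraNneq yS => <- //.
  move=> y /andP[yS yb]; rewrite /joins !xpair_eqE eqxx /= eq_sym (negbTE yb) /=.
  by apply/eqP; rewrite eqb0 negb_and; apply/orP; right; apply: contraNneq bS => ->.
- rewrite (bigD1 b) //= (bigD1 a) //= {1}/joins eqxx orbT /= !big1 //.
    move=> x /andP[xS xb]; rewrite big1 // => y yS.
    rewrite /joins !xpair_eqE; apply/eqP; rewrite eqb0 negb_or !negb_and.
    rewrite [b == x]eq_sym xb orbT andbT.
    by apply/orP; left; apply: contraNneq aS => ->.
  move=> y /andP[yS ya]; rewrite /joins !xpair_eqE eqxx andbT /= [a == y]eq_sym (negbTE ya) /=.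
  by apply/eqP; rewrite orbF eqb0 negb_and; apply/orP; left; apply: contraNneq aS => ->.
- rewrite big1 // => x xS; rewrite big1 // => y yS.
  by rewrite off // (negbTE aS) (negbTE bS).
Qed.

Lemma joins_once a b :
  \sum_(u : T) \sum_(v : T | enum_rank u <= enum_rank v) joins (a, b) u v = 1.
Proof.
wlog ab : a b / enum_rank a <= enum_rank b.
  move=> W; case/orP: (leq_total (enum_rank a) (enum_rank b)) => ab; first exact: W.
  rewrite -(W _ _ ab); apply: eq_bigr => u _; apply: eq_bigr => v _.
  by rewrite /joins !xpair_eqE orbC [(b == v) && _]andbC [(b == u) && _]andbC.
rewrite (bigD1 a) //= (bigD1 b) //= {1}/joins eqxx /= !big1 //.
  move=> u ua; rewrite big1 // => v uv.
  apply/eqP; rewrite eqb0 /joins !xpair_eqE negb_or !negb_and eq_sym ua /=.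
  case: (eqVneq a v) => //= av; apply: contraNneq ua => bu.
  rewrite bu in ab; rewrite -av in uv.
  by apply/eqP/enum_rank_inj/val_inj/anti_leq; rewrite /= uv ab.
move=> v /andP[av vb]; apply/eqP; rewrite eqb0 /joins !xpair_eqE eqxx /=.
rewrite [b == v]eq_sym (negbTE vb) /=; apply: contra vb => /andP[/eqP <- /eqP ->] //.
Qed.
End EdgeSums.
End ListGraphs.

Section LGraph.
Local Open Scope nat_scope.

Section Seq.
Variable L : eqType.
Implicit Types (E : seq (L * L)) (V : seq L) (x y v : L).

Definition nedges E x y : nat := count (fun e => joins e x y) E.

Lemma nedges_sym E x y : nedges E x y = nedges E y x.
Proof. by apply: eq_count => e; exact: joins_sym. Qed.

Lemma nedges_cat E F x y : nedges (E ++ F) x y = nedges E x y + nedges F x y.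
Proof. exact: count_cat. Qed.

Lemma nedges_perm E F x y : perm_eq E F -> nedges E x y = nedges F x y.
Proof. by move/permP; exact. Qed.

Definition edges_in V E := all (fun e => (e.1 \in V) && (e.2 \in V)) E.

Lemma edges_inP V E : reflect (forall e, e \in E -> e.1 \in V /\ e.2 \in V) (edges_in V E).
Proof.
apply: (iffP allP) => H e /H; first by move/andP.
by move=> [-> ->].
Qed.

Definition edge_degree E v : nat :=
  count (fun e => e.1 == v) E + count (fun e => e.2 == v) E.

Definition crossings (S : pred L) E : nat := count (fun e => S e.1 != S e.2) E.
End Seq.

Lemma nedges_map (L L' : eqType) (f : L -> L') (V : seq L) E x y :
  {in V &, injective f} -> edges_in V E -> x \in V -> y \in V ->
  nedges [seq (f e.1, f e.2) | e <- E] (f x) (f y) = nedges E x y.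
Proof.
move=> injf /edges_inP EV xV yV; rewrite /nedges count_map; apply: eq_in_count.
move=> [a b] /EV /= [aV bV]; rewrite /joins !xpair_eqE.
have fE u v : u \in V -> v \in V -> (f u == f v) = (u == v).
  by move=> uV vV; apply/eqP/eqP => [/injf->|->].
by rewrite !fE.
Qed.

Section Graph.
Variable L : choiceType.
Implicit Types (E : seq (L * L)) (V : seq L).

(** Loops and multiple edges are allowed: repeated edges in E are counted
    with multiplicity, and an edge with equal ends is a loop. *)
Definition lgraph V E : mgraph :=
  @MGraph (seq_sub V) (fun x y => nedges E (val x) (val y))
    (fun x y => nedges_sym E (val x) (val y)).

Lemma card_lgraph V E : uniq V -> #|lgraph V E| = size V.
Proof. exact: card_seq_sub. Qed.

(** Degrees, numbers of edges and cuts are all additive in the list of edges,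
    so each is computed by adding one edge between genuine vertices. *)
Lemma edges_ind V (P : seq (L * L) -> Prop) : P [::] ->
  (forall (a b : seq_sub V) E, P E -> P ((val a, val b) :: E)) ->
  forall E, edges_in V E -> P E.
Proof.
move=> P0 PS; elim=> [|[a b] E IH] //= /andP[/andP[aV bV] EV].
exact: (PS (Sub a aV) (Sub b bV) E (IH EV)).
Qed.

Lemma joins_val V (a b x y : seq_sub V) :
  joins (val a, val b) (val x) (val y) = joins (a, b) x y.
Proof. by rewrite /joins !xpair_eqE !(inj_eq val_inj). Qed.

Lemma degree_lgraph V E (x : lgraph V E) : edges_in V E ->
  degree x = edge_degree E (val x).
Proof.
suff H : forall E, edges_in V E -> forall x : seq_sub V,
    \sum_(u : seq_sub V) nedges E (val x) (val u) + nedges E (val x) (val x)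
    = edge_degree E (val x) by move=> EV; exact: H.
apply: edges_ind => [y|a b {}E IH {}x]; first by rewrite big1.
rewrite (eq_bigr (fun u : seq_sub V => joins (a, b) x u + nedges E (val x) (val u))); last first.
  by move=> u _; rewrite /nedges /= joins_val.
rewrite big_split /= joins_val addnACA joins_degree IH /edge_degree /=.
by rewrite !(inj_eq val_inj) addnACA.
Qed.

Lemma num_edges_lgraph V E : edges_in V E -> num_edges (lgraph V E) = size E.
Proof.
rewrite /num_edges /=; move: E; apply: edges_ind => [|a b E IH].
  by rewrite big1 // => u _; rewrite big1.
rewrite (eq_bigr (fun u : seq_sub V => \sum_(v : seq_sub V | enum_rank u <= enum_rank v) joins (a, b) u v
   + \sum_(v : seq_sub V | enum_rank u <= enum_rank v) nedges E (val u) (val v))); last first.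
  move=> u _; rewrite -big_split /=; apply: eq_bigr => v _.
  by rewrite /nedges /= joins_val.
by rewrite big_split /= joins_once IH.
Qed.

Definition edge_cut (G : mgraph) (S : {set G}) : nat :=
  \sum_(x in S) \sum_(y | y \notin S) mult x y.

Lemma cut_lgraph V E (S : {set lgraph V E}) (P : pred L) : edges_in V E ->
  (forall x : lgraph V E, (x \in S) = P (val x)) ->
  edge_cut S = crossings P E.
Proof.
suff H : forall E, edges_in V E -> forall S' : {set seq_sub V},
    (forall x : seq_sub V, (x \in S') = P (val x)) ->
    \sum_(x in S') \sum_(y | y \notin S') nedges E (val x) (val y)
    = crossings P E by move=> EV; exact: H.
apply: edges_ind => [{}S SP|a b {}E IH {}S SP].
  by rewrite big1 // => u _; rewrite big1.
rewrite (eq_bigr (fun u : seq_sub V => \sum_(v : seq_sub V | v \notin S) joins (a, b) u v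
   + \sum_(v : seq_sub V | v \notin S) nedges E (val u) (val v))); last first.
  move=> u _; rewrite -big_split /=; apply: eq_bigr => v _.
  by rewrite /nedges /= joins_val.
by rewrite big_split /= joins_cut (IH S SP) /crossings /= !SP.
Qed.

(** Apply the hypothesis to the set of vertices reachable from u: no edge
    leaves it. *)
Lemma lgraph_connected V E : edges_in V E -> 0 < size V ->
  (forall P : pred L, crossings P E = 0 -> {in V &, forall x y, P x = P y}) ->
  connected_graph (lgraph V E).
Proof.
move=> EV V0 cE; have [v0 v0V] : exists v, v \in V.
  by case: {+}V V0 => // v V' _; exists v; rewrite mem_head.
split; first by apply/card_gt0P; exists (Sub v0 v0V).
move=> u v; set r := fun x y : lgraph V E => _.
pose P x := if insub x is Some x' then connect r u (x' : seq_sub V) else false.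
have symr x y : r x y = r y x by rewrite /r mult_sym.
have Pv (x : seq_sub V) : P (val x) = connect r u x by rewrite /P valK.
have : P (val u) = P (val v).
  apply: cE (valP u) (valP v); apply/eqP; rewrite -leqn0 leqNgt -has_count.
  apply/hasPn => -[a b] eE /=; rewrite negbK.
  have /(edges_inP _ _)/(_ _ eE) /= [aV bV] := EV.
  rewrite -[a]/(val (Sub a aV : seq_sub V)) -[b]/(val (Sub b bV : seq_sub V)) !Pv.
  have rab : r (Sub a aV) (Sub b bV).
    by rewrite /r /= -has_count; apply/hasP; exists (a, b); rewrite // /joins eqxx.
  apply/eqP; apply/idP/idP => h; apply: connect_trans h (connect1 _) => //.
  by rewrite symr.
by rewrite !Pv connect0 => <-.
Qed.

End Graph.

Lemma lgraph_iso (L L' : choiceType) (f : L -> L') V E V' E' :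
  {in V &, injective f} -> map f V =i V' ->
  {in V &, forall x y, nedges E' (f x) (f y) = nedges E x y} ->
  graph_iso (lgraph V E) (lgraph V' E').
Proof.
move=> injf VV' fE.
have F (x : seq_sub V) : f (val x) \in V' by rewrite -VV' map_f // (valP x).
pose g (x : lgraph V E) : lgraph V' E' := Sub (f (val x)) (F x).
exists g; split; last by move=> u v; rewrite /= fE // ?(valP u) ?(valP v).
apply: inj_surj_bij => [x y|y].
  by move=> /(congr1 val) /= /injf e; apply: val_inj; apply: e; exact: valP.
have := valP y; rewrite -VV' => /mapP[x xV e].
by exists (Sub x xV); apply: val_inj; rewrite /= -e.
Qed.

Lemma lgraph_perm (L : choiceType) (V V' : seq L) E E' :
  perm_eq V V' -> perm_eq E E' -> graph_iso (lgraph V E) (lgraph V' E').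
Proof.
move=> VV' EE'; apply: (@lgraph_iso _ _ id) => //.
  by move=> x; rewrite map_id (perm_mem VV').
by move=> x y _ _; exact/esym/nedges_perm.
Qed.

Section Smooth.
Variable L : choiceType.
Implicit Types (E : seq (L * L)) (V : seq L).

Definition touches (v : L) (e : L * L) := (e.1 == v) || (e.2 == v).
Definition opposite (v : L) (e : L * L) := if e.1 == v then e.2 else e.1.

(** The value is meaningful when exactly two edges meet v and neither is a
    loop, which smoothable ensures. *)
Definition smooth1 v E := let rest := [seq e <- E | ~~ touches v e] in
  if [seq e <- E | touches v e] is [:: e1; e2]
  then (opposite v e1, opposite v e2) :: rest else rest.

Definition smoothable v E :=
  if [seq e <- E | touches v e] is [:: e1; e2]
  then (opposite v e1 != v) && (opposite v e2 != v) else false.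

Lemma joins_touch v e u : opposite v e != v ->
  joins e v u = touches v e && (u == opposite v e).
Proof.
case: e => [a b]; rewrite /joins /touches /opposite /= !xpair_eqE.
case: (eqVneq a v) => [->|av] /=.
  by move=> bv; rewrite (negbTE bv) andbF orbF eq_sym.
by move=> _; rewrite andbC eq_sym [a == u]eq_sym.
Qed.

(** These are the hypotheses of a smoothing step and the description of its
    result, expressed by multiplicities instead of lists. *)
Lemma smooth1_nedges v E : smoothable v E -> exists a b,
  [/\ a != v, b != v, (exists2 e, e \in E & (e.1 == a) || (e.2 == a)),
      (exists2 e, e \in E & (e.1 == b) || (e.2 == b)) &
      (forall u, nedges E v u = (u == a) + (u == b)) /\
      (forall x y, x != v -> y != v ->
         nedges (smooth1 v E) x y = nedges E x y + joins (a, b) x y)].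
Proof.
rewrite /smoothable /smooth1.
case eF: [seq e <- E | touches v e] => [|e1 [|e2 [|e3 F]]] // /andP[a1 a2].
have nE x y : nedges E x y = joins e1 x y + joins e2 x y
    + nedges [seq e <- E | ~~ touches v e] x y.
  have /permPl pE := perm_filterC (touches v) E.
  by rewrite -(nedges_perm _ _ pE) eF nedges_cat /nedges /= addn0.
have [t1 m1] : touches v e1 /\ e1 \in E.
  by have : e1 \in [seq e <- E | touches v e]; [rewrite eF mem_head | rewrite mem_filter => /andP[]].
have [t2 m2] : touches v e2 /\ e2 \in E.
  by have : e2 \in [seq e <- E | touches v e]; [rewrite eF !inE eqxx orbT | rewrite mem_filter => /andP[]].
have restv x y : (x == v) || (y == v) -> nedges [seq e <- E | ~~ touches v e] x y = 0.
  move=> xy; apply/eqP; rewrite -leqn0 leqNgt -has_count; apply/hasPn => -[a b].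
  rewrite mem_filter /touches /= => /andP[+ _]; apply: contra.
  rewrite /joins !xpair_eqE; case/orP: xy => /eqP<- /orP[]/andP[/eqP-> /eqP->];
    by rewrite eqxx ?orbT.
exists (opposite v e1), (opposite v e2); split=> //.
- by exists e1 => //; rewrite /opposite; case: ifP => _; rewrite eqxx ?orbT.
- by exists e2 => //; rewrite /opposite; case: ifP => _; rewrite eqxx ?orbT.
split=> [u|x y xv yv].
  by rewrite nE !joins_touch // t1 t2 restv ?eqxx // addn0.
have tf e : touches v e -> joins e x y = false.
  case: e => a b; rewrite /touches /joins !xpair_eqE /=.
  by case/orP=> /eqP->; rewrite ![v == _]eq_sym (negbTE xv) (negbTE yv) ?andbF.
by rewrite nE (tf e1) // (tf e2) //= /nedges /= add0n addnC.
Qed.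

Lemma smooth1_edges_in V v E : edges_in V E -> smoothable v E ->
  edges_in [seq x <- V | x != v] (smooth1 v E).
Proof.
move=> /edges_inP EV; rewrite /smoothable /smooth1.
case eF: [seq e <- E | touches v e] => [|e1 [|e2 [|e3 F]]] // /andP[a1 a2].
have m e : e \in [seq e <- E | touches v e] -> opposite v e \in V.
  rewrite mem_filter => /andP[_ /EV[]]; rewrite /opposite; by case: ifP.
rewrite /edges_in /= !mem_filter a1 a2 !m ?eF ?inE ?eqxx ?orbT //=.
apply/allP => e; rewrite !mem_filter negb_or => /andP[/andP[-> ->] /EV[-> ->]] //.
Qed.

Lemma smooth1_lgraph V E v : v \in V -> edges_in V E ->
  smoothable v E ->
  smooths_to (lgraph V E) (lgraph [seq x <- V | x != v] (smooth1 v E)).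
Proof.
move=> vV EV sv; have [a [b [av bv [ea eaE ea1] [eb ebE eb1] [vE sE]]]] := smooth1_nedges sv.
have aV : a \in V.
  by have /edges_inP/(_ _ eaE)[] := EV; case/orP: ea1 => /eqP->.
have bV : b \in V.
  by have /edges_inP/(_ _ ebE)[] := EV; case/orP: eb1 => /eqP->.
pose G := lgraph V E.
pose v' : G := Sub v vV; pose a' : G := Sub a aV; pose b' : G := Sub b bV.
have st : smoothed (smooth_vertex v' a' b') (smooth_vertex v' a' b') by exact: smoothed_refl.
exists (smooth_vertex v' a' b').
  apply: smoothed_step st => //.
  by move=> u /=; rewrite vE -!(inj_eq val_inj).
have F (x : {u : G | u != v'}) : val (val x) \in [seq x <- V | x != v].
  rewrite mem_filter (valP (val x : seq_sub V)) andbT.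
  by have := valP x; rewrite -(inj_eq val_inj).
pose g (x : smooth_vertex v' a' b') : lgraph [seq x <- V | x != v] (smooth1 v E) :=
  Sub (val (val x)) (F x).
exists g; split; last first.
  move=> x y /=; have xv : val (val x) != v by have := valP x; rewrite -(inj_eq val_inj).
  have yv : val (val y) != v by have := valP y; rewrite -(inj_eq val_inj).
  rewrite sE // /joins !xpair_eqE; congr (_ + _); rewrite -!(inj_eq val_inj) /=.
  by congr (nat_of_bool (_ || _)); rewrite ![_ == ssval _]eq_sym // andbC.
apply: inj_surj_bij => [x y /(congr1 val) /= /val_inj /val_inj //|y].
have := valP y; rewrite mem_filter => /andP[yv yV].
have yv' : (Sub (val y) yV : G) != v' by rewrite -(inj_eq val_inj).
by exists (exist (fun u : G => u != v') (Sub (val y) yV) yv'); apply: val_inj.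
Qed.

Definition smooth_seq vs E := foldl (fun E v => smooth1 v E) E vs.
Fixpoint smoothable_seq vs E :=
  if vs is v :: vs' then smoothable v E && smoothable_seq vs' (smooth1 v E) else true.

Lemma smooth_seq_lgraph vs V E : uniq vs -> {subset vs <= V} ->
  edges_in V E -> smoothable_seq vs E ->
  smooths_to (lgraph V E) (lgraph [seq x <- V | x \notin vs] (smooth_seq vs E)).
Proof.
elim: vs V E => [|v vs IH] V E /=.
  by rewrite filter_predT => _ _ _ _; exact/smooths_to_iso/graph_iso_refl.
move=> /andP[vvs uvs] sV EV /andP[sv svs].
have vV : v \in V by apply: sV; rewrite mem_head.
apply: smooths_to_trans (smooth1_lgraph vV EV sv) _.
have := IH [seq x <- V | x != v] (smooth1 v E) uvs _ (smooth1_edges_in EV sv) svs.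
rewrite -filter_predI; rewrite [X in lgraph X (smooth_seq _ _)](eq_filter (a2 := fun x => x \notin v :: vs)); last first.
  by move=> x; rewrite /= inE negb_or andbC.
apply=> x xvs; rewrite mem_filter sV ?inE ?xvs ?orbT // andbT.
by apply: contraNneq vvs => <-.
Qed.

End Smooth.
End LGraph.

(** * Chains of pieces joined by bridges *)

Section Chains.
Local Open Scope nat_scope.
Variable L : choiceType.

(** A finite graph with two marked vertices, where the previous and the next
    piece of a chain are attached. *)
Record piece := Piece { pV : seq L; pE : seq (L * L); pin : L; pout : L }.

Definition lift_edge (k : nat) (e : L * L) := ((k, e.1), (k, e.2)).

Fixpoint chainV k (ps : seq piece) : seq (nat * L) :=
  if ps is p :: ps' then [seq (k, x) | x <- pV p] ++ chainV k.+1 ps' else [::].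

Definition bridges k p (ps : seq piece) : seq ((nat * L) * (nat * L)) :=
  if ps is q :: _ then [:: ((k, pout p), (k.+1, pin q))] else [::].

(** The label of a vertex of a chain records the index of its piece, so
    that equal labels in different pieces do not interfere. *)
Fixpoint chainE k (ps : seq piece) : seq ((nat * L) * (nat * L)) :=
  if ps is p :: ps' then map (lift_edge k) (pE p) ++ bridges k p ps' ++ chainE k.+1 ps'
  else [::].

Definition well_formed p :=
  [&& uniq (pV p), edges_in (pV p) (pE p), pin p \in pV p & pout p \in pV p].

(** Equivalently, the piece is connected and has no bridge. *)
Definition tight p := forall S : pred L,
  {in pV p &, forall x y, S x = S y} \/ 2 <= crossings S (pE p).

Implicit Types (p q : piece) (ps : seq piece).

Lemma chainV_ge k ps v : v \in chainV k ps -> k <= v.1.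
Proof.
elim: ps k => // p ps IH k; rewrite /= mem_cat => /orP[/mapP[x _ ->] //|/IH].
exact: ltnW.
Qed.

Lemma chainV_lt k ps v : v \in chainV k ps -> v.1 < k + size ps.
Proof.
elim: ps k => // p ps IH k; rewrite /= mem_cat => /orP[/mapP[x _ ->]|/IH] /=.
  by rewrite -addSnnS leq_addr.
by rewrite addSnnS.
Qed.

Lemma chainV_uniq k ps : all well_formed ps -> uniq (chainV k ps).
Proof.
elim: ps k => // p ps IH k /= /andP[/and4P[uV _ _ _] wps].
rewrite cat_uniq map_inj_uniq ?uV ?IH //=; last by move=> x y [].
rewrite andbT; apply/hasPn => v /chainV_ge kv; apply/mapP => -[x _ e].
by rewrite e ltnn in kv.
Qed.

Lemma chainV_size k ps : size (chainV k ps) = sumn [seq size (pV p) | p <- ps].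
Proof. by elim: ps k => // p ps IH k; rewrite /= size_cat size_map IH. Qed.

Lemma chainE_size k ps :
  size (chainE k ps) = sumn [seq size (pE p) | p <- ps] + (size ps).-1.
Proof.
elim: ps k => // p ps IH k; rewrite /= !size_cat size_map IH -addnA.
by case: ps {IH} => [|q ps] /=; lia.
Qed.

Lemma chain_edges_in k ps : all well_formed ps -> edges_in (chainV k ps) (chainE k ps).
Proof.
elim: ps k => // p ps IH k /= /andP[/and4P[_ /edges_inP EV pi po] wps].
apply/edges_inP => e; rewrite !mem_cat => /or3P[].
- by move=> /mapP[[a b] /EV /= [aV bV] ->] /=; rewrite !map_f.
- case: ps wps {IH} => //= q ps /andP[/and4P[_ _ qi _] _].
  by rewrite inE => /eqP-> /=; rewrite !mem_cat; split; rewrite ?(map_f (pair k) po) ?(map_f (pair k.+1) qi) ?orbT.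
- by move=> eE; have /edges_inP/(_ _ eE)[-> ->] := IH k.+1 wps; rewrite !orbT.
Qed.

Lemma chain_head k p ps x : ((k, x) \in chainV k (p :: ps)) = (x \in pV p).
Proof.
rewrite /= mem_cat (mem_map (fun x y (e : (k, x) = (k, y)) => congr1 snd e)).
case: (x \in pV p) => //=; apply/negP => /chainV_ge /=; by rewrite ltnn.
Qed.

Lemma chain_tail k p ps v : v.1 != k -> (v \in chainV k (p :: ps)) = (v \in chainV k.+1 ps).
Proof.
move=> vk; rewrite /= mem_cat; case: mapP => // -[x _ e].
by rewrite e eqxx in vk.
Qed.

Lemma chain_nth d k ps i x : i < size ps ->
  ((k + i, x) \in chainV k ps) = (x \in pV (nth d ps i)).
Proof.
elim: ps k i => // p ps IH k [|i] /= il; first by rewrite addn0; exact: (chain_head k p ps x).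
rewrite -(IH k.+1) // addSnnS; apply: (@chain_tail k p ps (k + i.+1, x)) => /=; lia.
Qed.

Lemma nedges_lift k E i j x y :
  nedges (map (lift_edge k) E) (i, x) (j, y) = if (i == k) && (j == k) then nedges E x y else 0.
Proof.
rewrite /nedges count_map; case: ifP => [/andP[/eqP-> /eqP->]|ijk].
  apply: eq_count => -[a b]; rewrite /lift_edge /joins /= !xpair_eqE eqxx /=.
  by [].
rewrite (eq_count (a2 := pred0)) ?count_pred0 // => -[a b].
rewrite /lift_edge /joins /= !xpair_eqE ![k == _]eq_sym.
by case: (i == k) (j == k) ijk => -[] //= _; rewrite ?andbF.
Qed.

Lemma nedges_chain_low k ps u v : u.1 < k -> all well_formed ps ->
  nedges (chainE k ps) u v = 0.
Proof.
move=> uk wps; apply/eqP; rewrite -leqn0 leqNgt -has_count; apply/hasPn => e eE.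
have /edges_inP/(_ _ eE) [/chainV_ge e1 /chainV_ge e2] := chain_edges_in k wps.
by rewrite /joins negb_or; apply/andP; split; apply/eqP => ee; move: e1 e2; rewrite ee /= ![k <= u.1]leqNgt uk.
Qed.

Lemma nedges_chain_same d k ps i x y : all well_formed ps -> i < size ps ->
  nedges (chainE k ps) (k + i, x) (k + i, y) = nedges (pE (nth d ps i)) x y.
Proof.
elim: ps k i => // p ps IH k i /= /andP[_ wps] il; rewrite !nedges_cat nedges_lift andbb.
have -> : nedges (bridges k p ps) (k + i, x) (k + i, y) = 0.
  case: ps {IH wps il} => //= q ps; rewrite /nedges /= /joins !xpair_eqE; lia.
case: i il => [|i] il; first by rewrite addn0 eqxx nedges_chain_low //= !addn0.
by rewrite -addSnnS IH //= ifF //; lia.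
Qed.

Lemma nedges_chain_next d k ps i x y : all well_formed ps -> i.+1 < size ps ->
  nedges (chainE k ps) (k + i, x) (k + i.+1, y) =
  ((x == pout (nth d ps i)) && (y == pin (nth d ps i.+1))).
Proof.
elim: ps k i => // p ps IH k i /= /andP[_ wps] il; rewrite !nedges_cat nedges_lift.
rewrite ifF ?add0n; last lia.
case: i il => [|i] il.
  rewrite addn0 nedges_chain_low ?addn0 //=.
  case: ps wps il {IH} => //= q ps _ _; rewrite /nedges /= /joins !xpair_eqE addn0 addn1 !eqxx /=.
  rewrite [pout p == _]eq_sym [pin q == _]eq_sym [k == k.+1]eqn_leq ltnn andbF andFb orbF //.
rewrite -addSnnS -[k + i.+2]addSnnS IH //=.
case: ps wps il {IH} => //= q ps _ _; rewrite /nedges /= /joins !xpair_eqE.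
have n1 : (k == k.+1 + i) = false by apply/eqP; lia.
have n2 : (k == k.+1 + i.+1) = false by apply/eqP; lia.
by rewrite n1 n2 ?andbF.
Qed.

Lemma crossings_cat S (E F : seq ((nat * L) * (nat * L))) :
  crossings S (E ++ F) = crossings S E + crossings S F.
Proof. exact: count_cat. Qed.

Lemma crossings_lift S k (E : seq (L * L)) :
  crossings S (map (lift_edge k) E) = crossings (fun x => S (k, x)) E.
Proof. by rewrite /crossings count_map; exact: eq_count. Qed.

End Chains.

Notation chain_graph ps := (lgraph (chainV 0 ps) (chainE 0 ps)).

Arguments well_formed {L} p.
Arguments lift_edge {L} k e.

(** * Cuts of a chain *)

Section Tight.
Local Open Scope nat_scope.
Variable L : choiceType.
Implicit Types (V : seq L) (E : seq (L * L)).

(** Scanning the edges in turn and adding each as soon as one of its ends has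
    been reached, a component is exhausted after few rounds. *)
Definition grow1 (s : seq L) (e : L * L) :=
  if e.1 \in s then (if e.2 \in s then s else e.2 :: s)
  else if e.2 \in s then e.1 :: s else s.

Fixpoint reaches n E (s : seq L) (y : L) : bool :=
  if y \in s then true else
  if n is n'.+1 then reaches n' E (foldl grow1 s E) y else false.

(** The conditional, rather than a conjunction, stops a strict evaluation at
    the first bridge that is found. *)
Fixpoint bridgeless_from (pre post : seq (L * L)) : bool :=
  if post is e :: post' then
    if reaches (size (pre ++ post')) (pre ++ post') [:: e.1] e.2
    then bridgeless_from (rcons pre e) post' else false
  else true.

Definition tightb V E :=
  (if V is x :: _ then all (reaches (size E) E [:: x]) V else true) &&
  bridgeless_from [::] E.

Lemma crossings_cons (S : pred L) e E :
  crossings S (e :: E) = (S e.1 != S e.2) + crossings S E.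
Proof. by []. Qed.

Lemma reaches_constant n E (S : pred L) x s y : crossings S E = 0 ->
  {in s, forall z, S z = S x} -> reaches n E s y -> S y = S x.
Proof.
move=> S0; elim: n s => [|n IH] s Ss /=; case: ifP => ys //.
- by move=> _; exact: Ss.
- by move=> _; exact: Ss.
apply: IH; move: S0 s Ss {ys}; elim: E => [|e E IHE] S0 s Ss //.
move: S0 => /eqP; rewrite [foldl _ _ _]/=; rewrite crossings_cons addn_eq0 eqb0 negbK => /andP[/eqP e12 /eqP S0].
apply: IHE => // z; rewrite /grow1.
case: ifP => e1s; case: ifP => e2s; rewrite ?inE; try exact: Ss.
  by case/orP=> [/eqP->|/Ss //]; rewrite -e12 Ss.
by case/orP=> [/eqP->|/Ss //]; rewrite e12 Ss.
Qed.

(** If an edge crossed S and no other edge did, its ends could not be joined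
    by a path avoiding it. *)
Lemma bridgeless_fromP pre post (S : pred L) : bridgeless_from pre post ->
  crossings S (pre ++ post) < 2 -> crossings S post = 0.
Proof.
elim: post pre => // e post IH pre; rewrite [bridgeless_from _ _]/=.
case: ifP => // re bpost c.
have cE : crossings S (pre ++ e :: post) = crossings S [:: e] + crossings S (pre ++ post).
  by rewrite /crossings !count_cat /= addn0 addnCA.
rewrite crossings_cons (IH _ bpost) ?cat_rcons // addn0; apply/eqP; rewrite eqb0 negbK.
case: (eqVneq (S e.1) (S e.2)) => // ne.
move: c; rewrite cE /crossings /= ne -/(crossings S _) addn0 add1n ltnS ltnS leqn0 => /eqP c0.
by rewrite (reaches_constant (x := e.1) c0 _ re) ?eqxx // in ne => z; rewrite mem_seq1 => /eqP->.
Qed.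

Lemma tightP p : tightb (pV p) (pE p) -> tight p.
Proof.
move=> /andP[cE bE] S; case: (ltnP (crossings S (pE p)) 2) => c; last by right.
left; have c0 := bridgeless_fromP bE c.
case: (pV p) cE => // z V /allP rz x y xV yV.
have cz u : u \in z :: V -> S u = S z.
  by move=> /rz; apply: reaches_constant => // t; rewrite mem_seq1 => /eqP->.
by rewrite !cz.
Qed.

End Tight.

Section ChainCuts.
Local Open Scope nat_scope.
Variable L : choiceType.
Implicit Types (p q : piece L) (ps : seq (piece L)).

Definition good p := well_formed p && tightb (pV p) (pE p).

Lemma good_wf ps : all good ps -> all well_formed ps.
Proof. by apply: sub_all => p /andP[]. Qed.

Lemma piece_cut S k p : good p -> crossings S (map (lift_edge k) (pE p)) < 2 ->
  forall x, x \in pV p -> S (k, x) = S (k, pin p).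
Proof.
move=> /andP[/and4P[_ _ pi _] /tightP t] c x xV; rewrite crossings_lift in c.
by case: (t (fun x => S (k, x))) => [h|]; [exact: h | rewrite leqNgt c].
Qed.

(** An edge of the piece crosses S only if S separates two vertices of the
    piece, and then tightness yields a second crossing. *)
Lemma piece_uncut S k p : good p -> crossings S (map (lift_edge k) (pE p)) < 2 ->
  crossings S (map (lift_edge k) (pE p)) = 0.
Proof.
move=> gp c; have cst := piece_cut gp c.
have /andP[/and4P[_ /edges_inP EV _ _] _] := gp.
apply/eqP; rewrite -leqn0 leqNgt -has_count; apply/hasPn => _ /mapP[e /EV[e1 e2] ->] /=.
by rewrite !cst // eqxx.
Qed.

Lemma crossings_chain S k p q ps :
  crossings S (chainE k [:: p, q & ps]) =
  crossings S (map (lift_edge k) (pE p)) + (S (k, pout p) != S (k.+1, pin q))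
  + crossings S (chainE k.+1 (q :: ps)).
Proof.
rewrite [chainE k _]/= -[(k, pout p, _) :: _]/([:: (k, pout p, (k.+1, pin q))] ++ chainE k.+1 (q :: ps)).
rewrite !crossings_cat addnA; congr (_ + _ + _).
by rewrite /crossings /=; case: (_ != _).
Qed.

Lemma chain_uncut S k p ps : all good (p :: ps) ->
  crossings S (chainE k (p :: ps)) = 0 ->
  forall v, v \in chainV k (p :: ps) -> S v = S (k, pin p).
Proof.
elim: ps k p => [|q ps IH] k p /andP[gp gps].
  rewrite /= !cats0 => c v /mapP[x xV ->]; apply: (piece_cut gp) => //; by rewrite c.
move=> c v; move: c; rewrite crossings_chain => /eqP.
rewrite !addn_eq0 eqb0 negbK => /andP[/andP[/eqP c1 /eqP c2] /eqP c3].
rewrite mem_cat => /orP[/mapP[x xV ->]|]; first by apply: (piece_cut gp); rewrite ?c1.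
have po : pout p \in pV p by case/andP: gp => /and4P[].
move=> vin; rewrite (IH k.+1 q gps c3 v vin) -c2.
by apply: (piece_cut gp); rewrite ?c1.
Qed.

(** Tight pieces are not separated by a cut of size one, so the only crossing
    edge is one of the bridges, and the cut separates the first pieces from
    the last ones. *)
Lemma chain_cut1 S k p ps : all good (p :: ps) ->
  crossings S (chainE k (p :: ps)) = 1 ->
  exists2 j, k <= j < k + size ps &
    forall v, v \in chainV k (p :: ps) -> S v = S (k, pin p) (+) (j < v.1).
Proof.
elim: ps k p => [|q ps IH] k p /andP[gp gps].
  rewrite /= !cats0 => c.
  by have := piece_uncut gp (S := S) (k := k); rewrite c => /(_ isT).
have po : pout p \in pV p by case/andP: gp => /and4P[].
rewrite crossings_chain => c.
have c1 : crossings S (map (lift_edge k) (pE p)) = 0 by apply: (piece_uncut gp); lia.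
have Sp x : x \in pV p -> S (k, x) = S (k, pin p) by apply: (piece_cut gp); rewrite c1.
move: c; rewrite c1 add0n (Sp _ po) => c.
case: (eqVneq (S (k, pin p)) (S (k.+1, pin q))) c => [e|ne] /= c.
  have [j jk Sj] := IH k.+1 q gps c.
  exists j; first by rewrite /=; lia.
  move=> v; rewrite mem_cat => /orP[/mapP[x xV ->]|vin] /=.
    by rewrite Sp // ltnNge (_ : k <= j) ?addbF //; lia.
  by rewrite e Sj.
exists k; first by rewrite leqnn /= -addn1 leq_add2l.
move=> v; rewrite mem_cat => /orP[/mapP[x xV ->]|vin] /=.
  by rewrite Sp // ltnn addbF.
have c0 : crossings S (chainE k.+1 (q :: ps)) = 0 by case: c.
have kv : k < v.1 by exact: (@chainV_ge _ k.+1 (q :: ps)).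
rewrite (chain_uncut (ps := ps) gps c0 vin) kv addbT.
by case: (S _) (S _) ne => -[].
Qed.

Lemma prefix_cut j k p ps : all good (p :: ps) ->
  crossings (fun v => v.1 <= j) (chainE k (p :: ps)) = (k <= j < k + size ps).
Proof.
elim: ps k p => [|q ps IH] k p /andP[gp gps].
  rewrite /= !cats0 crossings_lift /= /crossings (eq_count (a2 := pred0)) ?count_pred0; last first.
    by move=> e /=; rewrite eqxx.
  by rewrite addn0; case: leqP => //= h; rewrite ltnNge h.
rewrite crossings_chain crossings_lift.
rewrite {1}/crossings (eq_count (a2 := pred0)) ?count_pred0; last by move=> e /=; rewrite eqxx.
rewrite (IH k.+1 q gps) /=; lia.
Qed.

Lemma chain_connected ps : all good ps -> 0 < size ps ->
  connected_graph (chain_graph ps).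
Proof.
case: ps => // p ps gps _; apply: lgraph_connected.
- exact/chain_edges_in/good_wf.
- rewrite /= size_cat size_map ltn_addr //; case/andP: gps => /andP[/and4P[_ _ + _] _] _.
  by case: (pV p).
- by move=> S c x y xV yV; rewrite !(chain_uncut gps c).
Qed.

(** The number of bridges separating v from r, in a form that is manifestly
    invariant under isomorphism. *)
Definition cut_rank (G : mgraph) (r v : G) : nat :=
  #|[set S : {set G} | [&& r \in S, v \notin S & edge_cut S == 1]]|.

Lemma cut_iso (G H : mgraph) (f : G -> H) (S : {set G}) : bijective f ->
  (forall u v, mult (f u) (f v) = mult u v) -> edge_cut (f @: S) = edge_cut S.
Proof.
move=> bf fm; have injf := bij_inj bf; rewrite /edge_cut.
rewrite (reindex f) /=; last exact: onW_bij.
apply: eq_big => [x|x _]; first by rewrite mem_imset.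
rewrite (reindex f) /=; last exact: onW_bij.
by apply: eq_big => [y|y _]; rewrite ?mem_imset ?fm.
Qed.

Lemma cut_rank_iso (G H : mgraph) (f : G -> H) r v : bijective f ->
  (forall u v, mult (f u) (f v) = mult u v) ->
  cut_rank (f r) (f v) = cut_rank r v.
Proof.
move=> bf fm; have injf := bij_inj bf; rewrite /cut_rank.
rewrite -[RHS](card_imset _ (imset_inj injf)); congr #|pred_of_set _|.
apply/setP => S; apply/idP/imsetP => [|[S' + ->]]; rewrite !inE.
  have [g fK gK] := bf.
  have SE : S = f @: (g @: S).
    by rewrite -imset_comp (eq_imset (g := id)) ?imset_id.
  by rewrite SE !mem_imset // cut_iso // => h; exists (g @: S); rewrite // inE.
by rewrite !mem_imset // cut_iso.
Qed.

(** By chain_cut1 the cuts of size one that separate a vertex of the first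
    piece from v are given by the bridges before the piece of v. *)
Lemma cut_rank_chain p ps (r v : chain_graph (p :: ps)) :
  all good (p :: ps) -> (val r).1 = 0 -> cut_rank r v = (val v).1.
Proof.
move=> gps r0; pose K := chain_graph (p :: ps).
have EV := chain_edges_in 0 (good_wf gps).
have V0 : (0, pin p) \in chainV 0 (p :: ps).
  by rewrite chain_head; case/andP: gps => /andP[/and4P[]].
have vle : (val v).1 <= size ps.
  by have := chainV_lt (valP v); rewrite add0n.
pose pre (j : 'I_(size ps)) : {set K} := [set x : K | (val x).1 <= j].
have cpre j : edge_cut (pre j) = 1.
  rewrite (cut_lgraph (P := fun x => x.1 <= j)) //; last by move=> x; rewrite inE.
  by rewrite prefix_cut // add0n ltn_ord.
have injpre : injective pre.
  move=> j j' /setP e; apply/val_inj/eqP; rewrite eqn_leq.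
  have rep (i : nat) : i < size ps -> exists x : K, (val x).1 = i.+1.
    move=> il; have := chain_nth p 0 (pin (nth p (p :: ps) i.+1)) (ps := p :: ps) (i := i.+1) il.
    rewrite add0n; have /(all_nthP p)/(_ i.+1 il)/andP[/and4P[_ _ -> _] _] := gps.
    by move=> iV; exists (SeqSub iV).
  have aux (a b : 'I_(size ps)) : (forall x, (x \in pre a) = (x \in pre b)) -> a <= b.
    move=> ab; rewrite leqNgt; apply/negP => ba.
    have [x xb] := rep b (ltn_ord b).
    by have := ab x; rewrite !inE xb ltnn ba.
  by rewrite !aux.
rewrite /cut_rank (_ : [set S | _] = pre @: [set j : 'I_(size ps) | j < (val v).1]).
  rewrite card_imset // cardsE -sum1_card.
  rewrite (eq_bigl (fun j : 'I_(size ps) => j < (val v).1)) //.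
  by rewrite (big_ord_narrow vle) /= sum1_card card_ord.
apply/setP => S; rewrite inE; apply/and3P/imsetP.
  move=> [rS vS /eqP c].
  pose P (x : nat * L) := if insub x is Some x' then (x' : seq_sub (chainV 0 (p :: ps))) \in S else false.
  have SP (x : K) : (x \in S) = P (val x) by rewrite /P valK.
  rewrite (cut_lgraph EV SP) in c.
  have [j jl Pj] := chain_cut1 gps c; rewrite add0n in jl.
  have P0 : P (0, pin p).
    by move: rS; rewrite SP Pj ?(valP r) // r0 ltn0 addbF.
  exists (Ordinal (jl : j < size ps)).
    by rewrite inE /=; move: vS; rewrite SP Pj ?(valP v) // P0 /= negbK.
  apply/setP => x; rewrite inE /= SP Pj ?(valP x) // P0 /=.
  by rewrite -leqNgt.
by move=> [j]; rewrite inE => jv ->; rewrite !inE r0 cpre -ltnNge jv.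
Qed.

End ChainCuts.

Arguments good {L} p.

(** * The pieces of a chain are isomorphism invariants *)

Arguments chainE : simpl never.
Arguments chainV : simpl never.

Section Walks.
Local Open Scope nat_scope.

Fixpoint walks (L : eqType) (V : seq L) (E : seq (L * L)) (a : L) n (v : L) : nat :=
  if n is n'.+1 then \sum_(u <- V) nedges E v u * walks V E a n' u else (v == a).

(** Confined to one piece of a chain, walks in the whole graph are those of
    the piece alone. *)
Fixpoint walks_in (G : mgraph) (B : pred G) (a : G) n (v : G) : nat :=
  if n is n'.+1 then \sum_(u | B u) mult v u * walks_in B a n' u else (v == a).

Lemma walks_in_iso (G H : mgraph) (f : G -> H) (B : pred G) (B' : pred H) a n v :
  bijective f -> (forall u v, mult (f u) (f v) = mult u v) ->
  (forall u, B' (f u) = B u) ->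
  walks_in B' (f a) n (f v) = walks_in B a n v.
Proof.
move=> bf fm fB; elim: n v => [|n IH] v /=; first by rewrite (inj_eq (bij_inj bf)).
rewrite (reindex f) /=; last exact: onW_bij.
by apply: eq_big => [u|u _]; rewrite ?fB // fm IH.
Qed.

Variable L : choiceType.
Implicit Types (p q : piece L) (ps : seq (piece L)).

(** The sum over v of the squared number of walks of length n from the entry
    to v, that is, the number of closed walks of length 2n at the entry.
    This form needs only the iteration of n steps. *)
Definition walk_energy p n :=
  \sum_(v <- pV p) walks (pV p) (pE p) (pin p) n v ^ 2.

Lemma sum_seq_sub (T : choiceType) (V : seq T) (P : pred T) (F : T -> nat) : uniq V ->
  \sum_(u : seq_sub V | P (val u)) F (val u) = \sum_(u <- V | P u) F u.
Proof.
move=> uV; rewrite -(big_map val P F); apply: perm_big; apply: uniq_perm => //.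
  by rewrite map_inj_uniq ?index_enum_uniq //; exact: val_inj.
move=> x; apply/mapP/idP => [[y _ ->]|xV]; first exact: valP.
by exists (SeqSub xV); rewrite // mem_index_enum.
Qed.

Lemma sum_chain_level d k ps i (F : nat * L -> nat) : i < size ps ->
  \sum_(u <- chainV k ps | u.1 == k + i) F u = \sum_(x <- pV (nth d ps i)) F (k + i, x).
Proof.
elim: ps k i => // p ps IH k i il; rewrite -[chainV _ _]/(_ ++ chainV k.+1 ps) big_cat big_map /=.
case: i il => [|i] il.
  have z : \sum_(u <- chainV k.+1 ps | u.1 == k) F u = 0.
    rewrite big_seq_cond big_pred0 // => v.
    by apply/negbTE/negP => /andP[/chainV_ge kv /eqP vk]; rewrite vk ltnn in kv.
  by rewrite addn0 z addn0; apply: eq_bigl => x; rewrite eqxx.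
have z : \sum_(x <- pV p | k == k + i.+1) F (k, x) = 0.
  by rewrite big_pred0 // => x; apply/eqP; lia.
rewrite z add0n.
by rewrite -addSnnS IH.
Qed.

Lemma walks_chain d ps k (a v : chain_graph ps) n :
  all good ps -> k < size ps -> (val a).1 = k -> (val v).1 = k ->
  walks_in (fun u : chain_graph ps => (val u).1 == k) a n v
  = walks (pV (nth d ps k)) (pE (nth d ps k)) (val a).2 n (val v).2.
Proof.
move=> gps kl ak; elim: n v => [|n IH] v vk /=.
  congr nat_of_bool; apply/eqP/eqP => [->//|e]; apply: val_inj.
  by rewrite [LHS]surjective_pairing [RHS]surjective_pairing ak vk e.
pose W (x : nat * L) := nedges (chainE 0 ps) (val v) x *
  walks (pV (nth d ps k)) (pE (nth d ps k)) (val a).2 n x.2.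
rewrite (eq_bigr (fun u : seq_sub (chainV 0 ps) => W (val u))); last first.
  by move=> u /eqP uk; rewrite /W IH.
have wps := good_wf gps.
rewrite (sum_seq_sub (fun u => u.1 == k) W (chainV_uniq 0 wps)).
rewrite (@sum_chain_level d 0) //; apply: eq_bigr => x _.
rewrite /W /=; congr (_ * _).
by rewrite [val v]surjective_pairing vk (@nedges_chain_same _ d 0).
Qed.

Lemma walk_energy_chain d ps k (a : chain_graph ps) n :
  all good ps -> k < size ps -> val a = (k, pin (nth d ps k)) ->
  \sum_(v : chain_graph ps | (val v).1 == k)
     walks_in (fun u : chain_graph ps => (val u).1 == k) a n v ^ 2
  = walk_energy (nth d ps k) n.
Proof.
move=> gps kl ak; pose p := nth d ps k.
pose W (x : nat * L) := walks (pV p) (pE p) (pin p) n x.2 ^ 2.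
rewrite (eq_bigr (fun u : seq_sub (chainV 0 ps) => W (val u))); last first.
  by move=> v /eqP vk; rewrite (walks_chain d) ?ak.
rewrite (sum_seq_sub (fun u => u.1 == k) W (chainV_uniq 0 (good_wf gps))).
by rewrite (@sum_chain_level d 0).
Qed.

Lemma nedges_same0 d ps i x y : all well_formed ps -> i < size ps ->
  nedges (chainE 0 ps) (i, x) (i, y) = nedges (pE (nth d ps i)) x y.
Proof. exact: (@nedges_chain_same _ d 0). Qed.

Lemma nedges_next0 d ps i x y : all well_formed ps -> i.+1 < size ps ->
  nedges (chainE 0 ps) (i, x) (i.+1, y) =
  ((x == pout (nth d ps i)) && (y == pin (nth d ps i.+1))).
Proof. exact: (@nedges_chain_next _ d 0). Qed.

Lemma chain_nth0 d ps i x : i < size ps ->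
  ((i, x) \in chainV 0 ps) = (x \in pV (nth d ps i)).
Proof. exact: (@chain_nth _ d 0). Qed.

Definition loopless p := all (fun x => nedges (pE p) x x == 0) (pV p).

(** The loop in the first piece has to go to the first piece, since the pieces
    qs have no loops. The number of bridges that separate a vertex from the loop
    is invariant by cut_rank_chain, so an isomorphism preserves the index of
    a piece, hence also the ends of the bridges, hence the entries of the pieces
    and the walks from them. *)
Theorem chain_iso_walks d p q ps qs : all good (p :: ps) -> all good (q :: qs) ->
  ~~ loopless p -> all loopless qs ->
  graph_iso (chain_graph (p :: ps)) (chain_graph (q :: qs)) ->
  size ps = size qs /\
  forall k n, k < size ps -> walk_energy (nth d ps k) n = walk_energy (nth d qs k) n.
Proof.
move=> gps gqs lp lqs [f [bf fm]].
have wps := good_wf gps; have wqs := good_wf gqs.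
(* r carries the loop that locates the first piece *)
have [r [r0 rl]] : exists r : chain_graph (p :: ps), (val r).1 = 0 /\ 0 < mult r r.
  move: lp => /allPn[x xV xl]; have rV : (0, x) \in chainV 0 (p :: ps) by rewrite chain_head.
  exists (SeqSub rV); split=> //=; rewrite lt0n.
  by rewrite (nedges_same0 d).
have fr0 : (val (f r)).1 = 0.
  move: rl; rewrite -fm -[mult _ _]/(nedges _ (val (f r)) (val (f r))).
  case: (val (f r)) (valP (f r)) => -[//|i] x xin.
  have il := chainV_lt xin; rewrite /= add0n ltnS in il.
  rewrite (chain_nth0 d) //= in xin.
  rewrite (nedges_same0 d) //=.
  by have /(all_nthP d)/(_ _ il)/allP/(_ _ xin)/eqP-> := lqs.
have lev (v : chain_graph (p :: ps)) : (val (f v)).1 = (val v).1.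
  by rewrite -(cut_rank_chain v gps r0) -(cut_rank_iso r v bf fm) (cut_rank_chain _ gqs fr0).
have [g fK gK] := bf.
have pinV (ps' : seq (piece L)) k : all good ps' -> k < size ps' ->
    (k, pin (nth d ps' k)) \in chainV 0 ps'.
  move=> gps' kl; rewrite (chain_nth0 d) //.
  by have /(all_nthP d)/(_ _ kl)/andP[/and4P[_ _ ->]] := gps'.
have poutV (ps' : seq (piece L)) k : all good ps' -> k < size ps' ->
    (k, pout (nth d ps' k)) \in chainV 0 ps'.
  move=> gps' kl; rewrite (chain_nth0 d) //.
  by have /(all_nthP d)/(_ _ kl)/andP[/and4P[_ _ _ ->]] := gps'.
have sz : size ps = size qs.
  apply/eqP; rewrite eqn_leq; apply/andP; split.
    have := lev (SeqSub (pinV _ _ gps (ltnSn (size ps)))) => /= <-.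
    by rewrite -ltnS; exact: (chainV_lt (valP (f _))).
  have := lev (g (SeqSub (pinV _ _ gqs (ltnSn (size qs))))); rewrite gK /= => ->.
  by rewrite -ltnS; exact: (chainV_lt (valP (g _))).
split=> // k n kl.
have kl1 : k.+1 < size (p :: ps) by [].
have kl1' : k.+1 < size (q :: qs) by rewrite /= -sz.
pose v : chain_graph (p :: ps) := SeqSub (pinV _ _ gps kl1).
pose u : chain_graph (p :: ps) := SeqSub (poutV _ _ gps (ltnW kl1)).
(* v is the entry of piece k+1 as it is joined to the exit u of piece k *)
have fv2 : (val (f v)).2 = pin (nth d qs k).
  have : 0 < mult (f u) (f v).
    by rewrite fm /= (nedges_next0 d) // !eqxx.
  have u1 : (val (f u)).1 = k by rewrite lev.
  have v1 : (val (f v)).1 = k.+1 by rewrite lev.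
  rewrite -[mult _ _]/(nedges _ (val (f u)) (val (f v))).
  rewrite [val (f u)]surjective_pairing [val (f v)]surjective_pairing u1 v1.
  rewrite (nedges_next0 d) //.
  by rewrite lt0b => /andP[_ /eqP].
have fv : val (f v) = (k.+1, pin (nth d qs k)).
  by rewrite [LHS]surjective_pairing lev fv2.
have W := walks_in_iso (B := fun x : chain_graph (p :: ps) => (val x).1 == k.+1)
  (B' := fun x : chain_graph (q :: qs) => (val x).1 == k.+1) v n _ bf fm
  (fun x => congr1 (eq_op^~ k.+1) (lev x)).
rewrite -[nth d ps k]/(nth d (p :: ps) k.+1) -[nth d qs k]/(nth d (q :: qs) k.+1).
rewrite -(@walk_energy_chain d (p :: ps) k.+1 v n) // -(@walk_energy_chain d (q :: qs) k.+1 (f v) n) //.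
rewrite [RHS](reindex f) /=; last exact: onW_bij.
by apply: eq_big => [x|x _]; rewrite ?lev // W.
Qed.

End Walks.

Arguments loopless {L} p.

(** * Smoothing a chain piece by piece *)

Section ChainSmoothing.
Local Open Scope nat_scope.
Variable L : choiceType.
Implicit Types (p q : piece L) (vs : seq L).

(** Smoothing is local: edges that do not touch v are carried along, and the
    edges can be transported along an injective renaming. *)
Lemma smooth1_frame (L' : choiceType) (f : L -> L') v E F : injective f ->
  {in F, forall e, ~~ touches (f v) e} ->
  let E' := [seq (f e.1, f e.2) | e <- E] in
  smooth1 (f v) (E' ++ F) = [seq (f e.1, f e.2) | e <- smooth1 v E] ++ F /\
  smoothable (f v) (E' ++ F) = smoothable v E.
Proof.
move=> injf FF E'.
have tE e : touches (f v) (f e.1, f e.2) = touches v e by rewrite /touches /= !(inj_eq injf).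
have fF : [seq e <- F | touches (f v) e] = [::].
  by apply/eqP; rewrite -[_ == _]negbK -has_filter; apply/hasPn.
have fF' : [seq e <- F | ~~ touches (f v) e] = F by apply/all_filterP/allP.
have e1 : [seq e <- E' ++ F | touches (f v) e] =
    [seq (f e.1, f e.2) | e <- E & touches v e].
  by rewrite filter_cat fF cats0 filter_map; congr map; apply: eq_filter => e; exact: tE.
have e2 : [seq e <- E' ++ F | ~~ touches (f v) e] =
    [seq (f e.1, f e.2) | e <- E & ~~ touches v e] ++ F.
  rewrite filter_cat fF' filter_map; congr (map _ _ ++ _); apply: eq_filter => e /=.
  by rewrite tE.
have oE e : opposite (f v) (f e.1, f e.2) = f (opposite v e).
  by rewrite /opposite /= (inj_eq injf); case: ifP.
rewrite /smooth1 /smoothable e1 e2.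
case: [seq e <- E | touches v e] => [|a [|b [|c s]]] //=.
by rewrite !oE !(inj_eq injf).
Qed.

Lemma smooth_seq_frame (L' : choiceType) (f : L -> L') vs E F : injective f ->
  {in vs & F, forall v e, ~~ touches (f v) e} ->
  let E' := [seq (f e.1, f e.2) | e <- E] in
  smooth_seq (map f vs) (E' ++ F) = [seq (f e.1, f e.2) | e <- smooth_seq vs E] ++ F /\
  smoothable_seq (map f vs) (E' ++ F) = smoothable_seq vs E.
Proof.
move=> injf; elim: vs E => //= v vs IH E FF.
have [|-> ->] := smooth1_frame (v := v) (F := F) E injf.
  by move=> e eF; apply: FF; rewrite ?mem_head.
have [|-> ->] := IH (smooth1 v E) => // u e uv eF; apply: FF => //.
by rewrite inE uv orbT.
Qed.

(** The marked vertices stay, although they may have degree 2 within the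
    piece: in a chain the bridges add to their degree. *)
Definition reduce (r : piece L * seq L) : piece L :=
  Piece [seq x <- pV r.1 | x \notin r.2] (smooth_seq r.2 (pE r.1)) (pin r.1) (pout r.1).

Definition reducible (r : piece L * seq L) : bool :=
  [&& well_formed r.1, uniq r.2, all [in pV r.1] r.2, smoothable_seq r.2 (pE r.1),
      pin r.1 \notin r.2 & pout r.1 \notin r.2].

Lemma smooth_seq_edges_in vs V E : edges_in V E -> smoothable_seq vs E ->
  edges_in [seq x <- V | x \notin vs] (smooth_seq vs E).
Proof.
elim: vs V E => [|v vs IH] V E EV /=; first by rewrite filter_predT.
move=> /andP[sv svs]; have := IH _ _ (smooth1_edges_in EV sv) svs.
rewrite -filter_predI; congr (edges_in _ _ = true).
by apply: eq_filter => x; rewrite /= inE negb_or andbC.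
Qed.

Lemma reduce_wf r : reducible r -> well_formed (reduce r).
Proof.
move=> /and5P[/and4P[uV EV pi po] _ _ gvs /andP[piv pov]]; rewrite /well_formed /=.
by rewrite filter_uniq // smooth_seq_edges_in // !mem_filter piv pov pi po.
Qed.

Lemma smooths_to_isol G H K : graph_iso G H -> smooths_to H K -> smooths_to G K.
Proof. move=> /smooths_to_iso; exact: smooths_to_trans. Qed.

(** Pieces before index k are already smoothed and form, with the bridge that
    leaves them, the context W, F; its only contact with the next piece is
    the entry of that piece, which is not smoothed away. *)
Lemma chain_smooth_from k (rs : seq (piece L * seq L)) W F :
  all reducible rs -> uniq W -> all (fun w => w.1 < k) W ->
  edges_in (W ++ chainV k (map fst rs)) F ->
  (forall e u, e \in F -> u \in [:: e.1; e.2] -> k <= u.1 ->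
     if rs is r :: _ then u = (k, pin r.1) else True) ->
  smooths_to
    (lgraph (W ++ chainV k (map fst rs)) (F ++ chainE k (map fst rs)))
    (lgraph (W ++ chainV k (map reduce rs)) (F ++ chainE k (map reduce rs))).
Proof.
elim: rs k W F => [|[p vs] rs IH] k W F /=.
  by move=> _ _ _ _ _; exact/smooths_to_iso/graph_iso_refl.
move=> /andP[/and5P[/= wp uvs svs' gvs /andP[piv pov]] rrs] uW /allP kW FV FF.
have /allP svs := svs'.
have wrs : all well_formed (map fst rs).
  by rewrite all_map; apply: sub_all rrs => r /= /and5P[].
set CV := chainV k.+1 (map fst rs); set CE := chainE k.+1 (map fst rs).
rewrite -[chainV k (p :: _)]/(map (pair k) (pV p) ++ CV) in FV *.
rewrite -[chainE k (p :: _)]/(map (lift_edge k) (pE p) ++ bridges k p (map fst rs) ++ CE).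
set B := bridges k p _.
have injk : injective (pair k : L -> nat * L) by move=> x y [].
have touch : {in vs & F ++ B ++ CE, forall v e, ~~ touches (k, v) e}.
  have piv' v : v \in vs -> v <> pin p by move=> vv e; move: piv; rewrite -e vv.
  have pov' v : v \in vs -> v <> pout p by move=> vv e; move: pov; rewrite -e vv.
  move=> v e vv; rewrite !mem_cat => /or3P[eF|eB|eC]; apply/negP => /orP[]/eqP te.
  - have := FF _ e.1 eF (mem_head _ _); rewrite te leqnn => /(_ isT)[e']; exact: (piv' v).
  - have := FF _ e.2 eF; rewrite inE mem_head orbT te leqnn => /(_ isT isT)[e']; exact: (piv' v).
  - move: eB te; rewrite /B; case: (map fst rs) => //= q qs; rewrite inE => /eqP-> [] e'.
    exact: (pov' v).
  - move: eB te; rewrite /B; case: (map fst rs) => //= q qs; rewrite inE => /eqP-> [] /eqP.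
    by rewrite -[X in _ == X]addn0 -addn1 eqn_add2l.
  - have /edges_inP/(_ _ eC)[/chainV_ge + _] := chain_edges_in k.+1 wrs.
    by rewrite te ltnn.
  - have /edges_inP/(_ _ eC)[_ /chainV_ge +] := chain_edges_in k.+1 wrs.
    by rewrite te ltnn.
have wall : all well_formed (p :: map fst rs) by rewrite /= wp.
have EVall : edges_in (W ++ map (pair k) (pV p) ++ CV)
    (map (lift_edge k) (pE p) ++ F ++ B ++ CE).
  apply/edges_inP => e eE.
  have [eF|eC] : e \in F \/ e \in map (lift_edge k) (pE p) ++ B ++ CE.
    by move: eE; rewrite !mem_cat => /or4P[->|->|->|->]; rewrite ?orbT; auto.
    by have /edges_inP/(_ _ eF) := FV.
  have /edges_inP/(_ e eC)[] := chain_edges_in k wall.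
  by rewrite -[chainV k (p :: _)]/(map (pair k) (pV p) ++ CV) ![_ \in W ++ _]mem_cat => -> ->; rewrite !orbT.
have [sE sB] : smooth_seq (map (pair k) vs) (map (lift_edge k) (pE p) ++ F ++ B ++ CE)
      = map (lift_edge k) (smooth_seq vs (pE p)) ++ F ++ B ++ CE /\
    smoothable_seq (map (pair k) vs) (map (lift_edge k) (pE p) ++ F ++ B ++ CE)
      = smoothable_seq vs (pE p).
  have H := @smooth_seq_frame _ (pair k) vs (pE p) (F ++ B ++ CE) injk touch.
  exact: H.
have step1 : smooths_to (lgraph (W ++ map (pair k) (pV p) ++ CV)
      (map (lift_edge k) (pE p) ++ F ++ B ++ CE))
    (lgraph [seq x <- W ++ map (pair k) (pV p) ++ CV | x \notin map (pair k) vs]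
      (map (lift_edge k) (smooth_seq vs (pE p)) ++ F ++ B ++ CE)).
  rewrite -sE; apply: smooth_seq_lgraph => //.
  - by rewrite map_inj_uniq.
  - move=> _ /mapP[x xv ->]; rewrite !mem_cat map_f ?orbT //; exact: svs.
  - by rewrite sB.
have filt : [seq x <- W ++ map (pair k) (pV p) ++ CV | x \notin map (pair k) vs] =
    (W ++ map (pair k) [seq x <- pV p | x \notin vs]) ++ CV.
  rewrite !filter_cat -catA; congr (_ ++ (_ ++ _)).
  - apply/all_filterP/allP => w /kW wk; apply/mapP => -[x _ e].
    by rewrite e ltnn in wk.
  - by rewrite filter_map; congr map; apply: eq_filter => x /=; rewrite mem_map.
  - apply/all_filterP/allP => w /chainV_ge wk; apply/mapP => -[x _ e].
    by rewrite e ltnn in wk.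
rewrite {}filt in step1.
set p' := reduce (p, vs).
set W' := W ++ map (pair k) (pV p').
set F' := F ++ map (lift_edge k) (pE p') ++ B.
have eqV : W ++ chainV k (p' :: map reduce rs) = W' ++ chainV k.+1 (map reduce rs).
  by rewrite /W' -catA.
have eqE : F ++ chainE k (p' :: map reduce rs) = F' ++ chainE k.+1 (map reduce rs).
  rewrite /F' -!catA; congr (_ ++ _); rewrite -[LHS]/(_ ++ _ ++ _); congr (_ ++ (_ ++ _)).
  by rewrite /B; case: (rs) => [|[q qs] rs'].
rewrite eqV eqE.
apply: smooths_to_isol (lgraph_perm (perm_refl _) _) (smooths_to_trans step1 _).
  by rewrite perm_catCA.
apply: smooths_to_isol (lgraph_perm (perm_refl _) _) (IH k.+1 W' F' rrs _ _ _ _).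
- by rewrite /F' -!catA perm_catCA.
- rewrite cat_uniq uW map_inj_uniq //= filter_uniq ?andbT; last by case/and4P: wp.
  apply/hasPn => _ /mapP[x _ ->]; apply/negP => /kW /=; by rewrite ltnn.
- apply/allP => w; rewrite mem_cat => /orP[/kW|/mapP[x _ ->] //=]; exact: ltnW.
- have wp' : well_formed p' by apply: reduce_wf; rewrite /reducible /= wp uvs svs' gvs piv.
  have /and4P[_ /edges_inP E'V _ po'] := wp'.
  apply/edges_inP => e; rewrite !mem_cat => /or3P[eF|/mapP[e' /E'V [e1 e2] ->]|eB].
  - have in' u : u \in [:: e.1; e.2] -> u \in W ++ map (pair k) (pV p) ++ CV ->
        u \in W' ++ CV.
      move=> ue; rewrite !mem_cat => /or3P[->//|/mapP[x xV ux]|->]; rewrite ?orbT //.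
      have := FF _ _ eF ue; rewrite {1}ux leqnn => /(_ isT) [->].
      by rewrite map_f ?orbT // mem_filter piv; case/and4P: wp.
    have /edges_inP/(_ _ eF)[e1 e2] := FV.
    by rewrite -!mem_cat; split; apply: in'; rewrite // !inE eqxx ?orbT.
  - by rewrite /= !(map_f (pair k)) ?orbT.
  - move: eB; rewrite /B /CV; case: (rs) wrs => //= r rs' /andP[/and4P[_ _ ri _] _].
    rewrite inE => /eqP-> /=; rewrite (map_f (pair k) po') orbT; split=> //.
    by rewrite -[chainV _ _]/(_ ++ _) mem_cat (map_f (pair k.+1) ri) !orbT.
- move=> e u; rewrite !mem_cat => /or3P[eF ue ku|/mapP[e' _ ->]|eB].
  + by have := FF _ _ eF ue (ltnW ku) => ukk; rewrite ukk ltnn in ku.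
  + by rewrite !inE => /orP[]/eqP->; rewrite ltnn.
  + move: eB; rewrite /B; case: (rs) => //= r rs'; rewrite inE => /eqP->.
    by rewrite !inE => /orP[]/eqP-> //=; rewrite ltnn.
Qed.

Lemma chain_smooth rs : all reducible rs ->
  smooths_to (chain_graph (map fst rs)) (chain_graph (map reduce rs)).
Proof. by move=> rrs; apply: (@chain_smooth_from 0 rs [::] [::]). Qed.

Lemma edge_degree_cat (T : eqType) (E F : seq (T * T)) v :
  edge_degree (E ++ F) v = edge_degree E v + edge_degree F v.
Proof. by rewrite /edge_degree !count_cat addnACA. Qed.

Lemma edge_degree_lift k (E : seq (L * L)) i x :
  edge_degree (map (lift_edge k) E) (i, x) = if i == k then edge_degree E x else 0.
Proof.
rewrite /edge_degree !count_map /=; case: eqP => [->|/eqP ik].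
  by congr (_ + _); apply: eq_count => e; rewrite /= xpair_eqE eqxx.
rewrite !(eq_count (a2 := pred0)) ?count_pred0 // => e;
  by rewrite /= xpair_eqE eq_sym (negbTE ik).
Qed.

Lemma edge_degree_chain_low k (ps : seq (piece L)) v : all well_formed ps -> v.1 < k ->
  edge_degree (chainE k ps) v = 0.
Proof.
move=> wps vk; apply/eqP; rewrite addn_eq0 -!leqn0 ![_ <= 0]leqNgt -!has_count.
apply/andP; split; apply/hasPn => e eE;
  have /edges_inP/(_ _ eE)[/chainV_ge e1 /chainV_ge e2] := chain_edges_in k wps.
- by apply: contraTneq e1 => ->; rewrite -ltnNge.
- by apply: contraTneq e2 => ->; rewrite -ltnNge.
Qed.

(** The two marked vertices gain the end of a bridge, except at the ends of
    the chain. They may coincide, and then gain both. *)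
Lemma edge_degree_chain d k (ps : seq (piece L)) i x : all well_formed ps -> i < size ps ->
  edge_degree (chainE k ps) (k + i, x) = edge_degree (pE (nth d ps i)) x
    + ((0 < i) && (x == pin (nth d ps i)))
    + ((i.+1 < size ps) && (x == pout (nth d ps i))).
Proof.
elim: ps k i => // p ps IH k i /andP[_ wps] il.
rewrite -[chainE _ _]/(_ ++ _ ++ _) !edge_degree_cat edge_degree_lift.
case: i il => [|i] il.
  rewrite addn0 eqxx edge_degree_chain_low //= addn0 addn0; congr (_ + _).
  case: ps {IH wps il} => //= q ps; rewrite /edge_degree /= !xpair_eqE eqxx /=.
  by rewrite [_.+1 == _](_ : _ = false) ?addn0 1?eq_sym //; apply/eqP; lia.
have -> : (k + i.+1 == k) = false by apply/eqP; lia.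
rewrite -addSnnS IH //= add0n ltnS.
case: ps {IH} wps il => //= q ps wps il; rewrite /edge_degree /= !xpair_eqE.
have -> : (k == k.+1 + i) = false by apply/eqP; lia.
have -> : (k.+1 == k.+1 + i) = (i == 0) by apply/eqP/eqP; lia.
case: i il => [|i] il /=; last by rewrite !add0n.
by rewrite [pin q == _]eq_sym /=; lia.
Qed.

End ChainSmoothing.
Arguments reducible {L} r.

(** * Strips of triangles and their dual graphs *)

Section Strip.
Local Open Scope nat_scope.

Notation word := (seq bool).
Notation label := (nat * nat * bool)%type.
Implicit Types (w : word) (ws : seq word) (i k : nat).

(** The column between the vertical lines i and i+1 is described by a word,
    read upwards: true is a triangle standing on a unit segment of line i,
    false a triangle standing on a unit segment of line i+1. After k triangles
    the front has reached the heights lcount w k and rcount w k. *)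
Definition lcount w k := count id (take k w).
Definition rcount w k := count negb (take k w).
Definition nL w := count id w.
Definition nR w := count negb w.

(** Each triangle of a strip has exactly one vertical side. The label (i, a, s)
    is that of the triangle whose vertical side joins (i,a) to (i,a+1) and
    which lies on its right (s true) or on its left (s false). *)
Definition lab i w k : label :=
  if nth false w k then (i, lcount w k, true) else (i.+1, rcount w k, false).
Definition labs i w : seq label := [seq lab i w k | k <- iota 0 (size w)].

(** Consecutive triangles of one column share a slanted side. *)
Definition consec (T : Type) (s : seq T) : seq (T * T) := zip s (behead s).
(** The triangles on both sides of a vertical segment share it. *)
Definition rungs i h : seq (label * label) :=
  [seq ((i, a, false), (i, a, true)) | a <- iota 0 h].

Fixpoint wlabs i ws : seq label :=
  if ws is w :: ws' then labs i w ++ wlabs i.+1 ws' else [::].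
Fixpoint wedges i ws : seq (label * label) :=
  if ws is w :: ws' then consec (labs i w) ++ rungs i.+1 (nR w) ++ wedges i.+1 ws'
  else [::].

Lemma lr_count w k : k <= size w -> lcount w k + rcount w k = k.
Proof.
move=> kw; rewrite /lcount /rcount -[X in _ = X](size_takel kw).
exact: (count_predC id).
Qed.

Lemma lcountS w k : k < size w -> lcount w k.+1 = lcount w k + nth false w k.
Proof.
by move=> kw; rewrite /lcount (take_nth false kw) -cats1 count_cat /= addn0.
Qed.

Lemma rcountS w k : k < size w -> rcount w k.+1 = rcount w k + ~~ nth false w k.
Proof.
by move=> kw; rewrite /rcount (take_nth false kw) -cats1 count_cat /= addn0.
Qed.

Lemma count_take_le (p : pred bool) w k k' : k <= k' ->
  count p (take k w) <= count p (take k' w).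
Proof.
move=> kk; rewrite -[k'](subnKC kk) takeD count_cat; exact: leq_addr.
Qed.

Lemma lcount_step w k k' : k < k' -> k < size w ->
  lcount w k + nth false w k <= lcount w k'.
Proof. by move=> kk kw; rewrite -lcountS //; exact: count_take_le. Qed.

Lemma rcount_step w k k' : k < k' -> k < size w ->
  rcount w k + ~~ nth false w k <= rcount w k'.
Proof. by move=> kk kw; rewrite -rcountS //; exact: count_take_le. Qed.

Lemma lcount_lt w k : k < size w -> nth false w k -> lcount w k < nL w.
Proof.
move=> kw wk; have := lcountS kw; rewrite wk addn1 => <-.
rewrite -[w in nL w]take_size; exact: count_take_le.
Qed.

Lemma rcount_lt w k : k < size w -> ~~ nth false w k -> rcount w k < nR w.
Proof.
move=> kw wk; have := rcountS kw; rewrite wk addn1 => <-.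
rewrite -[w in nR w]take_size; exact: count_take_le.
Qed.

Lemma lab_inj i w : {in gtn (size w) &, injective (lab i w)}.
Proof.
have aux k k' : k < k' -> k < size w -> lab i w k <> lab i w k'.
  move=> kk kw; have := lcount_step kk kw; have := rcount_step kk kw; rewrite /lab.
  by case: (nth false w k); case: (nth false w k') => //=; rewrite addn1 => h1 h2 [] e;
    move: h1 h2; rewrite e ltnn.
move=> k k'; rewrite !unfold_in /= => kw kw' e.
case: (ltngtP k k') => // kk; first by case: (aux _ _ kk kw e).
by case: (aux _ _ kk kw' (esym e)).
Qed.

Lemma labs_uniq i w : uniq (labs i w).
Proof.
rewrite map_inj_in_uniq ?iota_uniq // => k k'; rewrite !mem_iota /= !add0n.
exact: lab_inj.
Qed.

Lemma nth_labs i w k d : k < size w -> nth d (labs i w) k = lab i w k.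
Proof. by move=> kw; rewrite (nth_map 0) ?size_iota // nth_iota. Qed.

Lemma size_labs i w : size (labs i w) = size w.
Proof. by rewrite size_map size_iota. Qed.

Definition column (x : label) := if x.2 then x.1.1 else x.1.1.-1.

Lemma column_lab i w k : column (lab i w k) = i.
Proof. by rewrite /lab /column; case: (nth _ _ _). Qed.

Lemma nedges_consec_notin (T : eqType) (s : seq T) x y : x \notin s ->
  nedges (consec s) x y = 0.
Proof.
move=> xs; apply/eqP; rewrite -leqn0 leqNgt -has_count; apply/hasPn => -[a b] ab.
have [aS bS] : a \in s /\ b \in s.
  split; first by have := map_f fst ab; rewrite -[map _ _]/(unzip1 _) => /mem_subseq; apply;
    rewrite /consec; elim: (s) => //= c [|d t] //= IH; rewrite eqxx.
  apply: (mem_behead (s := s)); have := map_f snd ab.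
  rewrite -[map _ _]/(unzip2 _) /consec unzip2_zip //= size_behead; exact: leq_pred.
rewrite /joins !xpair_eqE negb_or !negb_and; apply/andP; split.
  by apply/orP; left; apply: contraNneq xs => <-.
by apply/orP; right; apply: contraNneq xs => <-.
Qed.

Lemma nedges_consec (T : eqType) (s : seq T) d k k' : uniq s ->
  k < size s -> k' < size s ->
  nedges (consec s) (nth d s k) (nth d s k') = ((k' == k.+1) || (k == k'.+1)).
Proof.
elim: s k k' => // a [|b s] IH k k'; first by case: k k' => -[].
move=> /andP[abs us] kl kl'; rewrite /consec /= -/(consec (b :: s)) /nedges /= -/(nedges _ _ _).
case: k k' kl kl' => [|k] [|k'] kl kl'.
- by rewrite nedges_consec_notin //= /joins !xpair_eqE eqxx; case: (eqVneq b a) abs => // ->; rewrite mem_head.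
- rewrite nedges_consec_notin //= addn0 /joins !xpair_eqE eqxx /= orbF.
  case: (eqVneq a (nth d (b :: s) k')) => [e|_]; first by rewrite {1}e mem_nth in abs.
  rewrite /= orbF; congr nat_of_bool; apply/eqP/eqP => [e|[->] //].
  by congr S; apply/eqP; rewrite -(@nth_uniq _ d (b :: s)) //= -e.
- rewrite nedges_sym nedges_consec_notin //= addn0 /joins !xpair_eqE eqxx /=.
  case: (eqVneq a (nth d (b :: s) k)) => [e|_]; first by rewrite {1}e mem_nth in abs.
  rewrite /=; congr nat_of_bool; apply/eqP/eqP => [e|[->] //].
  by congr S; apply/eqP; rewrite -(@nth_uniq _ d (b :: s)) //= -e.
- have aN j : j < size (b :: s) -> (a == nth d (b :: s) j) = false.
    by move=> jl; apply: contraNF abs => /eqP->; rewrite mem_nth.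
  by rewrite /= in kl kl'; rewrite /joins !xpair_eqE /= !aN //= IH.
Qed.

Lemma nedges_rungs m h (x y : label) :
  nedges (rungs m h) x y =
  [&& x.1.1 == m, y.1.1 == m, x.1.2 == y.1.2, x.2 != y.2 & x.1.2 < h].
Proof.
case: x y => [[i a] s] [[i' a'] s'] /=.
set C := [&& i == m, i' == m, a == a' & s != s'].
rewrite /nedges count_map (eq_count (a2 := fun b => (b == a) && C)); last first.
  move=> b; rewrite /joins /C /= !xpair_eqE ![m == _]eq_sym.
  case: (i == m); case: (i' == m); rewrite ?andbF //=.
  case: (eqVneq b a) => [->|ba] /=; rewrite ?andbT.
    by case: (a == a'); case: (s) => /=; case: (s').
  by case: (b == a'); rewrite ?andbF.
transitivity (C && (a < h) : nat); last by rewrite /C -!andbA.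
case: C => /=; last by rewrite (eq_count (a2 := pred0)) ?count_pred0 // => b; rewrite andbF.
rewrite (eq_count (a2 := pred1 a)) => [|b]; last by rewrite /= andbT.
by rewrite count_uniq_mem ?iota_uniq // mem_iota.
Qed.

Lemma nedges_wedges i0 ws x y : nedges (wedges i0 ws) x y =
  \sum_(j < size ws) (nedges (consec (labs (i0 + j) (nth [::] ws j))) x y
     + nedges (rungs (i0 + j).+1 (nR (nth [::] ws j))) x y).
Proof.
elim: ws i0 => [|w ws IH] i0 /=; first by rewrite big_ord0.
rewrite !nedges_cat big_ord_recl /= addn0 IH addnA; congr (_ + _).
by apply: eq_bigr => j _; rewrite /bump /= addnA addn1 addSn.
Qed.

(** Adjacency read from positions: cell (i, k) is the k-th triangle of the
    column i. Used to compare the geometric and the combinatorial dual graph. *)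
Definition adjacent ws (c c' : nat * nat) : bool :=
  let w := nth [::] ws c.1 in let w' := nth [::] ws c'.1 in
  ((c.1 == c'.1) && ((c'.2 == c.2.+1) || (c.2 == c'.2.+1))) ||
  ([&& c'.1 == c.1.+1, ~~ nth false w c.2, nth false w' c'.2 & rcount w c.2 == lcount w' c'.2]
   || [&& c.1 == c'.1.+1, ~~ nth false w' c'.2, nth false w c.2 & rcount w' c'.2 == lcount w c.2]).

Definition in_strip ws (c : nat * nat) := (c.1 < size ws) && (c.2 < size (nth [::] ws c.1)).
Definition cell_label ws (c : nat * nat) := lab c.1 (nth [::] ws c.1) c.2.

Lemma nedges_cells ws c c' : in_strip ws c -> in_strip ws c' ->
  nedges (wedges 0 ws) (cell_label ws c) (cell_label ws c') = adjacent ws c c'.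
Proof.
case: c c' => [i k] [i' k'] /andP[/= il kl] /andP[/= il' kl'].
rewrite nedges_wedges big_split /=.
set w := nth [::] ws i; set w' := nth [::] ws i'.
have notin j : (i != j) -> lab i w k \notin labs j (nth [::] ws j).
  by move=> ij; apply/mapP => -[k0 _ /(congr1 column)]; rewrite !column_lab => /eqP; rewrite (negbTE ij).
have -> : \sum_(j < size ws) nedges (consec (labs (0 + j) (nth [::] ws j))) (lab i w k) (lab i' w' k')
  = ((i == i') && ((k' == k.+1) || (k == k'.+1))).
  rewrite (bigD1 (Ordinal il)) //= [X in _ + X]big1 ?addn0; last first.
    move=> j ji; rewrite nedges_consec_notin // notin //.
    by apply: contra ji => /eqP ji; apply/eqP/val_inj; rewrite /= ji.
  case: (eqVneq i i') => [e|ii'] /=.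
    rewrite /w' -e in kl' *; rewrite -!(nth_labs _ (0, 0, false)) // nedges_consec //;
    by rewrite ?labs_uniq ?size_labs.
  rewrite nedges_sym nedges_consec_notin //.
  by apply/mapP => -[k0 _ /(congr1 column)]; rewrite !column_lab => /eqP; rewrite eq_sym (negbTE ii').
have -> : \sum_(j < size ws) nedges (rungs (0 + j).+1 (nR (nth [::] ws j))) (lab i w k) (lab i' w' k')
  = ([&& i' == i.+1, ~~ nth false w k, nth false w' k' & rcount w k == lcount w' k']
   || [&& i == i'.+1, ~~ nth false w' k', nth false w k & rcount w' k' == lcount w k]).
  under eq_bigr do rewrite nedges_rungs add0n.
  rewrite /lab; case wk: (nth false w k); case wk': (nth false w' k') => /=;
    rewrite ?andbF ?orbF ?andbT /=.
  - by rewrite big1 // => j _; rewrite !andbF.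
  - case: (eqVneq i i'.+1) => [ii|ii] /=; last first.
      rewrite big1 // => j _; case: (eqVneq i j.+1) => //= ij.
      by rewrite -ij eq_sym (negbTE ii).
    rewrite (bigD1 (Ordinal il')) //= big1 ?addn0 => [|j ji].
      rewrite ii !eqxx /= [_ == rcount _ _]eq_sym; case: eqP => //= <-.
      by rewrite rcount_lt ?wk'.
    rewrite [_ == j.+1](_ : _ = false) //; apply: contraNF ji => /eqP ij.
    by apply/eqP/val_inj => /=; apply: succn_inj; rewrite -ij.
  - case: (eqVneq i' i.+1) => [ii|ii] /=; last first.
      rewrite big1 // => j _; case: (eqVneq i.+1 j.+1) => //= ij.
      by rewrite -ij (negbTE ii).
    rewrite (bigD1 (Ordinal il)) //= big1 ?addn0 => [|j ji].
      rewrite ii !eqxx /=; case: eqP => //= _.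
      by rewrite rcount_lt ?wk.
    rewrite [i.+1 == j.+1](_ : _ = false) //; apply: contraNF ji => /eqP ij.
    by apply/eqP/val_inj => /=; apply: succn_inj; rewrite -ij.
  - by rewrite big1 // => j _; rewrite !andbF.
rewrite /adjacent /= -/w -/w'.
case: (eqVneq i i') => [->|ii] //=.
by rewrite ?add0n [i' == i'.+1](_ : _ = false) //= ?addn0 //; apply/eqP; lia.
Qed.

(** The front before the k-th step is a segment from line i to line i+1; the
    triangle adds one point to it. *)
Definition corners ws (c : nat * nat) : seq (nat * nat) :=
  let w := nth [::] ws c.1 in let l := lcount w c.2 in let r := rcount w c.2 in
  [:: (c.1, l); (c.1.+1, r); if nth false w c.2 then (c.1, l.+1) else (c.1.+1, r.+1)].

Lemma corners_uniq ws c : uniq (corners ws c).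
Proof.
rewrite /corners /=; case: (nth false _ _); rewrite !inE !xpair_eqE; lia.
Qed.

(** Two triangles share a side exactly when they are consecutive in a column or
    stand on the same vertical segment. In all other cases at most one corner
    is common, as heights along a line only increase. *)
Lemma common_corners ws c c' : in_strip ws c -> in_strip ws c' ->
  (count [in corners ws c'] (corners ws c) == 2) = adjacent ws c c'.
Proof.
have cs a b : count [in corners ws b] (corners ws a) = count [in corners ws a] (corners ws b).
  rewrite -!size_filter; apply/perm_size/uniq_perm.
  - exact/filter_uniq/corners_uniq.
  - exact/filter_uniq/corners_uniq.
  - by move=> x; rewrite !mem_filter andbC.
have as' a b : adjacent ws a b = adjacent ws b a.
  by rewrite /adjacent [a.1 == b.1]eq_sym [X in X || _](_ : _ = (b.1 == a.1) && ((a.2 == b.2.+1) || (b.2 == a.2.+1))) 1?[X in _ || X]orbC // orbC.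
wlog le : c c' / (c.1 < c'.1) || ((c.1 == c'.1) && (c.2 <= c'.2)).
  move=> W sc sc'; case: (boolP ((c.1 < c'.1) || ((c.1 == c'.1) && (c.2 <= c'.2)))) => h; first exact: W.
  rewrite cs as'; apply: W => //; move: h; lia.
case: c c' le => [i k] [i' k'] /= le /andP[/= il kl] /andP[/= il' kl'].
rewrite /corners /adjacent /=.
set w := nth [::] ws i; set w' := nth [::] ws i'.
have := lr_count (ltnW kl); have := lr_count (ltnW kl').
case: (eqVneq i i') => [e|ne].
  have ww : w' = w by rewrite /w' -e.
  move: le kl'; rewrite e ltnn eqxx /= -/w' ww => le kl'.
  case: (ltngtP k k') le => // [kk|kk] _.
    have := lcount_step kk kl; have := rcount_step kk kl; rewrite -/w.
    case: (nth false w k); case: (nth false w k'); rewrite /= !inE !xpair_eqE; lia.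
  rewrite kk; case: (nth false w k'); rewrite /= !inE !xpair_eqE; lia.
move=> _ _; have {}le : i < i' by move: le; rewrite (negbTE ne) orbF.
have e1 : (i == i'.+1) = false by apply/eqP; lia.
have e2 : (i.+1 == i'.+1) = false by rewrite eqSS (negbTE ne).
rewrite e1 /= orbF [i' == _]eq_sym.
case: (nth false w k); case: (nth false w' k');
  rewrite /= !inE !xpair_eqE ?e1 ?e2 ?(negbTE ne) /= ?andbF ?orbF //.
all: case: (i.+1 == i') => //=.
all: move: (lcount w' k') (rcount w k) => l r {kl kl' il il' cs as' w w'}; clear.
all: lia.
Qed.

End Strip.

Section StripDual.
Local Open Scope nat_scope.

Definition pt (p : nat * nat) : 'rV[int]_2 :=
  \row_(j < 2) Posz (if j == ord0 then p.1 else p.2).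

Lemma pt_inj : injective pt.
Proof.
move=> [a b] [c d] /rowP e.
have := e ord0; have := e (lift ord0 ord0); rewrite !mxE /=.
by move=> [->] [->].
Qed.

Definition tri ws c : {fset 'rV[int]_2} := [fset x in map pt (corners ws c)]%fset.

Definition cells (ws : seq (seq bool)) : seq (nat * nat) :=
  [seq (i, k) | i <- iota 0 (size ws), k <- iota 0 (size (nth [::] ws i))].

Lemma mem_cells ws c : (c \in cells ws) = in_strip ws c.
Proof.
apply/allpairsPdep/idP => [[i [k []]]|].
  by rewrite !mem_iota /= !add0n => il kl ->; apply/andP.
case: c => i k /= /andP[il kl].
by exists i, k; rewrite !mem_iota /= !add0n.
Qed.

Definition strip ws : {fset {fset 'rV[int]_2}} := [fset t in map (tri ws) (cells ws)]%fset.

Lemma mem_strip ws t : reflect (exists2 c, in_strip ws c & t = tri ws c) (t \in strip ws).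
Proof.
rewrite in_fset; apply: (iffP mapP) => -[c cs ->]; exists c => //.
  by rewrite -mem_cells.
by rewrite mem_cells.
Qed.

Lemma card_common ws c c' :
  #|` (tri ws c `&` tri ws c')%fset| = count [in corners ws c'] (corners ws c).
Proof.
have -> : (tri ws c `&` tri ws c' = [fset x in [seq x <- map pt (corners ws c) |
    x \in map pt (corners ws c')]])%fset.
  by apply/fsetP => x; rewrite in_fsetI !in_fset mem_filter andbC.
rewrite card_fseq undup_id ?filter_uniq ?map_inj_uniq ?corners_uniq //; last exact: pt_inj.
rewrite size_filter count_map; apply: eq_count => x; exact: (mem_map pt_inj).
Qed.

(** The sums of x, y and xy over the corners determine the column, the side
    on which the triangle stands and its position. *)
Lemma tri_inj ws : {in in_strip ws &, injective (tri ws)}.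
Proof.
move=> c c' cs cs' /fsetP e.
have pe : perm_eq (corners ws c) (corners ws c').
  apply: uniq_perm; rewrite ?corners_uniq // => x.
  by have := e (pt x); rewrite !in_fset !mem_map //; exact: pt_inj.
have S (f : nat * nat -> nat) : \sum_(x <- corners ws c) f x = \sum_(x <- corners ws c') f x.
  exact: perm_big.
move: (S fst) (S snd) (S (fun x => x.1 * x.2)) => {S pe e}.
case: c c' cs cs' => [i k] [i' k']; rewrite !unfold_in => /andP[/= il kl] /andP[/= il' kl'].
have := lr_count (ltnW kl); have := lr_count (ltnW kl').
rewrite /corners /= !big_cons !big_nil /=.
set w := nth [::] ws i; set w' := nth [::] ws i'.
move: (lcount w k) (rcount w k) (lcount w' k') (rcount w' k') => l r l' r' e' e.
case: (nth false w k); case: (nth false w' k') => /= s1 s2 s3.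
- have ii : i = i' by lia.
  (* s4 supplies the product in which the quadratic terms of s3 cancel *)
  have s4 := congr1 (muln i') s2; subst i'; congr (_, _); nia.
- by exfalso; lia.
- by exfalso; lia.
- have ii : i = i' by lia.
  have s4 := congr1 (muln i') s2; subst i'; congr (_, _); nia.
Qed.

Lemma mem_wlabs i0 ws x : reflect
  (exists2 c, in_strip ws c & x = lab (i0 + c.1) (nth [::] ws c.1) c.2) (x \in wlabs i0 ws).
Proof.
elim: ws i0 x => [|w ws IH] i0 x /=; first by constructor; case=> -[i k] /andP[].
rewrite mem_cat; apply: (iffP orP) => [[/mapP[k + ->]|/IH[[i k] ik ->]]|[[[|i] k] ik ->]].
- by rewrite mem_iota => kl; exists (0, k); rewrite /in_strip //= addn0.
- by exists (i.+1, k); rewrite /= ?addnS.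
- by left; rewrite /= addn0; apply: map_f; rewrite mem_iota.
- by right; apply/IH; exists (i, k) => //=; rewrite addSnnS.
Qed.

Theorem dual_strip ws :
  graph_iso (dual_graph (strip ws)) (lgraph (wlabs 0 ws) (wedges 0 ws)).
Proof.
apply: graph_iso_sym.
have ex (x : seq_sub (wlabs 0 ws)) : exists c, in_strip ws c && (val x == cell_label ws c).
  by have /mem_wlabs[c cs ->] := valP x; exists c; rewrite cs /=.
pose cell x := xchoose (ex x).
have cellP x : in_strip ws (cell x) by have /andP[] := xchooseP (ex x).
have cellE x : val x = cell_label ws (cell x) by have /andP[_ /eqP] := xchooseP (ex x).
have tP x : tri ws (cell x) \in strip ws by apply/mem_strip; exists (cell x).
pose h (x : lgraph (wlabs 0 ws) (wedges 0 ws)) : dual_graph (strip ws) := FSetSub (tP x).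
have injh : injective h.
  move=> x y /(congr1 val) /= /tri_inj e; apply: val_inj.
  have {}e : cell x = cell y by apply: e; exact: cellP.
  exact: etrans (cellE x) (etrans (congr1 _ e) (esym (cellE y))).
exists h; split; last first.
  move=> x y; rewrite /= cellE [in RHS]cellE.
  by rewrite nedges_cells // card_common common_corners.
apply: inj_surj_bij => // t; have /mem_strip[c cs tc] := valP t.
have xin : cell_label ws c \in wlabs 0 ws by apply/mem_wlabs; exists c.
exists (SeqSub xin); apply: val_inj; rewrite /= [RHS]tc; congr tri.
have := cellE (SeqSub xin); rewrite /=; move: (cellP (SeqSub xin)).
move: (cell _) => c' cs' e; move: cs cs' (congr1 column e); rewrite /cell_label !column_lab.
case: c c' {xin tc} e => [i k] [i' k'] /= + /andP[/= il kl] /andP[/= il' kl'] ii.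
by rewrite /cell_label /= -ii in kl' * => /lab_inj ->; rewrite ?unfold_in.
Qed.

End StripDual.

(** * Triangulations certified by a height function *)

Section Convexity.
Local Open Scope classical_set_scope.
Local Open Scope ring_scope.
Variable R : realType.

Lemma nonzero_weight n (w : 'I_n -> R) : \sum_i w i = 1 -> exists i, w i != 0.
Proof.
move=> w1; apply/existsP; rewrite -[X in is_true X]negbK negb_exists; apply/negP => /forallP H.
have : \sum_i w i = 0 by rewrite big1 // => i _; apply/eqP; rewrite -[_ == _]negbK; exact: H.
by rewrite w1 => /eqP; rewrite oner_eq0.
Qed.

Section Hull.
Variable E : lmodType R.
Implicit Types (A B : set E) (phi : E -> R).

(** Affine functions, in the only form in which they are used: they commute
    with convex combinations. *)
Definition barycentric phi := forall n (w : 'I_n -> R) (p : 'I_n -> E),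
  \sum_i w i = 1 -> phi (\sum_i w i *: p i) = \sum_i w i * phi (p i).

Lemma conv_hull_mono A B : A `<=` B -> conv_hull A `<=` conv_hull B.
Proof.
move=> AB x [n [w [p [w0 w1 pA ->]]]].
by exists n, w, p; split=> // i; exact/AB/pA.
Qed.

Lemma sub_conv_hull A : A `<=` conv_hull A.
Proof.
move=> x Ax; exists 1%N, (fun=> 1), (fun=> x); split=> //.
  by rewrite big_ord1.
by rewrite big_ord1 scale1r.
Qed.

Lemma conv_hull_le0 A phi : barycentric phi -> (forall p, A p -> phi p <= 0) ->
  forall x, conv_hull A x -> phi x <= 0.
Proof.
move=> aphi A0 x [n [w [p [w0 w1 pA ->]]]]; rewrite aphi // sumr_le0 // => i _.
by rewrite mulr_ge0_le0 // A0.
Qed.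

Lemma conv_hull_eq0 A phi : barycentric phi -> (forall p, A p -> phi p = 0) ->
  forall x, conv_hull A x -> phi x = 0.
Proof.
move=> aphi A0 x [n [w [p [w0 w1 pA ->]]]]; rewrite aphi // big1 // => i _.
by rewrite A0 // mulr0.
Qed.

(** In a convex combination where a nonpositive affine function vanishes, it
    vanishes at every point of nonzero weight; the points of weight zero are
    replaced by one of nonzero weight. *)
Lemma conv_hull_face A phi : barycentric phi -> (forall p, A p -> phi p <= 0) ->
  forall x, conv_hull A x -> phi x = 0 -> conv_hull (A `&` [set p | phi p = 0]) x.
Proof.
move=> aphi A0 x [n [w [p [w0 w1 pA ->]]]]; rewrite aphi // => s0.
have wphi i : w i * phi (p i) = 0.
  have : \sum_i (- (w i * phi (p i))) = 0 by rewrite sumrN s0 oppr0.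
  move/eqP; rewrite psumr_eq0 => [/allP/(_ i (mem_index_enum i))/=|j _].
    by rewrite oppr_eq0 => /eqP.
  by rewrite oppr_ge0 mulr_ge0_le0 // A0.
have [i0 wi0] := nonzero_weight w1.
exists n, w, (fun i => if w i == 0 then p i0 else p i); split=> //.
  move=> i; case: (eqVneq (w i) 0) => [_|wi]; split=> //=.
    by apply/eqP; have /eqP := wphi i0; rewrite mulf_eq0 (negbTE wi0).
  by apply/eqP; have /eqP := wphi i; rewrite mulf_eq0 (negbTE wi).
by apply: eq_bigr => i _; case: (eqVneq (w i) 0) => [->|//]; rewrite !scale0r.
Qed.

End Hull.

Lemma conv_hull_image (E E' : lmodType R) (f : {linear E -> E'}) (A : set E) :
  f @` conv_hull A = conv_hull (f @` A).
Proof.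
apply/seteqP; split=> x.
  move=> [_ [n [w [p [w0 w1 pA ->]]]] <-].
  exists n, w, (fun i => f (p i)); split=> // [i|]; first by exists (p i).
  by rewrite linear_sum; apply: eq_bigr => i _; rewrite linearZ.
move=> [n [w [p [w0 w1 pA ->]]]].
have pA' i : exists q, A q /\ f q = p i by case: (pA i) => q; exists q.
have [q qP] := choice pA'.
exists (\sum_i w i *: q i); last first.
  by rewrite linear_sum; apply: eq_bigr => i _; rewrite linearZ; have [_ ->] := qP i.
by exists n, w, q; split=> // i; have [] := qP i.
Qed.

Definition aff (l : 'cV[R]_2) (c : R) (x : 'rV[R]_2) : R := (x *m l) 0 0 + c.

Lemma aff_barycentric l c : barycentric (aff l c).
Proof.
move=> n w p w1; rewrite /aff mulmx_suml summxE -[c in LHS]mul1r -w1 mulr_suml -big_split /=.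
by apply: eq_bigr => i _; rewrite -scalemxAl mxE mulrDr.
Qed.

Lemma affB l c l' c' x : aff (l - l') (c - c') x = aff l c x - aff l' c' x.
Proof. by rewrite /aff mulmxBr !mxE opprD addrACA. Qed.

Lemma affZ a l c x : aff (a *: l) (a * c) x = a * aff l c x.
Proof. by rewrite /aff -scalemxAr !mxE mulrDr. Qed.

End Convexity.

Section Unimodular.
Local Open Scope classical_set_scope.
Local Open Scope ring_scope.

Lemma col_mx_rows (u v : 'rV[int]_2) :
  (forall k, (col_mx u v : 'M[int]_2) 0 k = u 0 k) /\
  (forall k, (col_mx u v : 'M[int]_2) 1 k = v 0 k).
Proof.
split=> k; first by rewrite -(col_mxEu u v); congr (col_mx _ _ _ _); exact: val_inj.
by rewrite -(col_mxEd u v); congr (col_mx _ _ _ _); exact: val_inj.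
Qed.

(** The matrix of the sides has determinant 1 or -1, so it is invertible over
    any commutative ring; over the integers this gives integral affine
    functions. *)
Lemma interpolation (K : comUnitRingType) (t : {fset 'rV[int]_2}) (u : 'rV[int]_2 -> K) :
  unimodular_triangle t -> exists (l : 'cV[K]_2) (c : K), forall p, p \in t ->
    (map_mx intr p *m l) 0 0 + c = u p.
Proof.
move=> [a [b [d [-> area]]]].
set M : 'M[int]_2 := col_mx (b - a) (d - a).
have detM : `|\det M| = 1.
  move: area; rewrite /triangle_area -/M => /(congr1 (fun x => x * 2)).
  rewrite !divfK // => e; apply: (@intr_inj rat); exact: e.
pose MK : 'M[K]_2 := map_mx intr M.
have uMK : MK \in unitmx.
  rewrite unitmxE det_map_mx.
  have [->|->] : \det M = 1 \/ \det M = -1.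
    by move: detM; case: ger0P => _ e; [left | right; rewrite -e opprK].
    by rewrite unitr1.
  by rewrite rmorphN unitrN unitr1.
pose v : 'cV[K]_2 := \col_i (if i == 0 then u b - u a else u d - u a).
pose l := invmx MK *m v.
have Ml : MK *m l = v by rewrite mulKVmx.
have [M0 M1] := col_mx_rows (b - a) (d - a); rewrite -/M in M0 M1.
have r0 : (map_mx intr (b - a) *m l) 0 0 = u b - u a.
  transitivity (v 0 0); last by rewrite mxE.
  by rewrite -Ml !mxE; apply: eq_bigr => k _; rewrite [MK 0 k]mxE M0 mxE.
have r1 : (map_mx intr (d - a) *m l) 0 0 = u d - u a.
  transitivity (v 1 0); last by rewrite mxE.
  by rewrite -Ml !mxE; apply: eq_bigr => k _; rewrite [MK 1 k]mxE M1 mxE.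
have subE (A B : 'rV[K]_2) : ((A - B) *m l) 0 0 = (A *m l) 0 0 - (B *m l) 0 0.
  by rewrite mulmxBl mxE [X in _ + X]mxE.
exists l, (u a - (map_mx intr a *m l) 0 0) => p; rewrite !inE -orbA.
case/or3P=> /eqP->; first by rewrite addrCA subrr addr0.
  by rewrite addrCA -subE -map_mxB r0 addrCA subrr addr0.
by rewrite addrCA -subE -map_mxB r1 addrCA subrr addr0.
Qed.

Variable R : realType.

Lemma real_pt_inj : injective (real_pt R).
Proof.
move=> a b /matrixP e; apply/matrixP => i j.
by have := e i j; rewrite !mxE => /intr_inj.
Qed.

Lemma aff_int (l : 'cV[int]_2) (c : int) (q : 'rV[int]_2) :
  aff (map_mx intr l) c%:~R (real_pt R q) = ((q *m l) 0 0 + c)%:~R.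
Proof. by rewrite /aff /real_pt -map_mxM mxE rmorphD. Qed.

Lemma conv_hull_single (E : lmodType R) (A : set E) v :
  (forall q, A q -> q = v) -> forall x, conv_hull A x -> x = v.
Proof.
move=> Av x [n [w [p [_ w1 pA ->]]]].
rewrite (eq_bigr (fun i => w i *: v)) => [|i _]; last by rewrite (Av _ (pA i)).
by rewrite -scaler_suml w1 scale1r.
Qed.

(** If v has nonzero weight in p, the integral affine function that is 1 at v
    and 0 at the other vertices takes at p an integral value in (0, 1], hence
    the value 1, so that p = v. *)
Lemma lattice_point_vertex (t : {fset 'rV[int]_2}) p :
  unimodular_triangle t -> lattice_hull t (real_pt R p) -> p \in t.
Proof.
move=> ut hp; have [n [w [q [w0 w1 qt pE]]]] := hp.
have [i wi] := nonzero_weight w1.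
have [v vt qi] := qt i.
have [l [c lc]] := interpolation (fun x => (x == v)%:R : int) ut.
have {}lc x : x \in t -> (x *m l) 0 0 + c = (x == v)%:R.
  by move=> /lc <-; congr ((_ *m l) 0 0 + c); apply/matrixP => j k; rewrite mxE intz.
pose phi := aff (map_mx intr l : 'cV[R]_2) c%:~R.
have phit x : x \in t -> phi (real_pt R x) = (x == v)%:R.
  by move=> xt; rewrite /phi aff_int lc // natz; case: (_ == _).
have phip : phi (real_pt R p) = ((p *m l) 0 0 + c)%:~R by exact: aff_int.
have phi_gt0 : 0 < phi (real_pt R p).
  rewrite pE /phi (aff_barycentric _ _ _ w1) (bigD1 i) //= -/phi -qi phit // eqxx mulr1.
  rewrite ltr_pwDl ?lt0r ?wi ?w0 // sumr_ge0 // => j _; have [x xt <-] := qt j.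
  by rewrite -/phi phit // mulr_ge0.
have phi_ge1 : 1 <= phi (real_pt R p).
  by move: phi_gt0; rewrite phip ltr0z ler1z gtz0_ge1.
pose psi := aff (map_mx intr l : 'cV[R]_2) (c%:~R - 1).
have psiE x : psi x = phi x - 1 by rewrite /psi /phi /aff addrA.
have psi_le0 x : [set real_pt R p | p in [set` t]] x -> psi x <= 0.
  by move=> [y yt <-]; rewrite psiE phit // subr_le0; case: (_ == _).
have psi_p := conv_hull_le0 (aff_barycentric _ _) psi_le0 hp.
have psi0 : psi (real_pt R p) = 0.
  by apply/eqP; rewrite eq_le psi_p psiE subr_ge0.
have := conv_hull_face (aff_barycentric _ _) psi_le0 hp psi0.
move/(conv_hull_single (v := real_pt R v)) => e.
suff /real_pt_inj -> : real_pt R p = real_pt R v by [].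
apply: e => _ [[x xt <-]] /=; rewrite -/(psi _) psiE phit //.
by case: eqP => [->//|_] /eqP; rewrite sub0r oppr_eq0 oner_eq0.
Qed.

End Unimodular.

Section Certified.
Local Open Scope classical_set_scope.
Local Open Scope ring_scope.
Variables (R : realType) (T : {fset {fset 'rV[int]_2}}) (P : {fset 'rV[int]_2}).
Variable h : 'rV[int]_2 -> R.
Let D : set 'rV[R]_2 := lattice_hull P.
Hypothesis unimodular : forall t, t \in T -> unimodular_triangle t.
Hypothesis vertices : forall t, t \in T -> (t `<=` P)%fset.
Hypothesis covering : forall x, D x -> exists2 t, t \in T & lattice_hull t x.
Hypothesis certificate : forall t, t \in T -> exists l c, forall p, p \in P ->
  aff l c (real_pt R p) <= h p ?= iff (p \in t).

Lemma lattice_hull_mono (s t : {fset 'rV[int]_2}) : (s `<=` t)%fset ->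
  lattice_hull s `<=` (lattice_hull t : set 'rV[R]_2).
Proof.
by move=> /fsubsetP st; apply: conv_hull_mono => _ [p ps <-]; exists p => //; exact: st.
Qed.

Lemma lattice_points p : D (real_pt R p) <-> p \in P.
Proof.
split=> [/covering[t tT]|pP].
  by move/(lattice_point_vertex (unimodular tT)); apply/fsubsetP/vertices.
by apply: sub_conv_hull; exists p.
Qed.

(** The supporting functions of two triangles differ by an affine function that
    is nonpositive on one and nonnegative on the other, and vanishes exactly at
    the common vertices. *)
Lemma certified_meet t1 t2 : t1 \in T -> t2 \in T ->
  lattice_hull t1 `&` lattice_hull t2 = lattice_hull (t1 `&` t2)%fset :> set 'rV[R]_2.
Proof.
move=> t1T t2T; apply/seteqP; split=> [x [x1 x2]|x xI]; last first.
  by split; apply: lattice_hull_mono xI; [exact: fsubsetIl | exact: fsubsetIr].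
have [l1 [c1 cert1]] := certificate t1T; have [l2 [c2 cert2]] := certificate t2T.
pose phi := aff (l2 - l1) (c2 - c1).
have t1P p : p \in t1 -> p \in P by apply/fsubsetP/vertices.
have t2P p : p \in t2 -> p \in P by apply/fsubsetP/vertices.
have le1 p : p \in t1 -> phi (real_pt R p) <= 0 ?= iff (p \in t2).
  move=> pt1; rewrite /phi affB; have [_ /eqP] := cert1 p (t1P p pt1); rewrite pt1 => ->.
  by rewrite leifBLR add0r; exact: cert2 p (t1P p pt1).
have le2 p : p \in t2 -> 0 <= phi (real_pt R p).
  move=> pt2; rewrite /phi affB; have [_ /eqP] := cert2 p (t2P p pt2); rewrite pt2 => ->.
  by rewrite subr_ge0; have [] := cert1 p (t2P p pt2).
have A1 y : [set real_pt R p | p in [set` t1]] y -> phi y <= 0.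
  by move=> [p pt1 <-]; have [] := le1 p pt1.
pose psi := aff (l1 - l2) (c1 - c2).
have psiE y : psi y = - phi y by rewrite /psi /phi !affB opprB.
have phix0 : phi x = 0.
  apply/eqP; rewrite eq_le (conv_hull_le0 (aff_barycentric _ _) A1 x1) /=.
  rewrite -oppr_le0 -psiE; apply: (conv_hull_le0 (aff_barycentric _ _) _ x2).
  by move=> _ [p pt2 <-]; rewrite -/(psi _) psiE oppr_le0 le2.
have := conv_hull_face (aff_barycentric _ _) A1 x1 phix0.
apply: conv_hull_mono => _ [[p pt1 <-]] /= p0; exists p => //=.
by rewrite in_fsetI pt1 /=; have [_ <-] := le1 p pt1; apply/eqP.
Qed.

Lemma certified_unimodular_triangulation : unimodular_triangulation D T.
Proof.
split=> //.
- apply/seteqP; split=> [x [t tT]|x /covering[t tT xt]]; last by exists t.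
  exact/lattice_hull_mono/vertices.
- move=> t1 t2 t1T t2T; exists (t1 `&` t2)%fset; split; rewrite ?fsubsetIl ?fsubsetIr //.
  exact: certified_meet.
Qed.

Let lifted p : 'rV[R]_(2 + 1) := row_mx (real_pt R p) (h p)%:M.

Lemma lifted_polytopeE : lifted_polytope D h = conv_hull [set lifted p | p in [set` P]].
Proof.
congr conv_hull; apply/seteqP; split=> _ [p pD <-]; exists p => //.
  exact/lattice_points.
by apply/lattice_points.
Qed.

Let excess l c (q : 'rV[R]_(2 + 1)) : R := aff l c (lsubmx q) - rsubmx q 0 0.

Lemma excess_barycentric l c : barycentric (excess l c).
Proof.
move=> n w p w1; rewrite /excess !linear_sum /= summxE.
rewrite (eq_bigr (fun i => w i *: lsubmx (p i))) => [|i _]; last by rewrite linearZ.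
rewrite (aff_barycentric _ _ _ w1) -sumrB; apply: eq_bigr => i _.
by rewrite linearZ mxE mulrBr.
Qed.

Lemma excess_lifted l c p : excess l c (lifted p) = aff l c (real_pt R p) - h p.
Proof. by rewrite /excess row_mxKl row_mxKr mxE. Qed.

Lemma lower_face_hull l c (s : {fset 'rV[int]_2}) :
  (forall p, p \in P -> aff l c (real_pt R p) <= h p ?= iff (p \in s)) ->
  (s `<=` P)%fset ->
  lsubmx @` [set q | lifted_polytope D h q /\ rsubmx q 0 0 = aff l c (lsubmx q)]
  = lattice_hull s.
Proof.
move=> cert /fsubsetP sP; rewrite lifted_polytopeE.
have le0 q : [set lifted p | p in [set` P]] q -> excess l c q <= 0.
  by move=> [p pP <-]; rewrite excess_lifted subr_le0; have [] := cert p pP.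
have -> : [set q | conv_hull [set lifted p | p in [set` P]] q /\
      rsubmx q 0 0 = aff l c (lsubmx q)] = conv_hull [set lifted p | p in [set` s]].
  apply/seteqP; split=> [q [qP e]|q qs].
    have e0 : excess l c q = 0 by rewrite /excess e subrr.
    have := conv_hull_face (@excess_barycentric l c) le0 qP e0.
    apply: conv_hull_mono => _ [[p pP <-]] /= /eqP.
    rewrite excess_lifted subr_eq0 => pe; exists p => //.
    by rewrite /=; have [_ <-] := cert p pP.
  split; first by apply: conv_hull_mono qs => _ [p ps <-]; exists p => //; exact: sP.
  apply/esym/eqP; rewrite -subr_eq0 -/(excess l c q); apply/eqP.
  apply: (conv_hull_eq0 (@excess_barycentric l c) _ qs) => _ [p ps <-].
  rewrite excess_lifted; apply/eqP; rewrite subr_eq0.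
  by have [_ ->] := cert p (sP p ps).
rewrite (conv_hull_image (lsubmx : {linear 'rV[R]_(2 + 1) -> 'rV[R]_2})).
congr conv_hull; apply/seteqP; split=> [_ [_ [p ps <-] <-]|_ [p ps <-]].
  by exists p => //; rewrite /= /lifted row_mxKl.
by exists (lifted p); [exists p | rewrite /= /lifted row_mxKl].
Qed.

Lemma below_polytope l c :
  (forall q, lifted_polytope D h q -> (lsubmx q *m l) 0 0 + c <= rsubmx q 0 0) <->
  (forall p, p \in P -> aff l c (real_pt R p) <= h p).
Proof.
rewrite lifted_polytopeE; split=> [H p pP|H q qP].
  have := H (lifted p); rewrite row_mxKl row_mxKr [X in _ <= X]mxE; apply.
  by apply: sub_conv_hull; exists p.
rewrite -subr_le0 -/(excess l c q).
apply: (conv_hull_le0 (@excess_barycentric l c) _ qP) => _ [p pP <-].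
by rewrite excess_lifted subr_le0 H.
Qed.

(** The barycentre x of s lies in some triangle t. At the points of s, hence
    at x, the supporting function of t is at most that of s; at the vertices of
    t, hence at x, it is at least that of s. So equality holds at all points of
    s, which are therefore vertices of t. *)
Lemma contact_in_triangle l c (s : {fset 'rV[int]_2}) :
  (forall p, p \in P -> aff l c (real_pt R p) <= h p ?= iff (p \in s)) ->
  (s `<=` P)%fset -> s != fset0 -> exists2 t, t \in T & (s `<=` t)%fset.
Proof.
move=> cert /fsubsetP sP s0.
pose n := size (enum_fset s); pose q (i : 'I_n) := tnth (in_tuple (enum_fset s)) i.
have n0 : (n%:R : R) != 0 by rewrite pnatr_eq0 -lt0n -/(#|` s|) cardfs_gt0.
have qs i : q i \in s by exact: mem_tnth.
have w1 : \sum_(i < n) (n%:R^-1 : R) = 1.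
  by rewrite sumr_const card_ord -[RHS](mulVf n0) mulr_natr.
pose x := \sum_(i < n) n%:R^-1 *: real_pt R (q i).
have xD : D x.
  exists n, (fun=> n%:R^-1), (fun i => real_pt R (q i)); split=> // i.
  by exists (q i) => //=; exact: sP.
have [t tT xt] := covering xD; exists t => //.
have [l0 [c0 cert0]] := certificate tT.
pose phi := aff (l0 - l) (c0 - c).
have phis p : p \in s -> phi (real_pt R p) <= 0 ?= iff (p \in t).
  move=> ps; rewrite /phi affB; have [_ /eqP] := cert p (sP p ps); rewrite ps => ->.
  by rewrite leifBLR add0r; exact: cert0 p (sP p ps).
have phix_le0 : 0 <= phi x.
  have psiE y : aff (l - l0) (c - c0) y = - phi y by rewrite /phi !affB opprB.
  rewrite -oppr_le0 -psiE; apply: (conv_hull_le0 (aff_barycentric _ _) _ xt).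
  move=> _ [p pt <-]; have pP : p \in P by move: (p) pt; apply/fsubsetP/vertices.
  rewrite affB; have [_ /eqP] := cert0 p pP; rewrite (pt : p \in t) => ->.
  by rewrite subr_le0; have [] := cert p pP.
apply/fsubsetP => p ps; have [_ <-] := phis p ps; apply/eqP.
have qphi i : 0 <= - phi (real_pt R (q i)) by rewrite oppr_ge0; have [] := phis _ (qs i).
have : \sum_(i < n) n%:R^-1 * - phi (real_pt R (q i)) == 0.
  rewrite eq_le sumr_ge0 ?andbT => [|i _]; last by rewrite mulr_ge0 ?invr_ge0.
  under eq_bigr do rewrite mulrN.
  by rewrite sumrN oppr_le0 -(aff_barycentric _ _ _ w1).
rewrite psumr_eq0 => [/allP H|i _]; last by rewrite mulr_ge0 ?invr_ge0.
have /tnthP[i pq] : p \in in_tuple (enum_fset s) by [].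
have := H i (mem_index_enum i); rewrite /= mulf_eq0 invr_eq0 (negbTE n0) oppr_eq0.
by rewrite /q -pq => /eqP.
Qed.

(** Tilt the supporting function of t slightly downwards at the vertices of t
    outside s: the finitely many other points stay strictly above it. *)
Lemma face_certificate t (s : {fset 'rV[int]_2}) : t \in T -> (s `<=` t)%fset ->
  exists l c, forall p, p \in P -> aff l c (real_pt R p) <= h p ?= iff (p \in s).
Proof.
move=> tT /fsubsetP st; have [l0 [c0 cert0]] := certificate tT.
have [l [c lc]] := interpolation (fun x => (x \notin s)%:R : R) (unimodular tT).
pose phi := aff l c.
have [e e0 small] : exists2 e : R, 0 < e & forall p, p \in P -> p \notin t ->
    e * - phi (real_pt R p) < h p - aff l0 c0 (real_pt R p).
  have gap p : p \in P -> p \notin t -> 0 < h p - aff l0 c0 (real_pt R p).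
    move=> pP pt; rewrite subr_gt0 lt_neqAle; have [-> ->] := cert0 p pP.
    by rewrite pt.
  suff H (r : seq 'rV[int]_2) : {subset r <= P} -> exists2 e : R, 0 < e &
      forall p, p \in r -> p \notin t ->
        e * - phi (real_pt R p) < h p - aff l0 c0 (real_pt R p) by exact: (H (enum_fset P)).
  elim: r => [_|p r IH sub]; first by exists 1.
  have [e e0 He] := IH (fun x xr => sub x (mem_behead (s := p :: r) xr)).
  have pP : p \in P by apply: sub; exact: mem_head.
  have shrink e' q : 0 < e' -> e' <= e -> q \in P -> q \notin t ->
      e * - phi (real_pt R q) < h q - aff l0 c0 (real_pt R q) ->
      e' * - phi (real_pt R q) < h q - aff l0 c0 (real_pt R q).
    move=> e'0 e'e qP qt; case: (lerP 0 (- phi (real_pt R q))) => s0.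
      by apply: le_lt_trans; rewrite ler_wpM2r.
    by move=> _; apply: lt_trans (gap q qP qt); rewrite pmulr_rlt0.
  have [pt|pt] := boolP (p \in t).
    exists e => // q; rewrite inE => /orP[/eqP->|]; first by rewrite pt.
    exact: He.
  pose g := h p - aff l0 c0 (real_pt R p).
  pose m := `|phi (real_pt R p)| + 1.
  have m0 : 0 < m by rewrite ltr_pwDr.
  have g0 : 0 < g by exact: gap.
  (* with this bound e * m <= g / 2 is below the gap at p *)
  exists (Num.min e (g / (2 * m))).
    by rewrite lt_min e0 divr_gt0 ?mulr_gt0.
  move=> q; rewrite inE => /orP[/eqP-> _|qr qt].
    have le : g / (2 * m) * - phi (real_pt R p) < g.
      have phim : - phi (real_pt R p) < m.
        by rewrite (le_lt_trans (ler_norm _)) // normrN ltrDl.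
      rewrite -mulrA gtr_pMr // mulrC ltr_pdivrMr ?mulr_gt0 // mul1r.
      by rewrite (lt_trans phim) // ltr_pMl // ltr1n.
    case: (lerP 0 (- phi (real_pt R p))) => s0.
      apply: le_lt_trans le; rewrite ler_wpM2r //.
      by rewrite ge_min lexx orbT.
    apply: (lt_trans _ g0); rewrite pmulr_rlt0 //.
    by rewrite lt_min e0 divr_gt0 ?mulr_gt0.
  apply: shrink (He q qr qt) => //.
  - by rewrite lt_min e0 divr_gt0 ?mulr_gt0.
  - by rewrite ge_min lexx.
  - by apply: sub; rewrite inE qr orbT.
exists (l0 - e *: l), (c0 - e * c) => p pP; rewrite affB affZ -/phi.
have [pt|pt] := boolP (p \in t).
  have [_ /eqP] := cert0 p pP; rewrite pt => ->.
  rewrite /phi /aff /real_pt lc //; case: (boolP (p \in s)) => ps /=.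
    by rewrite mulr0 subr0; split; rewrite ?lexx ?eqxx.
  by rewrite mulr1; split; [rewrite gerBl ltW | apply/negbTE; rewrite lt_eqF // gtrBl].
have lt : aff l0 c0 (real_pt R p) - e * phi (real_pt R p) < h p.
  by have := small p pP pt; rewrite mulrN ltrBrDl.
by split; [exact: ltW | rewrite (lt_eqF lt); apply/esym; apply: contraNF pt => /st].
Qed.

(** The projection of a lower face is the hull of the points of contact, which
    are vertices of a single triangle; conversely every face of a triangle is
    a set of contact. *)
Lemma certified_regular : regular_triangulation D T.
Proof.
exists h; apply/seteqP; split=> [_ [F [F0 [l [c [below FE]]]] <-]|_ [t [s [tT st s0 ->]]]].
  move/below_polytope in below.
  pose s := [fset p in P | aff l c (real_pt R p) == h p]%fset.
  have cert p : p \in P -> aff l c (real_pt R p) <= h p ?= iff (p \in s).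
    by move=> pP; split; [exact: below | rewrite !inE /= pP].
  have sP : (s `<=` P)%fset by apply/fsubsetP => p; rewrite !inE => /andP[].
  have FsE : lsubmx @` F = lattice_hull s by rewrite FE; exact: lower_face_hull.
  have s0 : s != fset0.
    apply/eqP => s0; have [q Fq] := F0.
    have : (lsubmx @` F) (lsubmx q) by exists q.
    rewrite FsE s0 => -[n [w [p [_ w1 pA _]]]].
    case: n w p w1 pA => [|n] w p w1 pA; first by move/eqP: w1; rewrite big_ord0 eq_sym oner_eq0.
    by have [x] := pA ord0; rewrite /= inE.
  have [t tT st] := contact_in_triangle cert sP s0.
  by exists t, s.
have [l [c cert]] := face_certificate tT st.
have sP : (s `<=` P)%fset by exact: fsubset_trans st (vertices tT).
exists [set q | lifted_polytope D h q /\ rsubmx q 0 0 = aff l c (lsubmx q)].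
  split.
    have [p ps] : exists p, p \in s by exact/fset0Pn.
    exists (lifted p); split.
      rewrite lifted_polytopeE; apply: sub_conv_hull; exists p => //.
      by move: (p) ps; apply/fsubsetP.
    rewrite row_mxKl row_mxKr mxE mulr1n; apply/esym/eqP.
    have pP : p \in P by move: (p) ps; apply/fsubsetP.
    by have [_ ->] := cert p pP.
  exists l, c; split=> //; apply/below_polytope => p pP.
  by have [] := cert p pP.
exact: lower_face_hull.
Qed.

End Certified.

(** * Convex functions with prescribed interleaving of slopes *)

Section Slopes.
Local Open Scope ring_scope.
Variable R : realType.
Implicit Types (w v : seq bool) (l m s : seq R).

(** Fill in arbitrary real numbers at the positions of the word that are not
    prescribed, keeping the sequence increasing: the reals are densely
    ordered. *)
Lemma merge_slopes w l lo : path <%R lo l -> size l = nL w ->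
  exists m, [/\ path <%R lo m, size m = size w & mask w m = l].
Proof.
elim: w l lo => [|[] w IH] l lo lol sl.
- by exists [::]; split=> //; case: l {lol} sl.
- case: l lol sl => //= x l /andP[lox xl] [sl].
  have [m [xm sm ml]] := IH l x xl sl.
  by exists (x :: m); rewrite /= lox xm sm ml.
- have [x lox xl] : exists2 x, lo < x & path <%R x l.
    case: l lol {sl} => [_|y l /= /andP[loy yl]]; first by exists (lo + 1); rewrite // ltrDl.
    exists ((lo + y) / 2); first by rewrite midf_lt.
    by rewrite /= yl andbT midf_lt.
  have [m [xm sm ml]] := IH l x xl sl.
  by exists (x :: m); rewrite /= lox xm sm ml.
Qed.

(** Going through the columns from left to right, the slopes on the left line
    of a column are already chosen; merging determines slopes on its right
    line. The increasing sequence ms i lists the slopes on both lines in the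
    order in which the word alternates between them. *)
Lemma slopes_exist ws l : sorted <%R l -> size l = nL (head [::] ws) ->
  (forall i, (i.+1 < size ws)%N -> nR (nth [::] ws i) = nL (nth [::] ws i.+1)) ->
  exists ms : nat -> seq R,
  [/\ forall i, (i < size ws)%N -> sorted <%R (ms i) /\ size (ms i) = size (nth [::] ws i),
     mask (head [::] ws) (ms 0) = l &
     forall i, (i.+1 < size ws)%N ->
       mask (map negb (nth [::] ws i)) (ms i) = mask (nth [::] ws i.+1) (ms i.+1)].
Proof.
elim: ws l => [|w ws IH] l sl szl matched.
  by exists (fun=> [::]); split=> //; rewrite /=; case: l szl {sl} => // [].
have [lo lol] : exists lo, path <%R lo l.
  by case: l sl {szl} => [|x l xl]; [exists 0 | exists (x - 1); rewrite /= ltrBlDr ltrDl ltr01].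
rewrite /= in szl; have [m [lom sm ml]] := merge_slopes lol szl.
have sm' : sorted <%R m := path_sorted lom.
case: ws IH matched => [|w' ws] IH matched.
  exists (fun=> m); split=> //; by case.
have sl' : sorted <%R (mask (map negb w) m).
  by apply: subseq_sorted sm' => //; [exact: lt_trans | exact: mask_subseq].
have [||ms [ms1 ms2 ms3]] := IH _ sl'.
- rewrite size_mask ?size_map // -[nL _]/(nL (nth [::] [:: w, w' & ws] 1)) -matched //.
  by rewrite /nR count_map; apply: eq_count => -[].
- by move=> i il; exact: (matched i.+1).
exists (fun i => if i is i'.+1 then ms i' else m); split=> //.
- by case=> [_|i il]; [split | exact: ms1].
- by case=> [_|i il]; [rewrite /= -ms2 | exact: ms3].
Qed.

Definition height_sum s j := \sum_(q < j) s`_q.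

Lemma height_sumS s j : height_sum s j.+1 = height_sum s j + s`_j.
Proof. by rewrite /height_sum big_ord_recr. Qed.

(** The slopes below the front at step k are smaller than the slope of step k,
    and those above are at least as large. *)
Lemma mask_slopes v m k : sorted <%R m -> size m = size v -> (k < size v)%N ->
  let s := mask v m in let a := lcount v k in
  (forall q, (q < a)%N -> s`_q < m`_k) /\
  (forall q, (a <= q < size s)%N -> m`_k <= s`_q ?= iff (nth false v k && (q == a))).
Proof.
move=> sm sz kv s a.
have km : (k < size m)%N by rewrite sz.
set s1 := mask (take k v) (take k m).
have size1 : size s1 = a by rewrite size_mask // !size_takel ?sz // ltnW.
have sE : s = s1 ++ mask (drop k v) (drop k m).
  by rewrite -mask_cat ?cat_take_drop // !size_takel ?sz // ltnW.
have ltm i j : (i < j)%N -> (j < size m)%N -> m`_i < m`_j.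
  by move=> ij jl; apply: (sorted_ltn_nth lt_trans) => //; rewrite inE // (ltn_trans ij).
have lt1 x : x \in s1 -> x < m`_k.
  move=> /mem_mask /(nthP 0)[i]; rewrite size_takel => [ik <-|]; last exact: ltnW.
  by rewrite nth_take // ltm.
have lt2 x : x \in mask (drop k.+1 v) (drop k.+1 m) -> m`_k < x.
  move=> /mem_mask /(nthP 0)[i]; rewrite size_drop => il <-.
  by rewrite nth_drop ltm // -?ltn_subRL // ltn_addr.
split=> q.
  by move=> qa; rewrite sE nth_cat size1 qa lt1 // mem_nth // size1.
move=> /andP[aq]; rewrite sE size_cat size1 nth_cat size1 (ltnNge q a) aq /=.
rewrite (drop_nth false kv) (drop_nth 0 km) /=.
case: (nth false v k) => /=; last first.
  rewrite -ltn_subLR // => ql.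
  have lt : m`_k < (mask (drop k.+1 v) (drop k.+1 m))`_(q - a) by rewrite lt2 // mem_nth.
  by split; [exact: ltW | rewrite lt_eqF].
move=> ql; case: (eqVneq q a) => [->|qa].
  by rewrite subnn /=; split; rewrite ?lexx ?eqxx.
have aq' : (a < q)%N by rewrite ltn_neqAle eq_sym qa.
case e: (q - a)%N => [|d]; first by lia.
have lt : m`_k < (mask (drop k.+1 v) (drop k.+1 m))`_d by rewrite lt2 // mem_nth //; move: ql; rewrite /= addnS ltnS -leq_subLR e.
by rewrite /=; split; [exact: ltW | rewrite lt_eqF].
Qed.

(** On one line, the linear function through the front with the slope of step
    k stays below the convex function with increments s, and touches it only at
    the corners of the k-th triangle. *)
Lemma column_convex v m k j : sorted <%R m -> size m = size v -> (k < size v)%N ->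
  let s := mask v m in let a := lcount v k in (j <= size s)%N ->
  height_sum s a + m`_k * (j%:R - a%:R) <= height_sum s j
    ?= iff ((j == a) || (nth false v k && (j == a.+1))).
Proof.
move=> sm sz kv s a; have [below above] := mask_slopes sm sz kv.
rewrite -/s -/a in below above.
case: (leqP a j) => [aj|ja] js.
  have weak e : (a + e <= size s)%N ->
      height_sum s a + m`_k * e%:R <= height_sum s (a + e).
    elim: e => [|e IHe] es; first by rewrite addn0 mulr0 addr0.
    rewrite addnS height_sumS -natr1 mulrDr mulr1 addrA lerD ?IHe //; first lia.
    by have [|-> //] := above (a + e)%N; lia.
  rewrite -[j](subnKC aj) in js *; move: (j - a)%N js => d {aj} js.
  rewrite natrD addrAC subrr add0r -[X in _ == X]addn0 eqn_add2l -[a.+1]addn1 eqn_add2l.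
  case: d js => [|d] js; first by rewrite mulr0 addr0 addn0; split; rewrite ?lexx ?eqxx.
  have [le eq] := above (a + d)%N ltac:(lia).
  rewrite addnS height_sumS -natr1 mulrDr mulr1 addrA.
  have wd : height_sum s a + m`_k * d%:R <= height_sum s (a + d) by apply: weak; lia.
  have ad0 : (a + d == a)%N = (d == 0%N) by rewrite -[X in _ == X]addn0 eqn_add2l.
  rewrite ad0 in eq.
  case: (boolP (nth false v k && (d == 0%N))) => [/andP[vk /eqP d0]|strict].
    move: eq; rewrite vk d0 addn0 /= mulr0 addr0 => /eqP ->; split; rewrite ?lexx ?eqxx //.
  have lt : m`_k < s`_(a + d) by rewrite lt_neqAle eq strict le.
  have lt' : height_sum s a + m`_k * d%:R + m`_k < height_sum s (a + d) + s`_(a + d).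
    exact: ler_ltD.
  split; first exact: ltW.
  by rewrite lt_eqF // eqSS (negbTE strict).
have weak e : (e <= a)%N -> height_sum s a - m`_k * e%:R <= height_sum s (a - e).
  elim: e => [|e IHe] es; first by rewrite mulr0 subr0 subn0.
  have := IHe (ltnW es); rewrite (_ : (a - e = (a - e.+1).+1)%N); last lia.
  rewrite height_sumS => le; have lt := below (a - e.+1)%N ltac:(lia).
  rewrite -natr1 mulrDr mulr1 opprD addrA lerBlDr; apply: le_trans le _.
  by rewrite lerD2l ltW.
have e0 : (j == a) || nth false v k && (j == a.+1) = false.
  by rewrite !(@ltn_eqF j) ?andbF // ltnW.
have lt : height_sum s a + m`_k * (j%:R - a%:R) < height_sum s j.
  have := weak (a - j.+1)%N (leq_subr _ _); rewrite (_ : (a - (a - j.+1) = j.+1)%N); last lia.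
  rewrite height_sumS natrB // -natr1 => le; have lt := below j ja.
  have : height_sum s a - m`_k * (a%:R - (j%:R + 1)) < height_sum s j + m`_k.
    by apply: le_lt_trans le _; rewrite ltrD2l.
  by rewrite -ltrBlDr; congr (_ < _); ring.
by rewrite e0; split; [exact: ltW | rewrite lt_eqF].
Qed.

End Slopes.

(** * Strip triangulations are regular *)

Section StripGeometry.
Local Open Scope classical_set_scope.
Local Open Scope ring_scope.
Variables (R : realType) (ws : seq (seq bool)) (ht : nat -> nat).
Let N := size ws.
Let w i := nth [::] ws i.
Hypothesis left_heights : forall i, (i < N)%N -> nL (w i) = ht i.
Hypothesis right_heights : forall i, (i < N)%N -> nR (w i) = ht i.+1.
Hypothesis words_nonempty : forall i, (i < N)%N -> (0 < size (w i))%N.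
Hypothesis concave : forall i, (i.+2 <= N)%N -> (ht i + ht i.+2 <= (ht i.+1).*2)%N.
Hypothesis N_gt0 : (0 < N)%N.

Definition strip_points : seq (nat * nat) :=
  [seq (i, j) | i <- iota 0 N.+1, j <- iota 0 (ht i).+1].
Definition strip_lattice : {fset 'rV[int]_2} := [fset x in map pt strip_points]%fset.

Lemma mem_strip_points i j : ((i, j) \in strip_points) = (i <= N)%N && (j <= ht i)%N.
Proof.
apply/allpairsPdep/andP => [[i' [j' []]]|[iN jh]].
  by rewrite !mem_iota !add0n !ltnS => /= ? ? [-> ->].
by exists i, j; rewrite !mem_iota !add0n !ltnS.
Qed.

Lemma strip_latticeP p : reflect
  (exists i j, [/\ p = pt (i, j), (i <= N)%N & (j <= ht i)%N]) (p \in strip_lattice).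
Proof.
rewrite in_fset; apply: (iffP mapP) => [[[i j] + ->]|[i [j [-> iN jh]]]].
  by rewrite mem_strip_points => /andP[? ?]; exists i, j.
by exists (i, j); rewrite // mem_strip_points iN.
Qed.

Definition graph_of (sx sy c : R) := aff (\col_(j < 2) (if j == 0 then sx else sy)) c.

Lemma graph_ofE sx sy c (x : 'rV[R]_2) : graph_of sx sy c x = x 0 0 * sx + x 0 1 * sy + c.
Proof.
rewrite /graph_of /aff mxE !big_ord_recl big_ord0 addr0 !mxE /=.
by congr (_ + x 0 _ * _ + _); apply/val_inj.
Qed.

Lemma real_pt0 i j : real_pt R (pt (i, j)) 0 0 = i%:R.
Proof. by rewrite !mxE. Qed.

Lemma real_pt1 i j : real_pt R (pt (i, j)) 0 1 = j%:R.
Proof. by rewrite !mxE. Qed.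

Lemma graph_of_pt sx sy c i j :
  graph_of sx sy c (real_pt R (pt (i, j))) = i%:R * sx + j%:R * sy + c.
Proof. by rewrite graph_ofE real_pt0 real_pt1. Qed.

Lemma mem_tri c p : (pt p \in tri ws c) = (p \in corners ws c).
Proof. by rewrite in_fset mem_map //; exact: pt_inj. Qed.

Lemma corner_bounds c p : in_strip ws c -> p \in corners ws c -> p \in strip_points.
Proof.
case: c p => i k [i' j] /andP[/= il kl].
have la : (lcount (w i) k <= ht i)%N by rewrite -left_heights //; exact: leq_count_subseq (take_subseq _ _).
have ra : (rcount (w i) k <= ht i.+1)%N by rewrite -right_heights //; exact: leq_count_subseq (take_subseq _ _).
rewrite mem_strip_points /corners /= !inE -/(w i).
case wk: (nth false (w i) k) => /or3P[]/eqP[-> ->]; rewrite ?(ltnW il) ?il ?la ?ra //=.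
  by rewrite -left_heights // lcount_lt.
by rewrite -right_heights // rcount_lt ?wk.
Qed.

Lemma strip_vertices t : t \in strip ws -> (t `<=` strip_lattice)%fset.
Proof.
move=> /mem_strip[c cs ->]; apply/fsubsetP => x; rewrite in_fset => /mapP[p pc ->].
by rewrite in_fset; apply: map_f; exact: corner_bounds pc.
Qed.

Lemma det22 (A : 'M[int]_2) : \det A = A 0 0 * A 1 1 - A 0 1 * A 1 0.
Proof.
rewrite (expand_det_row _ 0) !big_ord_recl big_ord0 addr0 /cofactor !det_mx11 !mxE /=.
have e1 : lift 0 0 = 1 :> 'I_2 by exact: val_inj.
have e3 : lift 1 0 = 0 :> 'I_2 by exact: val_inj.
by rewrite !e1 e3 /bump /= addn0 expr0 expr1 mul1r mulN1r mulrN.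
Qed.

Lemma strip_unimodular t : t \in strip ws -> unimodular_triangle t.
Proof.
move=> /mem_strip[c _ ->].
set l := lcount (nth [::] ws c.1) c.2; set r := rcount (nth [::] ws c.1) c.2.
set d := if nth false (nth [::] ws c.1) c.2 then (c.1, l.+1) else (c.1.+1, r.+1).
exists (pt (c.1, l)), (pt (c.1.+1, r)), (pt d); split.
  by apply/fsetP => x; rewrite in_fset !inE -orbA.
rewrite /triangle_area det22; congr (_ / _).
set u := pt _ - pt _; set v := pt d - _.
have [M0 M1] := col_mx_rows u v; rewrite !M0 !M1 (_ : _ - _ = 1) ?normr1 //.
by rewrite /u /v !mxE /= /d; case: (nth false _ _) => /=; lia.
Qed.

(** A quadratic term d (d - 1) vanishes at the two lines of a column and is at
    least 2 at all others; multiplied by a large constant it dominates the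
    error terms. *)
Lemma far_gap (M d B1 B2 : R) : 0 < M -> 2 <= d \/ d <= -1 ->
  `|B1| <= 3 * M -> `|B2| <= 3 * M -> 0 < 6 * M * (d * (d - 1)) + B1 - d * B2.
Proof.
move=> M0 dd; rewrite !ler_norml => /andP[b1 b1'] /andP[b2 b2'].
case: dd => dd.
  have d0 : 0 <= d by lra.
  have h1 : d * B2 <= d * (3 * M) by apply: ler_wpM2l.
  have h2 : 0 <= M * (d * (d - 2)) by rewrite !mulr_ge0 //; lra.
  have h3 : 0 < M * (d - 1) by rewrite mulr_gt0 //; lra.
  lra.
have d0 : 0 <= - d by lra.
have h1 : (- d) * (- (3 * M)) <= - d * B2 by apply: ler_wpM2l.
have h2 : 0 <= M * (- d * (- d - 1)) by rewrite !mulr_ge0 //; lra.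
have h3 : M * 1 <= M * - d by apply: ler_wpM2l; lra.
lra.
Qed.

Lemma bounded_family (f : nat -> nat -> R) n m : exists2 M : R, 0 < M &
  forall i j, (i < n)%N -> (j < m)%N -> `|f i j| <= M.
Proof.
(* the summand 1 makes the bound positive *)
exists (1 + \sum_(i < n) \sum_(j < m) `|f i j|).
  by rewrite ltr_pwDl // sumr_ge0 // => i _; rewrite sumr_ge0.
move=> i j il jl; rewrite (bigD1 (Ordinal il)) //= (bigD1 (Ordinal jl)) //=.
have s1 : 0 <= \sum_(k < m | k != Ordinal jl) `|f i k| by rewrite sumr_ge0.
have s2 : 0 <= \sum_(k < n | k != Ordinal il) \sum_(q < m) `|f k q|.
  by rewrite sumr_ge0 // => k _; rewrite sumr_ge0.
lra.
Qed.

(** The right line of the last column is treated as the left line of an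
    additional column of triangles. *)
Lemma line_slopes : exists ms s : nat -> seq R, forall i, (i < N)%N ->
  [/\ sorted <%R (ms i), size (ms i) = size (w i), mask (w i) (ms i) = s i &
      mask (map negb (w i)) (ms i) = s i.+1].
Proof.
pose ws' := rcons ws (nseq (ht N) true).
have nth' i : (i < N)%N -> nth [::] ws' i = w i by move=> iN; rewrite nth_rcons iN.
have nthN : nth [::] ws' N = nseq (ht N) true by rewrite nth_rcons ltnn eqxx.
have hd : head [::] ws' = w 0 by rewrite -nth0 nth'.
have sz0 : size ([::] : seq R) = nL (nseq (nL (w 0)) false) by rewrite /nL count_nseq.
(* any increasing sequence of the right length gives the slopes on line 0 *)
have [m [lom sm _]] := @merge_slopes R (nseq (nL (w 0)) false) [::] 0 isT sz0.
have [||ms [ms1 ms2 ms3]] := @slopes_exist R ws' m (path_sorted lom).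
- by rewrite sm size_nseq hd.
- move=> i; rewrite size_rcons ltnS => iN; rewrite nth' //.
  move: (iN); rewrite leq_eqVlt => /orP[/eqP e|lt]; last by rewrite nth' // left_heights // right_heights.
  rewrite e nthN /nL count_nseq mul1n right_heights //; congr ht; exact: e.
exists ms, (fun i => mask (nth [::] ws' i) (ms i)) => i iN.
have iN' : (i < size ws')%N by rewrite size_rcons ltnW.
have [so si] := ms1 i iN'; split=> //; first by rewrite si nth'.
  by rewrite nth'.
by rewrite -nth' // ms3 // size_rcons.
Qed.

(** The height is a steep convex function of x plus, on each vertical line, a
    convex function of y. In a column the two functions of y are chosen so that
    their slopes are interleaved as the word prescribes: this makes the plane
    over a triangle lie below the points of its two lines, and steepness takes
    care of all other lines. *)
Lemma strip_certificate : exists h : 'rV[int]_2 -> R, forall t, t \in strip ws ->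
  exists l c, forall p, p \in strip_lattice ->
    aff l c (real_pt R p) <= h p ?= iff (p \in t).
Proof.
have [ms [s slopes]] := line_slopes.
have sizes i : (i <= N)%N -> size (s i) = ht i.
  case: i => [_|i iN]; [have [_ ms0 <- _] := slopes 0 N_gt0 | have [_ msi _ <-] := slopes i iN].
    by rewrite size_mask // -/(nL _) left_heights.
  rewrite size_mask ?size_map // -right_heights // /nR count_map.
  by apply: eq_count => -[].
pose H := (\max_(i < N.+1) ht i)%N.
have htH i : (i <= N)%N -> (ht i <= H)%N.
  by rewrite -ltnS => iN; exact: (leq_bigmax (Ordinal iN)).
have [M1 M1_gt0 bound1] := bounded_family (fun i j => height_sum (s i) j) N.+1 H.+1.
have [M2 M2_gt0 bound2] := bounded_family (fun i k => (ms i)`_k) N (H + H).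
(* M bounds the functions on the lines and the linear functions compared with
   them, so that 6 M x^2 is steep enough for far_gap *)
pose M := M1 + M2 * H%:R.
have M_gt0 : 0 < M by rewrite ltr_pwDl // mulr_ge0 // ltW.
have bphi i j : (i <= N)%N -> (j <= H)%N -> `|height_sum (s i) j| <= M.
  by move=> iN jH; rewrite (le_trans (bound1 i j _ _)) // lerDl mulr_ge0 // ltW.
have wsize i : (i < N)%N -> (size (w i) <= H + H)%N.
  move=> iN; rewrite -(count_predC id (w i)) leq_add //.
    by rewrite -/(nL (w i)) left_heights // htH // ltnW.
  by rewrite -/(nR (w i)) right_heights // htH.
have bsigma i k a j : (i < N)%N -> (k < size (w i))%N -> (a <= H)%N -> (j <= H)%N ->
    `|(ms i)`_k * (j%:R - a%:R)| <= M.
  move=> iN kw aH jH; rewrite normrM.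
  apply: (@le_trans _ _ (M2 * H%:R)); last by rewrite lerDr ltW.
  rewrite ler_pM // ?bound2 //; first exact: leq_trans (wsize i iN).
  have a0 : (0 : R) <= a%:R by []. have j0 : (0 : R) <= j%:R by [].
  have aH' : a%:R <= H%:R :> R by rewrite ler_nat.
  have jH' : j%:R <= H%:R :> R by rewrite ler_nat.
  by rewrite ler_norml; apply/andP; split; lra.
pose hh i j : R := 6 * M * i%:R ^+ 2 + height_sum (s i) j.
exists (fun p : 'rV[int]_2 => hh (absz (p 0 0)) (absz (p 0 1))) => t /mem_strip[[i k] /andP[/= iN kw] ->].
rewrite -/(w i) in kw.
have [sorted_m size_m sl sr] := slopes i iN.
set sg := (ms i)`_k; set a := lcount (w i) k; set b := rcount (w i) k.
(* with this slope in x the affine function agrees with h at both ends of the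
   k-th front, which are corners of the triangle *)
pose sx := hh i.+1 b - hh i a - sg * (b%:R - a%:R).
exists (\col_(j < 2) (if j == 0 then sx else sg)), (hh i a - i%:R * sx - a%:R * sg).
move=> _ /strip_latticeP[i' [j [-> i'N jh]]].
rewrite -/(graph_of _ _ _) graph_of_pt mem_tri !mxE !absz_nat /=.
have aht : (a <= ht i)%N by rewrite -left_heights //; exact: leq_count_subseq (take_subseq _ _).
have bht : (b <= ht i.+1)%N by rewrite -right_heights //; exact: leq_count_subseq (take_subseq _ _).
have shift (x y z : R) C : x <= y ?= iff C -> z + x <= z + y ?= iff C.
  by move=> [le e]; split; rewrite ?lerD2l // (inj_eq (addrI z)).
rewrite /corners /= -/(w i) -/a -/b.
case: (eqVneq i' i) => [ii|ni].
  have jh' : (j <= size (mask (w i) (ms i)))%N by rewrite sl sizes ?(ltnW iN) // -ii.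
  have := column_convex sorted_m size_m kw jh'; rewrite sl -/sg -/a ii => cv.
  have -> : ((i, j) \in [:: (i, a); (i.+1, b); if nth false (w i) k then (i, a.+1) else (i.+1, b.+1)])
     = ((j == a) || (nth false (w i) k && (j == a.+1))).
    have ii1 : (i == i.+1) = false by rewrite ltn_eqF.
    rewrite !inE !xpair_eqE eqxx ii1 /=.
    by case: (nth false (w i) k); rewrite xpair_eqE ?eqxx ?ii1.
  have -> : i%:R * sx + j%:R * sg + (hh i a - i%:R * sx - a%:R * sg) =
     6 * M * i%:R ^+ 2 + (height_sum (s i) a + sg * (j%:R - a%:R)) by rewrite /hh; ring.
  exact: shift.
case: (eqVneq i' i.+1) => [ii|ni'].
  have jh' : (j <= size (mask (map negb (w i)) (ms i)))%N by rewrite sr sizes // -ii.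
  have size_m' : size (ms i) = size (map negb (w i)) by rewrite size_map.
  have kw' : (k < size (map negb (w i)))%N by rewrite size_map.
  have := column_convex sorted_m size_m' kw' jh'.
  have -> : lcount (map negb (w i)) k = b by rewrite /lcount -map_take count_map.
  rewrite sr -/sg ii (nth_map false) // => cv.
  have -> : ((i.+1, j) \in [:: (i, a); (i.+1, b); if nth false (w i) k then (i, a.+1) else (i.+1, b.+1)])
     = ((j == b) || (~~ nth false (w i) k && (j == b.+1))).
    have ii1 : (i.+1 == i) = false by rewrite gtn_eqF.
    rewrite !inE !xpair_eqE eqxx ii1 /=.
    by case: (nth false (w i) k); rewrite xpair_eqE ?eqxx ?ii1.
  have -> : i.+1%:R * sx + j%:R * sg + (hh i a - i%:R * sx - a%:R * sg) =
     6 * M * i.+1%:R ^+ 2 + (height_sum (s i.+1) b + sg * (j%:R - b%:R)).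
    by rewrite /sx /hh -natr1; ring.
  exact: shift.
have -> : ((i', j) \in [:: (i, a); (i.+1, b); if nth false (w i) k then (i, a.+1) else (i.+1, b.+1)]) = false.
  rewrite !inE !xpair_eqE (negbTE ni) (negbTE ni') /=.
  by case: (nth false (w i) k); rewrite xpair_eqE ?(negbTE ni) ?(negbTE ni').
pose d : R := i'%:R - i%:R.
have far : 2 <= d \/ d <= -1.
  case: (ltngtP i' i) ni => // ii _.
    right; have : i'%:R + 1 <= i%:R :> R by rewrite natr1 ler_nat.
    by rewrite /d; lra.
  have ii2 : (i.+2 <= i')%N by rewrite ltn_neqAle eq_sym ni'.
  left; have : i%:R + 2 <= i'%:R :> R by rewrite -natrD ler_nat addn2.
  by rewrite /d; lra.
pose B1 := height_sum (s i') j - height_sum (s i) a - sg * (j%:R - a%:R).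
pose B2 := height_sum (s i.+1) b - height_sum (s i) a - sg * (b%:R - a%:R).
have aH : (a <= H)%N := leq_trans aht (htH i (ltnW iN)).
have bH : (b <= H)%N := leq_trans bht (htH i.+1 iN).
have jH : (j <= H)%N := leq_trans jh (htH i' i'N).
have tri3 (x y z : R) : `|x| <= M -> `|y| <= M -> `|z| <= M -> `|x - y - z| <= 3 * M.
  by rewrite !ler_norml => /andP[? ?] /andP[? ?] /andP[? ?]; apply/andP; split; lra.
have hB1 : `|B1| <= 3 * M.
  by apply: tri3; [exact: bphi | apply: bphi => //; exact: ltnW | exact: bsigma].
have hB2 : `|B2| <= 3 * M.
  by apply: tri3; [exact: bphi | apply: bphi => //; exact: ltnW | exact: bsigma].
have gap := far_gap M_gt0 far hB1 hB2.
have lt : i'%:R * sx + j%:R * sg + (hh i a - i%:R * sx - a%:R * sg) < hh i' j.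
  rewrite -subr_gt0; apply: lt_le_trans gap _; rewrite le_eqVlt; apply/orP; left; apply/eqP.
  by rewrite /d /B1 /B2 /sx /hh -natr1; ring.
by split; [exact: ltW | rewrite lt_eqF].
Qed.

(** The difference quotients of a concave function decrease. *)
Lemma chord_above i k : (i < N)%N -> (k <= N)%N ->
  (ht k)%:R <= (ht i)%:R + (k%:R - i%:R) * ((ht i.+1)%:R - (ht i)%:R) :> R.
Proof.
pose D j : R := (ht j.+1)%:R - (ht j)%:R.
have Dstep j : (j.+2 <= N)%N -> D j.+1 <= D j.
  move=> /concave; rewrite -addnn -(ler_nat R) !natrD /D; lra.
have Dle j d : (j + d < N)%N -> D (j + d)%N <= D j.
  elim: d => [|d IH]; first by rewrite addn0.
  rewrite addnS => jd; apply: le_trans (Dstep _ jd) (IH _); lia.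
move=> iN; case: (leqP i k) => [ik|ki].
  rewrite -[k](subnKC ik); move: (k - i)%N => d {k ik}; rewrite natrD addrAC subrr add0r.
  elim: d => [|d IH] dN; first by rewrite addn0 mul0r addr0.
  have {}IH := IH ltac:(lia).
  have := Dle i d ltac:(lia); rewrite addnS -natr1 -/(D i) mulrDl mul1r {1}/D.
  rewrite -/(D i) in IH; lra.
move=> _; have [d ikd] : exists d, i = (k + d)%N by exists (i - k)%N; lia.
rewrite ikd in iN *; rewrite natrD opprD addrA subrr add0r -/(D _).
suff H e : (e <= d)%N -> (ht k)%:R <= (ht (k + e))%:R - e%:R * D (k + d)%N by rewrite mulNr; exact: H.
elim: e => [|e IH] ed; first by rewrite addn0 mul0r subr0.
have {}IH := IH (ltnW ed).
have := Dle (k + e)%N (d - e)%N; rewrite (_ : (k + e + (d - e) = k + d)%N); last lia.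
move=> /(_ iN); rewrite addnS -natr1 mulrDl mul1r {2}/D; lra.
Qed.

Lemma conv_hull3 (E : lmodType R) (A : set E) (p q r : E) (a b c : R) :
  A p -> A q -> A r -> 0 <= a -> 0 <= b -> 0 <= c -> a + b + c = 1 ->
  conv_hull A (a *: p + b *: q + c *: r).
Proof.
move=> Ap Aq Ar a0 b0 c0 abc.
exists 3%N, (fun i => tnth [tuple a; b; c] i), (fun i => tnth [tuple p; q; r] i).
split.
- by case=> -[|[|[|]]].
- by rewrite !big_ord_recl big_ord0 /= addr0 addrA.
- by case=> -[|[|[|]]].
- by rewrite !big_ord_recl big_ord0 /= addr0 addrA.
Qed.

(** Over a fixed abscissa the fronts rise from 0 to the height of the strip,
    so that the point lies between two consecutive fronts, which bound a
    triangle. *)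
Lemma column_cover i (x : 'rV[R]_2) : (i < N)%N ->
  i%:R <= x 0 0 <= i.+1%:R ->
  0 <= x 0 1 <= (ht i)%:R + (x 0 0 - i%:R) * ((ht i.+1)%:R - (ht i)%:R) ->
  exists2 t, t \in strip ws & lattice_hull t x.
Proof.
move=> iN; rewrite -natr1 => /andP[x0 x1] /andP[y0 y1].
(* y k is the ordinate of the k-th front at the abscissa of x *)
pose u := x 0 0 - i%:R.
pose y k : R := (1 - u) * (lcount (w i) k)%:R + u * (rcount (w i) k)%:R.
have y_0 : y 0 = 0 by rewrite /y /lcount /rcount take0 /= !mulr0 addr0.
have y_n : x 0 1 <= y (size (w i)).
  rewrite /y /lcount /rcount take_size -/(nL _) -/(nR _) left_heights // right_heights //.
  by apply: le_trans y1 _; rewrite -/u; lra.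
have [k kw /andP[yk yk1]] : exists2 k, (k < size (w i))%N & y k <= x 0 1 <= y k.+1.
  have := words_nonempty iN; move: y_n; move: (size (w i)) => n.
  elim: n => [//|n IH] yn _; case: (lerP (x 0 1) (y n)) => h.
    case: n IH h yn => [|n] IH h yn; last by have [k kn kk] := IH h isT; exists k; rewrite // ltnW.
    by exists 0%N; rewrite // yn andbT y_0.
  by exists n; rewrite // yn andbT ltW.
set a := lcount (w i) k; set b := rcount (w i) k.
have ykE : y k = (1 - u) * a%:R + u * b%:R by [].
exists (tri ws (i, k)); first by apply/mem_strip; exists (i, k); rewrite // /in_strip /= iN.
have inA p : p \in corners ws (i, k) ->
    [set real_pt R p | p in [set` tri ws (i, k)]] (real_pt R (pt p)).
  by move=> pc; exists (pt p) => //=; rewrite mem_tri.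
pose l := x 0 1 - y k.
have l0 : 0 <= l by rewrite subr_ge0.
have u0 : 0 <= u by rewrite subr_ge0.
have u1 : u <= 1 by rewrite lerBlDr addrC.
have ext (v v' : 'rV[R]_2) : v 0 0 = v' 0 0 -> v 0 1 = v' 0 1 -> v = v'.
  move=> e0 e1; apply/rowP => -[[|[|]] //= lt].
    by rewrite (_ : Ordinal lt = 0) //; exact: val_inj.
  by rewrite (_ : Ordinal lt = 1) //; exact: val_inj.
have comb (p q r : 'rV[R]_2) (A B C : R) j :
    (A *: p + B *: q + C *: r) 0 j = A * p 0 j + B * q 0 j + C * r 0 j.
  by rewrite !mxE.
case wk: (nth false (w i) k).
  have l1 : l <= 1 - u.
    by move: yk1; rewrite /y lcountS // rcountS // wk addn0 addn1 -natr1 -/a -/b /l ykE; lra.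
  have -> : x = (1 - u - l) *: real_pt R (pt (i, a)) + u *: real_pt R (pt (i.+1, b))
      + l *: real_pt R (pt (i, a.+1)).
    apply: ext.
      by rewrite comb !real_pt0 -natr1 /u; ring.
    by rewrite comb !real_pt1 -natr1 /l ykE; ring.
  apply: conv_hull3 => //; try lra; apply: inA;
    by rewrite /corners /= -/(w i) -/a -/b wk !inE !eqxx ?orbT.
have l1 : l <= u.
  by move: yk1; rewrite /y lcountS // rcountS // wk addn0 addn1 -natr1 -/a -/b /l ykE; lra.
have -> : x = (1 - u) *: real_pt R (pt (i, a)) + (u - l) *: real_pt R (pt (i.+1, b))
    + l *: real_pt R (pt (i.+1, b.+1)).
  apply: ext.
    by rewrite comb !real_pt0 -natr1 /u; ring.
  by rewrite comb !real_pt1 -natr1 /l ykE; ring.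
apply: conv_hull3 => //; try lra; apply: inA;
  by rewrite /corners /= -/(w i) -/a -/b wk !inE !eqxx ?orbT.
Qed.

Lemma strip_cover (x : 'rV[R]_2) : lattice_hull strip_lattice x ->
  exists2 t, t \in strip ws & lattice_hull t x.
Proof.
move=> xD.
have bound sx sy c : (forall i j, (i <= N)%N -> (j <= ht i)%N -> i%:R * sx + j%:R * sy + c <= 0) ->
    x 0 0 * sx + x 0 1 * sy + c <= 0.
  move=> H; rewrite -graph_ofE; apply: (conv_hull_le0 (aff_barycentric _ _) _ xD).
  by move=> _ [p /strip_latticeP[i [j [-> iN jh]]] <-]; rewrite -/(graph_of _ _ _) graph_of_pt; exact: H.
have X0 : 0 <= x 0 0.
  have : x 0 0 * -1 + x 0 1 * 0 + 0 <= 0; last by lra.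
  by apply: bound => i j _ _; have : (0 : R) <= i%:R by []; lra.
have XN : x 0 0 <= N%:R.
  have : x 0 0 * 1 + x 0 1 * 0 + - N%:R <= 0; last by lra.
  by apply: bound => i j iN _; have : i%:R <= N%:R :> R by [rewrite ler_nat]; lra.
have Y0 : 0 <= x 0 1.
  have : x 0 0 * 0 + x 0 1 * -1 + 0 <= 0; last by lra.
  by apply: bound => i j _ _; have : (0 : R) <= j%:R by []; lra.
have [i iN /andP[i0 i1]] : exists2 i, (i < N)%N & i%:R <= x 0 0 <= i.+1%:R.
  case: (ltP (x 0 0) N%:R) => XN'.
    have /andP[t0 t1] := truncn_itv X0.
    exists (Num.truncn (x 0 0)); last by rewrite t0 ltW.
    by rewrite -(ltr_nat R); exact: le_lt_trans t0 XN'.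
  exists N.-1; first by rewrite prednK.
  rewrite prednK // XN andbT; apply: le_trans XN'; rewrite ler_nat; exact: leq_pred.
apply: (column_cover iN); rewrite ?i0 ?i1 ?Y0 //=.
pose s : R := (ht i.+1)%:R - (ht i)%:R.
have : x 0 0 * - s + x 0 1 * 1 + (i%:R * s - (ht i)%:R) <= 0; last by rewrite -/s; lra.
apply: bound => k j kN jh; have := chord_above iN kN; rewrite -/s.
have : j%:R <= (ht k)%:R :> R by rewrite ler_nat.
lra.
Qed.

Lemma interior_line i : (0 < i < N)%N -> (2 <= ht i)%N ->
  interior (lattice_hull strip_lattice) (real_pt R (pt (i, 1%N))).
Proof.
move=> /andP[i0 iN] h2; apply/nbhs_ballP; exists (1 / 4) => /=; first by lra.
move=> x [_ xB].
have := xB 0 0; have := xB 0 1; rewrite !real_pt0 !real_pt1 /ball /=.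
rewrite !ltr_distlC => /andP[y0 y1] /andP[x0 x1].
have h2' : 2 <= (ht i)%:R :> R by rewrite ler_nat.
have hpos j : 0 <= (ht j)%:R :> R by [].
suff [t tT xt] : exists2 t, t \in strip ws & lattice_hull t x.
  exact: (lattice_hull_mono (strip_vertices tT)).
case: (lerP i%:R (x 0 0)) => ix.
  apply: (column_cover iN); first by rewrite -natr1; apply/andP; split; lra.
  apply/andP; split; first lra.
  have : 0 <= (x 0 0 - i%:R) * (ht i.+1)%:R by rewrite mulr_ge0 // subr_ge0.
  have : (x 0 0 - i%:R) * ((ht i)%:R - 2) <= 1 * ((ht i)%:R - 2) by rewrite ler_wpM2r ?subr_ge0 //; lra.
  lra.
case: i i0 iN h2 h2' x0 x1 ix {xB} => // i _ iN h2 h2' x0 x1 ix; rewrite -natr1 in x0 x1 ix.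
apply: (column_cover (ltnW iN)); first by rewrite -natr1; apply/andP; split; lra.
apply/andP; split; first lra.
have := hpos i.
have : 0 <= (i%:R + 1 - x 0 0) * (ht i)%:R by rewrite mulr_ge0 // subr_ge0 ltW.
have : (i%:R + 1 - x 0 0) * ((ht i.+1)%:R - 2) <= 1 * ((ht i.+1)%:R - 2) by rewrite ler_wpM2r ?subr_ge0 //; lra.
lra.
Qed.

(** Concavity makes the region convex; the two interior points (1,1) and (2,1)
    give genus at least 2. *)
Theorem strip_triangulation : (3 <= N)%N -> (2 <= ht 1)%N -> (2 <= ht 2)%N ->
  exists (D : set 'rV[R]_2) (g : nat),
  [/\ lattice_polygon D, polygon_genus D g & (2 <= g)%N] /\
  (unimodular_triangulation D (strip ws) /\ regular_triangulation D (strip ws)).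
Proof.
move=> N3 h1 h2.
have [h cert] := strip_certificate.
pose D : set 'rV[R]_2 := lattice_hull strip_lattice.
have int1 : interior D (real_pt R (pt (1, 1)%N)) by apply: interior_line => //; exact: ltnW.
have int2 : interior D (real_pt R (pt (2, 1)%N)) by apply: interior_line.
pose F := [fset p in strip_lattice | `[<interior D (real_pt R p)>]]%fset.
have lp := lattice_points strip_unimodular strip_vertices strip_cover.
have memF p : (p \in F) = (p \in strip_lattice) && `[<interior D (real_pt R p)>].
  by rewrite in_fset.
have FE : [set p | interior D (real_pt R p)] = [set` F].
  apply/seteqP; split=> p /=; rewrite memF; last by move=> /andP[_ /asboolP].
  move=> pD; apply/andP; split; last exact/asboolP.
  exact: (iffLR (lp p) (interior_subset pD)).
exists D, #|` F|; split; last first.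
  split; first exact: (certified_unimodular_triangulation strip_unimodular strip_vertices strip_cover cert).
  exact: (certified_regular strip_unimodular strip_vertices strip_cover cert).
split.
- by split; [exists strip_lattice | exists (real_pt R (pt (1, 1)%N))].
- by rewrite /polygon_genus FE; exact/card_eq_fsetP.
- have neq : pt (1, 1)%N != pt (2, 1)%N by apply/eqP => /pt_inj.
  have c2 : #|` [fset pt (1, 1)%N; pt (2, 1)%N]%fset| = 2%N by rewrite cardfs2 neq.
  apply: (leq_trans (eq_leq (esym c2))); apply: fsubset_leq_card; apply/fsubsetP => p; rewrite in_fset2 => pp.
  have : [set q | interior D (real_pt R q)] p by case/orP: pp => /eqP->.
  by rewrite FE.
Qed.

End StripGeometry.

(** * Cutting a strip into blocks *)

Section Blocks.
Local Open Scope nat_scope.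

Notation word := (seq bool).
Notation label := (nat * nat * bool)%type.

(** A block consists of consecutive vertical lines between two bridges (or an
    end of the strip and a bridge). It is enough to record the height of its
    first line and the words of the columns between its lines. The flags
    entry_top and exit_top tell whether the bridges are at the top or at the
    bottom of the first and last line. *)
Record block := Block {
  first_height : nat; inner_words : seq word;
  entry_top : bool; exit_top : bool; is_first : bool; is_last : bool }.

Implicit Types (b : block) (bs : seq block).

Definition num_lines b := (size (inner_words b)).+1.
Definition last_height b := last (first_height b) (map nR (inner_words b)).

(** The triangles standing on one side of a line, from bottom to top. *)
Definition side_path i h s : seq label := [seq (i, a, s) | a <- iota 0 h].
Definition shift_label i (x : label) : label := (i + x.1.1, x.1.2, x.2).
Definition shift_edge i (e : label * label) := (shift_label i e.1, shift_label i e.2).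

Definition blockV b := side_path 0 (first_height b) false ++ wlabs 0 (inner_words b)
  ++ side_path (size (inner_words b)) (last_height b) true.
Definition blockE b := consec (side_path 0 (first_height b) false)
  ++ rungs 0 (first_height b) ++ wedges 0 (inner_words b)
  ++ consec (side_path (size (inner_words b)) (last_height b) true).
Definition entry b : label := (0, if entry_top b then (first_height b).-1 else 0, false).
Definition exit b : label :=
  (size (inner_words b), if exit_top b then (last_height b).-1 else 0, true).
(** At an end of the strip there is only one bridge, and its end serves as
    both marked vertices. *)
Definition raw b : piece label := Piece (blockV b) (blockE b)
  (if is_first b then exit b else entry b) (if is_last b then entry b else exit b).

(** All triangles of one line come before those of the other line, so that
    just one side, hence one dual edge, joins the two groups. *)
Definition bridge_word b b' : word :=
  if exit_top b then nseq (last_height b) true ++ nseq (first_height b') false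
  else nseq (first_height b') false ++ nseq (last_height b) true.

Fixpoint words_after b bs : seq word := inner_words b ++
  (if bs is b' :: bs' then bridge_word b b' :: words_after b' bs'
   else [:: nseq (last_height b) true]).
Definition chain_words b bs : seq word := nseq (first_height b) false :: words_after b bs.

(** The bridge word that leaves at the top of a line arrives at the bottom of
    the next, and conversely. *)
Definition linked b b' := [&& ~~ is_last b, ~~ is_first b', entry_top b' == ~~ exit_top b,
  0 < last_height b & 0 < first_height b'].

Lemma wlabs_cat i ws ws' : wlabs i (ws ++ ws') = wlabs i ws ++ wlabs (i + size ws) ws'.
Proof.
elim: ws i => [|w ws IH] i /=; first by rewrite addn0.
by rewrite IH catA addSnnS.
Qed.

Lemma wedges_cat i ws ws' : wedges i (ws ++ ws') = wedges i ws ++ wedges (i + size ws) ws'.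
Proof.
elim: ws i => [|w ws IH] i /=; first by rewrite addn0.
by rewrite IH !catA addSnnS.
Qed.

Lemma map_consec (T T' : Type) (f : T -> T') s :
  consec (map f s) = [seq (f e.1, f e.2) | e <- consec s].
Proof.
case: s => // x s; rewrite /consec /=; elim: s x => // y s IH x /=.
by rewrite IH.
Qed.

Lemma labs_shift i i0 w : labs (i + i0) w = map (shift_label i) (labs i0 w).
Proof.
rewrite -map_comp; apply: eq_map => k; rewrite /= /lab /shift.
by case: (nth false w k); rewrite /shift_label /= ?addnS.
Qed.

Lemma rungs_shift i i0 h : rungs (i + i0) h = map (shift_edge i) (rungs i0 h).
Proof. by rewrite -map_comp. Qed.

Lemma wlabs_shift i i0 ws : wlabs (i + i0) ws = map (shift_label i) (wlabs i0 ws).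
Proof.
elim: ws i0 => // w ws IH i0.
by rewrite /= map_cat -IH labs_shift addnS.
Qed.

Lemma wedges_shift i i0 ws : wedges (i + i0) ws = map (shift_edge i) (wedges i0 ws).
Proof.
elim: ws i0 => // w ws IH i0.
by rewrite /= !map_cat -IH labs_shift map_consec -addnS rungs_shift.
Qed.

Lemma side_path_shift i i0 h s : side_path (i + i0) h s = map (shift_label i) (side_path i0 h s).
Proof. by rewrite -map_comp. Qed.

Lemma labs_nseq_true i n w : labs i (nseq n true ++ w) =
  side_path i n true ++ [seq lab i (nseq n true ++ w) (n + k) | k <- iota 0 (size w)].
Proof.
rewrite /labs size_cat size_nseq iotaD map_cat add0n; congr (_ ++ _).
  rewrite /side_path; apply/eq_in_map => k; rewrite mem_iota add0n /= => kn.
  rewrite /lab nth_cat size_nseq kn nth_nseq kn /lcount take_cat size_nseq kn.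
  by rewrite take_nseq ?(ltnW kn) // count_nseq mul1n.
by rewrite -[n in iota n _]addn0 iotaDl -map_comp.
Qed.

Lemma labs_nseq_false i n w : labs i (nseq n false ++ w) =
  side_path i.+1 n false ++ [seq lab i (nseq n false ++ w) (n + k) | k <- iota 0 (size w)].
Proof.
rewrite /labs size_cat size_nseq iotaD map_cat add0n; congr (_ ++ _).
  rewrite /side_path; apply/eq_in_map => k; rewrite mem_iota add0n /= => kn.
  rewrite /lab nth_cat size_nseq kn nth_nseq kn /rcount take_cat size_nseq kn.
  by rewrite take_nseq ?(ltnW kn) // count_nseq mul1n.
by rewrite -[n in iota n _]addn0 iotaDl -map_comp.
Qed.

Lemma labs_true_false i n m : labs i (nseq n true ++ nseq m false) =
  side_path i n true ++ side_path i.+1 m false.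
Proof.
rewrite labs_nseq_true; congr (_ ++ _); rewrite size_nseq.
rewrite /side_path; apply/eq_in_map => k; rewrite mem_iota add0n /= => km.
rewrite /lab nth_cat size_nseq ltnNge leq_addr /= addKn nth_nseq km.
rewrite /rcount take_cat size_nseq ltnNge leq_addr /= addKn take_nseq ?(ltnW km) //.
by rewrite count_cat !count_nseq /= mul0n mul1n.
Qed.

Lemma labs_false_true i n m : labs i (nseq n false ++ nseq m true) =
  side_path i.+1 n false ++ side_path i m true.
Proof.
rewrite labs_nseq_false; congr (_ ++ _); rewrite size_nseq.
rewrite /side_path; apply/eq_in_map => k; rewrite mem_iota add0n /= => km.
rewrite /lab nth_cat size_nseq ltnNge leq_addr /= addKn nth_nseq km.
rewrite /lcount take_cat size_nseq ltnNge leq_addr /= addKn take_nseq ?(ltnW km) //.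
by rewrite count_cat !count_nseq /= mul0n mul1n.
Qed.

Lemma labs_true i n : labs i (nseq n true) = side_path i n true.
Proof. by rewrite -[nseq n true]cats0 labs_nseq_true /= cats0. Qed.

Lemma labs_false i n : labs i (nseq n false) = side_path i.+1 n false.
Proof. by rewrite -[nseq n false]cats0 labs_nseq_false /= cats0. Qed.

Lemma consec_cat (T : Type) (x0 : T) s t : 0 < size s -> 0 < size t ->
  consec (s ++ t) = consec s ++ (last x0 s, head x0 t) :: consec t.
Proof.
move=> + t0; case: t t0 => // y t _; elim: s => // x [|x' s] IH _ //.
by rewrite /= -IH.
Qed.

(** Lists of edges are compared by multiplicities, as a bridge may be listed
    with its ends exchanged. *)
Definition same_edges (L : eqType) (E F : seq (L * L)) := nedges E =2 nedges F.

Lemma nedges_cons (L : eqType) (e : L * L) E x y :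
  nedges (e :: E) x y = joins e x y + nedges E x y.
Proof. by []. Qed.

Lemma joins_swap (L : eqType) (a b x y : L) : joins (a, b) x y = joins (b, a) x y.
Proof. by rewrite /joins !xpair_eqE orbC [(a == y) && _]andbC [(a == x) && _]andbC. Qed.

Lemma size_side_path i h s : size (side_path i h s) = h.
Proof. by rewrite size_map size_iota. Qed.

Lemma last_side_path x0 i h s : 0 < h -> last x0 (side_path i h s) = (i, h.-1, s).
Proof.
case: h => // h _; rewrite -nth_last size_side_path (nth_map 0) ?size_iota //.
by rewrite nth_iota.
Qed.

Lemma head_side_path x0 i h s : 0 < h -> head x0 (side_path i h s) = (i, 0, s).
Proof. by case: h. Qed.

Definition offset i bs k := i + sumn (map num_lines (take k bs)).
Definition place i bs (v : nat * label) : label := shift_label (offset i bs v.1) v.2.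

(** The lines of the k-th block keep their internal labels up to a shift by
    the number of lines before it. A bridge column splits into the right side
    of its left line, which belongs to one block, the left side of its right
    line, which belongs to the next, and the bridge. *)
Lemma chain_layout bs b k i (F : nat * label -> label) : path linked b bs ->
  (forall j x, F (k + j, x) = shift_label (offset i (b :: bs) j) x) ->
  perm_eq (side_path i (first_height b) false ++ wlabs i (words_after b bs))
          (map F (chainV k (map raw (b :: bs)))) /\
  same_edges (consec (side_path i (first_height b) false) ++ rungs i (first_height b)
                ++ wedges i (words_after b bs))
             [seq (F e.1, F e.2) | e <- chainE k (map raw (b :: bs))].
Proof.
have FV j (f : label -> nat * label) (V : seq label) : (forall x, F (f x) = shift_label j x) ->
    map F (map f V) = map (shift_label j) V.
  by move=> Ff; rewrite -map_comp; apply: eq_map.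
have FEd j (f : label -> nat * label) (E : seq (label * label)) :
    (forall x, F (f x) = shift_label j x) ->
    [seq (F e.1, F e.2) | e <- [seq (f e.1, f e.2) | e <- E]] = map (shift_edge j) E.
  by move=> Ff; rewrite -map_comp; apply: eq_map => e /=; rewrite !Ff.
have vE j b0 : map (shift_label j) (blockV b0) = side_path j (first_height b0) false
    ++ wlabs j (inner_words b0) ++ side_path (j + size (inner_words b0)) (last_height b0) true.
  by rewrite /blockV !map_cat -!side_path_shift -wlabs_shift addn0.
have eE j b0 : map (shift_edge j) (blockE b0) = consec (side_path j (first_height b0) false)
    ++ rungs j (first_height b0) ++ wedges j (inner_words b0)
    ++ consec (side_path (j + size (inner_words b0)) (last_height b0) true).
  rewrite /blockE !map_cat -!map_consec -!side_path_shift -rungs_shift -wedges_shift.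
  by rewrite addn0.
elim: bs b k i => [|b' bs IH] b k i.
  move=> _ FE; have F0 x : F (k, x) = shift_label i x.
    by rewrite -[k]addn0 FE /offset /= addn0.
  rewrite -[chainV _ _]/(map (pair k) (blockV b) ++ [::]) cats0 (FV i) // vE.
  rewrite -[chainE _ _]/(map (lift_edge k) (blockE b) ++ [::]) cats0 (FEd i) // eE.
  by rewrite /= wlabs_cat wedges_cat /= labs_true !cats0 /nR count_nseq mul0n /= cats0.
rewrite /= => /andP[/and5P[lb fb' /eqP eb hl hf] path_b'] FE.
have F0 x : F (k, x) = shift_label i x.
  by rewrite -[k]addn0 FE /offset /= addn0.
have [|IHV IHE] := IH b' k.+1 (i + num_lines b) path_b'.
  by move=> j x; rewrite addSnnS FE /offset /= addnA.
have F1 x : F (k.+1, x) = shift_label (i + num_lines b) x.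
  by rewrite -addn1 FE /offset /= ?take0 /= addn0.
rewrite -[chainV _ _]/(map (pair k) (blockV b) ++ chainV k.+1 (map raw (b' :: bs))).
rewrite -[chainE _ _]/(map (lift_edge k) (blockE b) ++ ((k, pout (raw b)), (k.+1, pin (raw b')))
  :: chainE k.+1 (map raw (b' :: bs))).
have bridgeV : perm_eq (labs (i + size (inner_words b)) (bridge_word b b'))
    (side_path (i + size (inner_words b)) (last_height b) true
     ++ side_path (i + num_lines b) (first_height b') false).
  rewrite /bridge_word /num_lines addnS; case: ifP => _; first by rewrite labs_true_false.
  by rewrite labs_false_true perm_catC.
have bridgeE : same_edges (consec (labs (i + size (inner_words b)) (bridge_word b b')))
    (consec (side_path (i + size (inner_words b)) (last_height b) true)
     ++ (shift_label i (exit b), shift_label (i + num_lines b) (entry b'))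
     :: consec (side_path (i + num_lines b) (first_height b') false)).
  rewrite /bridge_word /entry /exit eb /num_lines addnS; case: (exit_top b) => /= x y.
    rewrite labs_true_false (consec_cat (0, 0, false)) ?size_side_path //.
    by rewrite last_side_path // head_side_path // /shift_label /= addn0.
  rewrite labs_false_true (consec_cat (0, 0, false)) ?size_side_path //.
  rewrite last_side_path // head_side_path // /shift_label /= addn0 !nedges_cat.
  rewrite !nedges_cons joins_swap addnCA [in RHS]addnCA.
  by congr (_ + _); exact: addnC.
split.
  rewrite map_cat (FV i) // vE wlabs_cat /= -addnS -!catA.
  rewrite perm_cat2l perm_cat2l.
  apply: (perm_trans (perm_cat bridgeV (perm_refl _))).
  by rewrite -catA perm_cat2l.
move=> x y; rewrite map_cat (FEd i) // eE wedges_cat /= -addnS.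
have nRb : nR (bridge_word b b') = first_height b'.
  by rewrite /bridge_word /nR; case: ifP => _; rewrite count_cat !count_nseq /= mul0n mul1n ?addn0.
have := IHE x y; have := bridgeE x y; rewrite nRb !(nedges_cat, nedges_cons) /=.
rewrite (negbTE lb) (negbTE fb') F0 F1 /num_lines addnS.
by move=> -> <-; rewrite !addnA.
Qed.

Lemma mem_wlabs_column i ws x : x \in wlabs i ws -> i <= column x.
Proof.
elim: ws i => // w ws IH i; rewrite /= mem_cat => /orP[/mapP[k _ ->]|/IH].
  by rewrite column_lab.
exact: ltnW.
Qed.

Lemma wlabs_uniq i ws : uniq (wlabs i ws).
Proof.
elim: ws i => // w ws IH i; rewrite /= cat_uniq labs_uniq IH andbT /=.
apply/hasPn => x /mem_wlabs_column xi; apply/mapP => -[k _ e].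
by move: xi; rewrite e column_lab ltnn.
Qed.

Theorem chain_words_iso b bs : path linked b bs -> all well_formed (map raw (b :: bs)) ->
  graph_iso (lgraph (wlabs 0 (chain_words b bs)) (wedges 0 (chain_words b bs)))
            (chain_graph (map raw (b :: bs))).
Proof.
move=> path_b wf; apply: graph_iso_sym.
have [V E] := chain_layout (k := 0) (i := 1) (F := place 1 (b :: bs)) path_b (fun j x => erefl).
have V' : perm_eq (map (place 1 (b :: bs)) (chainV 0 (map raw (b :: bs))))
    (wlabs 0 (chain_words b bs)).
  by rewrite perm_sym /= labs_false.
have E' : same_edges (wedges 0 (chain_words b bs))
    [seq (place 1 (b :: bs) e.1, place 1 (b :: bs) e.2) | e <- chainE 0 (map raw (b :: bs))].
  by move=> x y; rewrite -E /= labs_false /nR count_nseq mul1n.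
have place_inj : {in chainV 0 (map raw (b :: bs)) &, injective (place 1 (b :: bs))}.
  by apply: map_uniq_inj; rewrite (perm_uniq V') wlabs_uniq.
apply: (lgraph_iso place_inj); first by move=> x; rewrite (perm_mem V').
by move=> x y xV yV; rewrite E' (nedges_map place_inj) // chain_edges_in.
Qed.

End Blocks.

(** * Relabelling, and examination of blocks by computation *)

Section Relabelling.
Local Open Scope nat_scope.
Variables (L L' : choiceType) (f : L -> L').
Implicit Types (p : piece L).

Definition relabel p : piece L' :=
  Piece (map f (pV p)) [seq (f e.1, f e.2) | e <- pE p] (f (pin p)) (f (pout p)).

Let g (v : nat * L) : nat * L' := (v.1, f v.2).

Lemma chainV_relabel k ps : chainV k (map relabel ps) = map g (chainV k ps).
Proof.
elim: ps k => // p ps IH k; rewrite -[chainV k (map _ _)]/(_ ++ chainV k.+1 (map relabel ps)).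
by rewrite -[chainV k (p :: _)]/(_ ++ chainV k.+1 ps) map_cat IH -!map_comp.
Qed.

Lemma chainE_relabel k ps : chainE k (map relabel ps) = [seq (g e.1, g e.2) | e <- chainE k ps].
Proof.
elim: ps k => // p ps IH k.
rewrite -[chainE k (map _ _)]/(_ ++ _ ++ chainE k.+1 (map relabel ps)).
rewrite -[chainE k (p :: _)]/(_ ++ _ ++ chainE k.+1 ps) !map_cat IH -!map_comp.
by congr (_ ++ _ ++ _); case: ps {IH}.
Qed.

Lemma chain_relabel ps : all well_formed ps -> all (fun p => uniq (map f (pV p))) ps ->
  graph_iso (chain_graph ps) (chain_graph (map relabel ps)).
Proof.
move=> wf us; rewrite chainV_relabel chainE_relabel.
have uniq_g k : uniq (map g (chainV k ps)).
  elim: ps us {wf} k => // p ps IH /= /andP[up us] k.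
  rewrite -[chainV k _]/(map (pair k) (pV p) ++ chainV k.+1 ps) map_cat cat_uniq IH // andbT.
  rewrite -map_comp (eq_map (g := pair k \o f)) // map_comp map_inj_uniq ?up; last by move=> x y [].
  apply/hasPn => _ /mapP[v /chainV_ge vk ->]; apply/mapP => -[x _ [e _]].
  by rewrite e ltnn in vk.
have injg := map_uniq_inj (uniq_g 0).
apply: (lgraph_iso injg) => [//|x y xV yV].
by rewrite (nedges_map injg) // chain_edges_in.
Qed.

End Relabelling.

Section Examination.
Local Open Scope nat_scope.
Implicit Types (b : block) (V : seq nat) (E : seq (nat * nat)).

Definition neighbours E v : seq nat :=
  flatten [seq if e.1 == v then [:: e.2] else if e.2 == v then [:: e.1] else [::] | e <- E].

Definition walk_step (nbs : seq (seq nat)) (x : seq nat) : seq nat :=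
  [seq sumn [seq nth 0 x i | i <- nb] | nb <- nbs].

(** The adjacency lists are computed once, as positions, before the iteration. *)
Definition fast_energy (p : piece nat) n : nat :=
  let nbs := [seq [seq index u (pV p) | u <- neighbours (pE p) v] | v <- pV p] in
  sumn [seq m * m | m <- iter n (walk_step nbs) [seq (v == pin p) : nat | v <- pV p]].

Lemma sum_neighbours V E v (g : nat -> nat) : uniq V -> edges_in V E ->
  \sum_(u <- V) nedges E v u * g u = \sum_(u <- neighbours E v) g u.
Proof.
move=> uV; have one c : c \in V -> \sum_(u <- V) (c == u) * g u = g c.
  move=> cV; rewrite (bigD1_seq c) //= eqxx mul1n big1 ?addn0 // => u uc.
  by rewrite eq_sym (negbTE uc).
elim: E => [_|[a b] E IH /andP[/= /andP[aV bV] EV]].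
  by rewrite big_nil big1.
rewrite -[neighbours _ v]/(_ ++ neighbours E v) big_cat -IH //=.
rewrite -[RHS]/(\sum_(u <- if a == v then [:: b] else if b == v then [:: a] else [::]) g u
  + \sum_(u <- V) nedges E v u * g u).
rewrite (eq_bigr (fun u => joins (a, b) v u * g u + nedges E v u * g u)); last first.
  by move=> u _; rewrite -mulnDl.
rewrite big_split /=; congr (_ + _).
case: (eqVneq a v) => [av|av].
  rewrite big_seq1 -(one b bV); apply: eq_bigr => u _; congr (nat_of_bool _ * _).
  rewrite /joins !xpair_eqE av eqxx /=; case: (eqVneq b u) => //= bu.
  by apply/andP => -[/eqP vu /eqP bv]; move: bu; rewrite bv vu eqxx.
case: (eqVneq b v) => [bv|bv].
  rewrite big_seq1 -(one a aV); apply: eq_bigr => u _; congr (nat_of_bool _ * _).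
  by rewrite /joins !xpair_eqE bv eqxx (negbTE av) andbT.
rewrite big_nil big1 // => u _.
by rewrite /joins !xpair_eqE (negbTE av) (negbTE bv) andbF.
Qed.

Lemma fast_energyE p n : well_formed p -> fast_energy p n = walk_energy p n.
Proof.
move=> /and4P[uV EV _ _]; rewrite /fast_energy /walk_energy.
set nbs := [seq _ | v <- pV p].
have -> : iter n (walk_step nbs) [seq (v == pin p) : nat | v <- pV p]
    = [seq walks (pV p) (pE p) (pin p) n v | v <- pV p].
  elim: n => //= n ->; rewrite /walk_step -map_comp; apply: eq_map => v /=.
  rewrite (sum_neighbours _ _ uV EV) -map_comp sumnE big_map big_seq [RHS]big_seq.
  apply: eq_bigr => u uN; rewrite /= (nth_map 0) ?nth_index ?index_mem //;
    move: uN => /flattenP[s /mapP[e /(edges_inP _ _ EV)[e1 e2] ->]];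
    by case: ifP => _; [|case: ifP => _]; rewrite ?in_nil // mem_seq1 => /eqP->.
by rewrite -map_comp sumnE big_map; apply: eq_bigr => v _; rewrite /= mulnn.
Qed.

(** Labels are encoded by natural numbers, on which the tests compute fast;
    the encoding is injective for positions below 3. *)
Definition code (x : nat * nat * bool) : nat := 6 * x.1.1 + 2 * x.1.2 + x.2.
Definition low (x : nat * nat * bool) := x.1.2 < 3.

Lemma code_inj : {in low &, injective code}.
Proof.
move=> [[l a] s] [[l' a'] s']; rewrite !unfold_in /code /low /= => la la' e.
have ll : l = l' by case: s s' e => -[]; lia.
have aa : a = a' by case: s s' e => -[]; lia.
by rewrite ll aa; congr (_, _); case: s s' e => -[] //=; lia.
Qed.

Definition coded b : piece nat := relabel code (raw b).

(** The degree of v in the chain, where bridges are attached to the ends. *)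
Definition marked_degree b E v : nat :=
  edge_degree E v + (~~ is_first b && (v == code (entry b)))
   + (~~ is_last b && (v == code (exit b))).

Definition bivalent b (p : piece nat) := [seq v <- pV p | marked_degree b (pE p) v == 2].
(** The piece of the skeleton that comes from the block b. *)
Definition core b : piece nat := let p := coded b in reduce (p, bivalent b p).

Fixpoint chained h (ws : seq (seq bool)) : bool :=
  if ws is w :: ws' then (nL w == h) && chained (nR w) ws' else true.

Definition low_labels b : bool := [&& all low (blockV b),
  all (fun e => low e.1 && low e.2) (blockE b), low (entry b) & low (exit b)].

(** All facts about a block that the proof relies on; g is its contribution
    to the genus. The bound on the degrees before smoothing means that the
    dual graph has no leaves to prune. *)
Definition block_ok (g : nat) b : bool :=
  let p := coded b in let vs := bivalent b p in let q := reduce (p, vs) in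
  [&& chained (first_height b) (inner_words b), low_labels b, reducible (p, vs),
      all (fun v => 1 < edge_degree (pE p) v) (pV p) &
      [&& all (fun v => marked_degree b (pE q) v == 3) (pV q),
          tightb (pV q) (pE q), is_first b || loopless q &
          (size (pE q)).+1 == g + size (pV q)]].

Lemma coded_wf b : low_labels b -> well_formed (coded b) ->
  well_formed (raw b) /\ uniq (map code (blockV b)).
Proof.
move=> /and4P[/allP lV /allP lE lin lout] /and4P[uV /edges_inP EV iV oV]; split=> //.
have mem x : low x -> code x \in map code (blockV b) -> x \in blockV b.
  move=> lx /mapP[y yV e]; rewrite (code_inj _ _ e) ?unfold_in //; exact: lV.
apply/and4P; split; first exact: map_uniq uV.
- apply/edges_inP => e eE; have /andP[l1 l2] := lE e eE.
  have [m1 m2] := EV _ (map_f (fun e => (code e.1, code e.2)) eE).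
  by split; exact: mem.
- by apply: mem iV; rewrite /=; case: ifP.
- by apply: mem oV; rewrite /=; case: ifP.
Qed.

(** For each value of f a single x is kept, so that f becomes injective. *)
Definition keyed (T : eqType) (f : T -> nat) (r : seq T) : seq (nat * T) :=
  foldr (fun x s => if x.1 \in map fst s then s else x :: s) [::] [seq (f x, x) | x <- r].
Definition pick_by (T : eqType) (f : T -> nat) (r : seq T) : seq T := map snd (keyed f r).

Lemma keyedP (T : eqType) (f : T -> nat) (r : seq T) :
  uniq (map fst (keyed f r)) /\ {in keyed f r, forall x, x.1 = f x.2}.
Proof.
rewrite /keyed; elim: r => // c r [IHu IHf]; rewrite /=.
case: ifP => cr; first by split.
split; first by rewrite /= cr IHu.
by move=> x; rewrite inE => /orP[/eqP->|/IHf].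
Qed.

Lemma pick_by_inj (T : eqType) (f : T -> nat) (r : seq T) : {in pick_by f r &, injective f}.
Proof.
have [us fs] := keyedP f r.
move=> _ _ /mapP[x xs ->] /mapP[y ys ->]; rewrite -!fs // => e; congr snd.
exact: map_uniq_inj us x y xs ys e.
Qed.

Lemma pick_by_uniq (T : eqType) (f : T -> nat) (r : seq T) : uniq (pick_by f r).
Proof.
have [us fs] := keyedP f r; apply: (@map_uniq _ _ f); rewrite -map_comp.
suff -> : map (f \o snd) (keyed f r) = map fst (keyed f r) by [].
by apply/eq_in_map => x /fs.
Qed.

(** A block between the caps: the words between its lines of height 3, and a
    bit telling whether it is entered and left at opposite ends of its lines,
    at the top and at the bottom. *)
Definition spec := (seq (seq bool) * bool)%type.
Definition weight (c : spec) := (size c.1).+1.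
(** The entry is at the top or at the bottom according to the previous block.
    In the former case the block is turned upside down, so that it is always
    the same graph that is attached at its entry. *)
Definition middle (st : bool) (c : spec) : block :=
  Block 3 (if st then map rev c.1 else c.1) st (c.2 (+) st) false false.
(** One line of height 2: its four triangles form a cycle, which smooths to a
    loop at the exit. *)
Definition left_cap := Block 2 [::] false true true false.
(** One line of height 3, or two lines of heights 3 and 2: the two choices
    differ by one in genus and so reach both parities. *)
Definition right_cap (e st : bool) :=
  Block 3 (if e then [:: [:: true; false; true; false; true]] else [::]) st false false true.

Notation U := true (only parsing).
Notation D := false (only parsing).
(** Words of columns between two lines of height 3; enough of them to obtain
    the required numbers of blocks. U is a triangle on the left line. *)
Definition basic_words : seq (seq bool) :=
  [:: [:: U; U; D; U; D; D]; [:: U; U; D; D; U; D]; [:: U; D; U; U; D; D];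
      [:: U; D; U; D; U; D]; [:: U; D; D; U; U; D]; [:: U; D; D; D; U; U];
      [:: D; D; U; U; U; D]; [:: D; D; U; D; U; U]].

Definition candidates : seq spec :=
  [seq (ws, e) | ws <- [:: [::]] ++ [seq [:: w] | w <- basic_words]
     ++ [seq [:: w; w'] | w <- basic_words, w' <- basic_words], e <- [:: false; true]].
(** An invariant of a block with its entry; length 5 suffices to separate
    the blocks of the catalogue. *)
Definition key b := fast_energy (core b) 5.
Definition catalogue : seq spec := pick_by (fun c => key (middle false c)) candidates.

Definition spec_ok (c : spec) : bool :=
  [&& all (fun w => nR w == 3) c.1, block_ok (weight c).*2 (middle false c),
      block_ok (weight c).*2 (middle true c) & key (middle true c) == key (middle false c)].

Definition catalogue_ok (cat : seq spec) : bool :=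
  all spec_ok cat &&
  [&& count (fun c => weight c == 1) cat == 2, count (fun c => weight c == 2) cat == 13 &
      75 <= count (fun c => weight c == 3) cat].

(** The numbers 2, 13 and 75 are the coefficients of the cubic. *)
Lemma catalogueP : catalogue_ok catalogue.
Proof. by vm_compute. Qed.

Lemma caps_ok : [&& block_ok 1 left_cap, block_ok 3 (right_cap true false),
  block_ok 3 (right_cap true true), block_ok 2 (right_cap false false) &
  block_ok 2 (right_cap false true)] && ~~ loopless (core left_cap).
Proof. by vm_compute. Qed.

Lemma key_inj : {in catalogue &, injective (fun c => key (middle false c))}.
Proof. exact: pick_by_inj. Qed.

End Examination.

(** * Skeletons of chains of blocks *)

Section BlockChains.
Local Open Scope nat_scope.
Implicit Types (b : block) (bs : seq block).

(** A line of height h contributes its h - 1 interior lattice points. *)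
Definition block_genus b : nat :=
  sumn [seq h.-1 | h <- first_height b :: map nR (inner_words b)].
Definition admissible b := block_ok (block_genus b) b.
Definition capped b bs := [&& path linked b bs, is_first b & is_last (last b bs)].

Lemma capped_flags b bs i : capped b bs -> i < size (b :: bs) ->
  let c := nth b (b :: bs) i in is_first c = (i == 0) /\ is_last c = (i.+1 == size (b :: bs)).
Proof.
move=> /and3P[/(pathP b) linked_bs fb lb] il /=; split.
  case: i il => [|i] /= il; first by rewrite fb.
  by have /and5P[_ /negbTE] := linked_bs i il.
move: il; rewrite ltnS eqSS leq_eqVlt => /orP[/eqP->|il].
  by rewrite -(last_nth b) lb eqxx.
by rewrite (ltn_eqF il); have /and5P[/negbTE] := linked_bs i il.
Qed.

Lemma admissible_reducible b : admissible b -> reducible (coded b, bivalent b (coded b)).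
Proof. by case/and5P. Qed.

Lemma admissible_good b : admissible b -> good (core b).
Proof.
move=> ab; have := reduce_wf (admissible_reducible ab); case/and5P: ab => _ _ _ _.
by case/and4P=> _ tight_b _ _ wf; rewrite /good wf.
Qed.

Lemma admissible_raw b : admissible b -> well_formed (raw b) /\ uniq (map code (blockV b)).
Proof.
move=> ab; have /and5P[wf _ _ _ _] := admissible_reducible ab.
by case/and5P: ab => _ low_b _ _ _; exact: coded_wf.
Qed.

Lemma admissible_all bs : all admissible bs ->
  [/\ all well_formed (map raw bs), all (fun p => uniq (map code (pV p))) (map raw bs),
      all well_formed (map coded bs),
      all reducible [seq (coded b, bivalent b (coded b)) | b <- bs] & all good (map core bs)].
Proof.
move=> ok; rewrite !all_map; split; apply: sub_all ok => b ab /=.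
- by have [] := admissible_raw ab.
- by have [] := admissible_raw ab.
- by case/and5P: (admissible_reducible ab).
- exact: admissible_reducible.
- exact: admissible_good.
Qed.

Lemma degree_iso_neq G H d : graph_iso G H -> (forall v : H, degree v <> d) ->
  forall v : G, degree v <> d.
Proof. by move=> [f [bf fm]] dH v; rewrite -(degree_iso bf fm); exact: dH. Qed.

Lemma chain_degree (ps : seq (piece nat)) d (x : chain_graph ps) : all well_formed ps ->
  let p := nth d ps (val x).1 in
  [/\ (val x).1 < size ps, (val x).2 \in pV p & degree x = edge_degree (pE p) (val x).2
    + ((0 < (val x).1) && ((val x).2 == pin p))
    + (((val x).1.+1 < size ps) && ((val x).2 == pout p))].
Proof.
move=> wf p; rewrite {}/p degree_lgraph ?chain_edges_in //.
have : val x \in chainV 0 ps by exact: ssvalP.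
case: (val x) => i v xV; have il : i < size ps by exact: (chainV_lt xV).
split=> [||/=]; first exact: il.
  by move: xV; rewrite (chain_nth0 d v il).
exact: (edge_degree_chain d 0).
Qed.

Lemma chain_words_coded b bs : capped b bs -> all admissible (b :: bs) ->
  graph_iso (lgraph (wlabs 0 (chain_words b bs)) (wedges 0 (chain_words b bs)))
            (chain_graph (map coded (b :: bs))).
Proof.
move=> /and3P[path_b _ _] /admissible_all[wf u _ _ _].
apply: graph_iso_trans (chain_words_iso path_b wf) _.
by have := chain_relabel wf u; rewrite -map_comp.
Qed.

Lemma coded_no_leaf b bs : all admissible (b :: bs) ->
  forall v : chain_graph (map coded (b :: bs)), degree v <> 1.
Proof.
move=> ok v; have [_ _ wf _ _] := admissible_all ok.
have [il vV ->] := chain_degree (coded b) v wf; move: il vV.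
rewrite size_map => il; rewrite (nth_map b) //.
have /and5P[_ _ _ /allP two _] := all_nthP b ok _ il.
move=> /two; lia.
Qed.

Lemma core_trivalent b bs : capped b bs -> all admissible (b :: bs) ->
  forall v : chain_graph (map core (b :: bs)), degree v = 3.
Proof.
move=> cap_b ok v; have [_ _ _ _ gd] := admissible_all ok.
have [il vV ->] := chain_degree (core b) v (good_wf gd); move: il vV.
rewrite size_map => il; rewrite (nth_map b) //.
have [ff ll] := capped_flags cap_b il.
have /and5P[_ _ _ _ /and4P[/allP three _ _ _]] := all_nthP b ok _ il.
move: ff ll; set c := nth b _ _ => ff ll /three/eqP <-; rewrite /marked_degree ff ll.
congr (_ + nat_of_bool _ + nat_of_bool _).
  rewrite lt0n; case: eqVneq ff => //= _ ff.
  by rewrite ff.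
rewrite ltn_neqAle il andbT; case: eqVneq ll => //= _ ll.
by rewrite ll.
Qed.

(** Nothing is pruned, and smoothing the bivalent vertices of every block
    leaves a trivalent graph. *)
Lemma core_skeleton b bs T : capped b bs -> all admissible (b :: bs) ->
  graph_iso (dual_graph T)
    (lgraph (wlabs 0 (chain_words b bs)) (wedges 0 (chain_words b bs))) ->
  exists2 K, is_skeleton (dual_graph T) K & graph_iso (chain_graph (map core (b :: bs))) K.
Proof.
move=> cap_b ok iso; have isoc := graph_iso_trans iso (chain_words_coded cap_b ok).
have [_ _ _ red _] := admissible_all ok.
have := chain_smooth red; rewrite -!map_comp => /(smooths_to_isol isoc)[K sK iK].
exists K; last exact: graph_iso_sym.
exists (dual_graph T); split=> //; first exact: pruned_refl.
  exact: degree_iso_neq isoc (coded_no_leaf ok).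
apply: degree_iso_neq iK _ => v.
by rewrite core_trivalent.
Qed.

Lemma key_walks b : admissible b -> key b = walk_energy (core b) 5.
Proof. by move=> /admissible_good/andP[wf _]; exact: fast_energyE. Qed.

Lemma admissible_loopless b : admissible b -> ~~ is_first b -> loopless (core b).
Proof. by case/and5P => _ _ _ _ /and4P[_ _ + _]; case: (is_first b). Qed.

Lemma admissible_genus b : admissible b ->
  (size (pE (core b))).+1 = block_genus b + size (pV (core b)).
Proof. by case/and5P => _ _ _ _ /and4P[_ _ _ /eqP]. Qed.

(** Each piece has |E| + 1 = g + |V|, and the bridges are one fewer than the
    pieces. *)
Lemma core_genus b bs : all admissible (b :: bs) ->
  has_genus (chain_graph (map core (b :: bs))) (sumn (map block_genus (b :: bs))).
Proof.
move=> ok; have [_ _ _ _ gd] := admissible_all ok; split; first exact: chain_connected.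
rewrite num_edges_lgraph ?chain_edges_in ?good_wf // card_lgraph ?chainV_uniq ?good_wf //.
rewrite chainE_size chainV_size size_map [(size _).-1]/= addn1 -addnS.
rewrite -[(size bs).+1]/(size (b :: bs)).
elim: (b :: bs) ok {gd} => // c cs IH /andP[/admissible_genus ec /IH].
rewrite !map_cons -![sumn (_ :: _)]/(_ + sumn _) -[size (_ :: _)]/(size cs).+1.
by rewrite addnS -addSn; move: ec; lia.
Qed.

End BlockChains.

(** * The family of capped chains *)

Section Family.
Local Open Scope nat_scope.
Implicit Types (b : block) (bs : seq block) (c : spec) (cs : seq spec).

(** The bit st tells whether the next entry is at the top; a bridge that leaves
    at the top arrives at the bottom. *)
Fixpoint tail (e st : bool) cs : seq block :=
  if cs is c :: cs' then middle st c :: tail e (~~ (c.2 (+) st)) cs' else [:: right_cap e st].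

Lemma inner_heights st c : spec_ok c -> map nR (inner_words (middle st c)) = nseq (size c.1) 3.
Proof.
case/and4P => + _ _ _ /=; case: c => ws e /=; rewrite /nR => hs.
have -> : map nR (if st then map rev ws else ws) = map nR ws.
  by case: st => //; rewrite -map_comp; apply: eq_map => w /=; rewrite /nR count_rev.
elim: ws hs => //= w ws IH /andP[/eqP hw /IH->].
by rewrite /nR hw.
Qed.

Lemma middle_last st c : spec_ok c -> last_height (middle st c) = 3.
Proof.
move=> ok; rewrite /last_height inner_heights //=.
by elim: (size _) => //= n ->.
Qed.

Lemma middle_genus st c : spec_ok c -> block_genus (middle st c) = (weight c).*2.
Proof.
move=> ok; rewrite /block_genus map_cons inner_heights // /weight map_nseq /=.
by elim: (size _) => //= n; lia.
Qed.

Lemma left_cap_admissible : admissible left_cap.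
Proof. by have /andP[/and5P[]] := caps_ok. Qed.

Lemma right_cap_genus e st : block_genus (right_cap e st) = if e then 3 else 2.
Proof. by case: e. Qed.

Lemma right_cap_admissible e st : admissible (right_cap e st).
Proof.
rewrite /admissible right_cap_genus.
by have /andP[/and5P[_ ? ? ? ?] _] := caps_ok; case: e st => -[].
Qed.

Lemma middle_admissible st c : spec_ok c -> admissible (middle st c).
Proof. by move=> ok; rewrite /admissible middle_genus //; case/and4P: ok; case: st. Qed.

Lemma tail_admissible e st cs : all spec_ok cs -> all admissible (tail e st cs).
Proof.
elim: cs st => [|c cs IH] st; first by rewrite /= right_cap_admissible.
case/andP => okc /IH ok; rewrite -[all _ _]/(_ && all _ (tail _ _ _)) middle_admissible //.
exact: ok.
Qed.

Lemma tail_linked e st cs b : all spec_ok cs -> ~~ is_last b -> exit_top b = ~~ st ->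
  0 < last_height b -> path linked b (tail e st cs).
Proof.
elim: cs st b => [|c cs IH] st b /=.
  by move=> _ lb eb hb; rewrite /linked lb eb hb negbK eqxx.
case/andP => okc okcs lb eb hb; rewrite /linked lb eb hb negbK eqxx /= IH ?negbK //.
by rewrite middle_last.
Qed.

Lemma tail_last e st cs b : is_last (last b (tail e st cs)).
Proof. by elim: cs st b => [|c cs IH] st b //=; exact: IH. Qed.

Lemma tail_capped e cs : all spec_ok cs -> capped left_cap (tail e false cs).
Proof. by move=> ok; rewrite /capped tail_linked // tail_last. Qed.

Lemma tail_genus e st cs : all spec_ok cs ->
  sumn (map block_genus (tail e st cs)) = (sumn (map weight cs)).*2 + (if e then 3 else 2).
Proof.
elim: cs st => [|c cs IH] st; first by rewrite /= right_cap_genus addn0.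
case/andP => okc /IH H; rewrite -[LHS]/(block_genus (middle st c) + sumn (map _ (tail _ _ _))).
by rewrite H middle_genus //= doubleD addnA.
Qed.

Lemma bridge_heights b b' : nL (bridge_word b b') = last_height b /\
  nR (bridge_word b b') = first_height b'.
Proof.
by rewrite /bridge_word /nL /nR; case: ifP => _; rewrite !count_cat !count_nseq; split; lia.
Qed.

Lemma words_after_heights e st cs b : all spec_ok cs ->
  map nR (words_after b (tail e st cs)) = map nR (inner_words b)
    ++ nseq (sumn (map weight cs)) 3 ++ (if e then [:: 3; 2; 0] else [:: 3; 0]).
Proof.
elim: cs st b => [|c cs IH] st b; rewrite [words_after _ _]/= map_cat map_cons.
  move=> _; have [_ ->] := bridge_heights b (right_cap e st).
  by congr (_ ++ _); case: e.
case/andP => okc /IH ->; have [_ ->] := bridge_heights b (middle st c).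
by rewrite inner_heights // -[sumn (map weight (_ :: _))]/(weight c + _) nseqD -catA.
Qed.

Lemma chained_cat h ws ws' :
  chained h (ws ++ ws') = chained h ws && chained (last h (map nR ws)) ws'.
Proof. by elim: ws h => //= w ws IH h; rewrite IH andbA. Qed.

Lemma words_after_chained b bs : all admissible (b :: bs) ->
  chained (first_height b) (words_after b bs).
Proof.
elim: bs b => [|b' bs IH] b /andP[/and5P[cb _ _ _ _] ok];
  rewrite [words_after _ _]/= chained_cat cb -/(last_height b) /=.
  by rewrite /nL count_nseq mul1n eqxx.
by have [-> ->] := bridge_heights b b'; rewrite eqxx IH.
Qed.

Lemma chainedP h ws i : chained h ws -> i < size ws ->
  nL (nth [::] ws i) = nth 0 (h :: map nR ws) i.
Proof.
elim: ws h i => // w ws IH h [|i] /andP[/eqP hw cw] //= il.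
by rewrite (IH _ _ cw il).
Qed.

Definition family_words e cs := chain_words left_cap (tail e false cs).
Definition family_graph e cs : mgraph := chain_graph (map core (left_cap :: tail e false cs)).

(** The heights are 0, 2, 3, .., 3, 0 or 0, 2, 3, .., 3, 2, 0: a concave
    sequence. *)
Lemma family_heights e cs i : all spec_ok cs -> let n := sumn (map weight cs) in
  nth 0 (0 :: map nR (family_words e cs)) i =
  if i == 0 then 0 else if i == 1 then 2 else if i <= n + 2 then 3 else
  if e && (i == n + 3) then 2 else 0.
Proof.
move=> ok n; rewrite /family_words map_cons words_after_heights // -/n.
case: i => [|[|i]] //=; rewrite nth_cat size_nseq nth_nseq.
case: (ltnP i n) => ni; first by rewrite ifT //; lia.
have [k ->] : exists k, i = n + k by exists (i - n); lia.
rewrite addKn -[(n + k).+2]addn2 -addnA leq_add2l eqn_add2l.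
by case: k e => [|[|[|k]]] [] //=; rewrite ?nth_nil ?addn2.
Qed.

Lemma family_troplanar (R : realType) e cs : all spec_ok cs -> troplanar R (family_graph e cs).
Proof.
move=> ok; have ad : all admissible (left_cap :: tail e false cs).
  by rewrite -[all _ _]/(_ && all _ (tail _ _ _)) left_cap_admissible tail_admissible.
have cap := tail_capped e ok.
have [K skelK isoK] := core_skeleton cap ad (dual_strip (family_words e cs)).
set n := sumn (map weight cs).
have size_words : size (family_words e cs) = n + 3 + e.
  rewrite -(size_map nR) map_cons words_after_heights // -[size (_ :: _)]/(size _).+1.
  rewrite size_cat size_cat size_nseq -/n.
  by case: e {ad cap K skelK isoK} => /=; lia.
pose ht i := nth 0 (0 :: map nR (family_words e cs)) i.
have htE i : ht i = if i == 0 then 0 else if i == 1 then 2 else if i <= n + 2 then 3 else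
  if e && (i == n + 3) then 2 else 0 by exact: family_heights.
have lh i : i < size (family_words e cs) -> nL (nth [::] (family_words e cs) i) = ht i.
  by move=> il; apply: chainedP il; exact: (words_after_chained ad).
have rh i : i < size (family_words e cs) -> nR (nth [::] (family_words e cs) i) = ht i.+1.
  by move=> il; rewrite -[ht _]/(nth 0 (map nR _) i) (nth_map [::]).
have [||||||D [g [polyD [triD regD]]]] := @strip_triangulation R (family_words e cs) ht lh rh.
- move=> i il; rewrite -(count_predC id) -/(nL _) -/(nR _) lh // [nR _]rh // !htE.
  by move: il; rewrite size_words; case: (e) => /=; do !case: ifP => ?; lia.
- by move=> i; rewrite size_words !htE; case: (e) => /=; do !case: ifP => ?; lia.
- by rewrite size_words; lia.
- by rewrite size_words; lia.
- by rewrite htE.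
- by rewrite htE /= ifT //; lia.
by exists D, g, (strip (family_words e cs)), K.
Qed.

Lemma family_genus e cs : all spec_ok cs ->
  has_genus (family_graph e cs) (1 + ((sumn (map weight cs)).*2 + (if e then 3 else 2))).
Proof.
move=> ok; rewrite -(tail_genus _ false) //; apply: core_genus.
by rewrite -[all _ _]/(_ && all _ (tail _ _ _)) left_cap_admissible tail_admissible.
Qed.

Section Distinct.
Variable pool : seq spec.
Hypothesis pool_ok : all spec_ok pool.
Hypothesis pool_keys : {in pool &, injective (fun c => key (middle false c))}.

Lemma all_spec_ok cs : {subset cs <= pool} -> all spec_ok cs.
Proof. by move=> sub; apply/allP => c /sub; exact: (allP pool_ok). Qed.

(** Turning a block upside down does not change its key, so the keys are read
    off without knowing on which side the bridges arrive. *)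
Lemma keys_determine e st st' cs ds : {subset cs <= pool} -> {subset ds <= pool} ->
  size cs = size ds ->
  (forall k, k < size cs ->
     key (nth left_cap (tail e st cs) k) = key (nth left_cap (tail e st' ds) k)) -> cs = ds.
Proof.
elim: cs ds st st' => [|c cs IH] [|d ds] // st st' subc subd [sz] keys.
have cc : c \in pool := subc _ (mem_head _ _).
have dc : d \in pool := subd _ (mem_head _ _).
have key_middle s c' : c' \in pool -> key (middle s c') = key (middle false c').
  move=> /(allP pool_ok)/and4P[_ _ _ /eqP kc].
  by case: s.
congr (_ :: _).
  apply: (pool_keys cc dc); rewrite /= -(key_middle st c cc) -(key_middle st' d dc).
  exact: (keys 0 isT).
apply: (IH ds (~~ (c.2 (+) st)) (~~ (d.2 (+) st')) _ _ sz (fun k => keys k.+1)).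
  by move=> x xc; apply: subc; rewrite inE xc orbT.
by move=> x xc; apply: subd; rewrite inE xc orbT.
Qed.

(** The left cap is the only piece with a loop, so chain_iso_walks recovers
    the keys of all blocks, and these determine the blocks. *)
Lemma family_inj e cs ds : {subset cs <= pool} -> {subset ds <= pool} ->
  graph_iso (family_graph e cs) (family_graph e ds) -> cs = ds.
Proof.
move=> subc subd iso.
have good_tail es : {subset es <= pool} ->
    all good (map core (left_cap :: tail e false es)) /\
    all loopless (map core (tail e false es)).
  move=> /all_spec_ok ok; have ad := tail_admissible e false ok.
  have ad' : all admissible (left_cap :: tail e false es).
    by rewrite -[all _ _]/(_ && all _ (tail _ _ _)) left_cap_admissible.
  split; first by have [] := admissible_all ad'.
  rewrite all_map; apply/(all_nthP left_cap) => i il.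
  have [ff _] := capped_flags (i := i.+1) (tail_capped e ok) il.
  apply: admissible_loopless; first exact: all_nthP left_cap ad _ il.
  by move: ff => /= ->.
have [gc lc] := good_tail _ subc; have [gd ld] := good_tail _ subd.
have nl : ~~ loopless (core left_cap) by have /andP[] := caps_ok.
have {nl} [sz walksE] := chain_iso_walks (core left_cap) gc gd nl ld iso.
rewrite !size_map in sz walksE.
have size_tail st es : size (tail e st es) = (size es).+1.
  by elim: es st => //= x es IH st; rewrite IH.
apply: (@keys_determine e false false cs ds subc subd) => [|k kl].
  by move: sz; rewrite !size_tail => -[].
have kl' : k < size (tail e false cs) by rewrite size_tail ltnW.
have kd : k < size (tail e false ds) by rewrite -sz.
have := walksE k 5 kl'; rewrite (nth_map left_cap _ _ kl') (nth_map left_cap _ _ kd).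
rewrite -(key_walks (all_nthP left_cap (tail_admissible e false (all_spec_ok subc)) k kl')).
by rewrite -(key_walks (all_nthP left_cap (tail_admissible e false (all_spec_ok subd)) k kd)).
Qed.

End Distinct.

End Family.

(** * Counting *)

Section CodeCounts.
Local Open Scope nat_scope.

Section Codes.
Variable pool : seq spec.

Definition extend (C : seq spec) (A : seq (seq spec)) := [seq c :: s | c <- C, s <- A].
Definition of_weight k := [seq c <- pool | weight c == k].

(** The sequences of specifications of total weights n-2, n-1 and n, the weight
    of a specification being its number of lines. *)
Fixpoint codes3 n : seq (seq spec) * seq (seq spec) * seq (seq spec) :=
  if n is m.+1 then let: (x, y, z) := codes3 m in
    (y, z, extend (of_weight 1) z ++ extend (of_weight 2) y ++ extend (of_weight 3) x)
  else ([::], [::], [:: [::]]).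
Definition codes n := (codes3 n).2.

Hypothesis pool_uniq : uniq pool.

Let coded_by d n (A : seq (seq spec)) := uniq A /\
  forall s, s \in A -> {subset s <= pool} /\ sumn (map weight s) + d = n.

Lemma extend_coded d k n A : coded_by d n A ->
  coded_by 0 (n - d + k) (extend (of_weight k) A) /\
  forall s, s \in extend (of_weight k) A -> head 0 (map weight s) = k.
Proof.
move=> [uA wA]; split; first split.
- by rewrite allpairs_uniq ?filter_uniq // => -[a b] [a' b'] _ _ [-> ->].
- move=> _ /allpairsP[[c s] [/= + /wA[sub <-] ->]]; rewrite mem_filter => /andP[/eqP wc cC].
  split; last by rewrite /=; lia.
  by move=> c'; rewrite inE => /orP[/eqP->|/sub].
move=> _ /allpairsP[[c s] [/= + _ ->]]; rewrite mem_filter => /andP[/eqP wc _].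
exact: wc.
Qed.

Lemma codes3P n : let: (x, y, z) := codes3 n in
  [/\ coded_by 2 n x, coded_by 1 n y & coded_by 0 n z].
Proof.
elim: n => [|n]; first by split; split=> // s; rewrite mem_seq1 => /eqP->.
rewrite [codes3 _.+1]/=; case: (codes3 n) => [[x y] z] [cx cy cz].
split; first by case: cy => u H; split=> // s /H[sub <-]; split=> //; rewrite addnS.
  by case: cz => u H; split=> // s /H[sub <-]; split=> //; rewrite addnS.
have [[u1 w1] h1] := extend_coded 1 cz; have [[u2 w2] h2] := extend_coded 2 cy.
have [[u3 w3] h3] := extend_coded 3 cx.
have le1 : y != [::] -> 0 < n.
  by case: cy => _; case: (y) => // s y' /(_ s (mem_head _ _)) [_ <-] _; rewrite addn1.
have le2 : x != [::] -> 1 < n.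
  by case: cx => _; case: (x) => // s x' /(_ s (mem_head _ _)) [_ <-] _; rewrite addn2.
split.
  rewrite !cat_uniq u1 u2 u3 andbT /=; apply/andP; split.
    apply/hasPn => s; rewrite mem_cat => /orP[/h2 e2|/h3 e3]; apply/negP => /h1; lia.
  by apply/hasPn => s /h3 e3; apply/negP => /h2; lia.
move=> s; rewrite !mem_cat => /or3P[] sin.
- by have [sub ->] := w1 s sin; split=> //; lia.
- have [sub ->] := w2 s sin; split=> //.
  have : y != [::] by apply: contraTneq sin => ->; rewrite /extend allpairs0r.
  by move/le1; lia.
have [sub ->] := w3 s sin; split=> //.
have : x != [::] by apply: contraTneq sin => ->; rewrite /extend allpairs0r.
by move/le2; lia.
Qed.

Lemma codes_uniq n : uniq (codes n).
Proof. by have := codes3P n; rewrite /codes; case: codes3 => [[x y] z] [_ _ []]. Qed.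

Lemma codesP n s : s \in codes n -> {subset s <= pool} /\ sumn (map weight s) = n.
Proof.
have := codes3P n; rewrite /codes; case: codes3 => [[x y] z] /= [_ _ [_ H]] /H[sub <-].
by rewrite addn0.
Qed.

End Codes.

(** The numbers of codes satisfy a_(n+3) >= 2 a_(n+2) + 13 a_(n+1) + 75 a_n,
    and alpha is the corresponding eigenvalue: its left eigenvector (u, v, 1)
    gives a linear form in (a_(n-2), a_(n-1), a_n) that grows at least by the
    factor alpha at each step. As the a_n are nondecreasing, the form is at most
    (u + v + 1) a_n <= 20 a_n. *)
Lemma codes_growth (R : realType) (alpha : R) (pool : seq spec) n :
  (6 <= alpha <= 7)%R -> (alpha ^+ 3 - 2 * alpha ^+ 2 - 13 * alpha - 75 = 0)%R ->
  2 <= count (fun c => weight c == 1) pool -> 13 <= count (fun c => weight c == 2) pool ->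
  75 <= count (fun c => weight c == 3) pool ->
  (alpha ^+ n <= 20 * (size (codes pool n))%:R)%R.
Proof.
move=> /andP[a6 a7] root count1 count2 count3.
pose u : R := (75 / alpha)%R; pose v : R := (alpha - 2)%R.
have a0 : (alpha != 0)%R by apply: lt0r_neq0; lra.
have ua : (u * alpha = 75)%R by rewrite /u divfK.
have u0 : (0 <= u <= 25 / 2)%R by rewrite /u divr_ge0 ?ler_pdivrMr //=; lra.
suff : let: (x, y, z) := codes3 pool n in
    (alpha ^+ n <= u * (size x)%:R + v * (size y)%:R + (size z)%:R)%R /\
    size x <= size y <= size z.
  rewrite /codes; case: codes3 => [[x y] z] /= [le_n /andP[xy yz]].
  apply: (le_trans le_n).
  have xz : ((size x)%:R <= (size z)%:R :> R)%R by rewrite ler_nat (leq_trans xy).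
  have {}yz : ((size y)%:R <= (size z)%:R :> R)%R by rewrite ler_nat.
  have ux : (u * (size x)%:R <= 25 / 2 * (size z)%:R)%R.
    by apply: ler_pM => //; case/andP: u0.
  have vy : (v * (size y)%:R <= 5 * (size z)%:R)%R by apply: ler_pM; rewrite // /v; lra.
  have : (0 <= (size z)%:R :> R)%R by [].
  lra.
elim: n => [|n]; first by rewrite /= !mulr0 !add0r expr0.
rewrite [codes3 _ _.+1]/=; case: (codes3 pool n) => [[x y] z] /= [le_n /andP[xy yz]].
rewrite !size_cat !size_allpairs !size_filter.
move: count1 count2 count3; set c1 := count _ _; set c2 := count _ _; set c3 := count _ _.
move=> h1 h2 h3; split; last by rewrite yz; nia.
have big : (2 * (size z)%:R + 13 * (size y)%:R + 75 * (size x)%:R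
    <= (c1 * size z + (c2 * size y + c3 * size x))%:R :> R)%R.
  rewrite !natrD !natrM addrA.
  by apply: lerD; [apply: lerD|]; apply: ler_wpM2r => //; rewrite ler_nat.
apply: le_trans (lerD (lexx _) big).
rewrite exprSr; apply: le_trans (ler_wpM2r _ le_n) _; first by lra.
have vE : (v * alpha = u + 13)%R.
  apply: (mulIf a0); rewrite [RHS]mulrDl ua /v.
  by move: root; rewrite !exprS expr0; lra.
have -> : ((u * (size x)%:R + v * (size y)%:R + (size z)%:R) * alpha =
   u * alpha * (size x)%:R + v * alpha * (size y)%:R + alpha * (size z)%:R)%R by ring.
by rewrite ua vE /v; lra.
Qed.

End CodeCounts.

Section Growth.
Local Open Scope ring_scope.
Variable R : realType.

Lemma num_troplanar_codes (pool : seq spec) (e : bool) n : uniq pool -> all spec_ok pool ->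
  {in pool &, injective (fun c => key (middle false c))} ->
  (size (codes pool n) <= num_troplanar R (1 + (n.*2 + (if e then 3 else 2))))%N.
Proof.
move=> u ok keys.
pose K (i : 'I_(size (codes pool n))) := family_graph e (nth [::] (codes pool n) i).
have codeP (i : 'I_(size (codes pool n))) := codesP u (mem_nth [::] (ltn_ord i)).
apply: (@num_troplanar_ge R _ _ K) => [|i|i j iso]; first by case: (e); rewrite add1n ltnS addnS.
  have [sub w] := codeP i; have oki := all_spec_ok ok sub.
  split; first exact: family_troplanar.
  by have := family_genus e oki; rewrite w.
have [subi _] := codeP i; have [subj _] := codeP j.
apply/val_inj/eqP; rewrite -(nth_uniq [::] (ltn_ord i) (ltn_ord j)) ?codes_uniq //.
by rewrite (family_inj ok keys subi subj iso).
Qed.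

Lemma num_troplanar_growth (alpha : R) (e : bool) n : 6 <= alpha <= 7 ->
  alpha ^+ 3 - 2 * alpha ^+ 2 - 13 * alpha - 75 = 0 ->
  alpha ^+ n <= 20 * (num_troplanar R (1 + (n.*2 + (if e then 3 else 2))))%:R.
Proof.
move=> bounds root; move: catalogueP key_inj (pick_by_uniq _ _ : uniq catalogue).
move: catalogue => pool /andP[ok /and3P[/eqP c1 /eqP c2 c3]] keys u.
apply: le_trans (codes_growth n bounds root _ _ c3) _; rewrite ?c1 ?c2 //.
by rewrite ler_pM2l // ler_nat; exact: num_troplanar_codes.
Qed.

(** A real root exists by the intermediate value theorem. Dividing by x - alpha
    leaves a quadratic of negative discriminant -3 alpha^2 + 4 alpha + 56,
    so there is no other. *)
Lemma cubic_root : exists2 alpha : R, 61 / 10 <= alpha <= 49 / 8 &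
  forall x : R, x ^+ 3 - 2 * x ^+ 2 - 13 * x - 75 = 0 <-> x = alpha.
Proof.
pose p : {poly R} := 'X^3 - 2%:P * 'X^2 - 13%:P * 'X - 75%:P.
have pE x : p.[x] = x ^+ 3 - 2 * x ^+ 2 - 13 * x - 75 by rewrite /p !hornerE.
(* close enough to 2.47 ^ 2 for the required approximation of sqrt alpha *)
have [||alpha bounds] := @poly_ivt R p (61 / 10) (49 / 8).
- by lra.
- by rewrite !pE; apply/andP; split; lra.
rewrite /root pE => /eqP pa; exists alpha => // x; split=> [px|->//].
apply/eqP; rewrite -subr_eq0; apply/negPn/negP => xa.
have /eqP : (x - alpha) * (x ^+ 2 + x * alpha + alpha ^+ 2 - 2 * (x + alpha) - 13) = 0.
  rewrite -[0](subrr 0) -{1}px -pa; ring.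
rewrite mulf_eq0 (negbTE xa) /= => /eqP q.
by nra.
Qed.

End Growth.

Local Open Scope ring_scope.

(** Two specifications of the right cap cover both parities of the genus. *)
Lemma genus_splitting g : (3 <= g)%N -> exists n (e : bool),
  g = (1 + (n.*2 + (if e then 3 else 2)))%N /\ g = (2 * n + (3 + e))%N.
Proof.
move=> g3; exists (g - 3)./2, (odd (g - 3)).
by have := odd_double_half (g - 3); case: odd; lia.
Qed.

Theorem corollary5p5 (R : realType) :
  exists alpha : R,
    (forall x : R,
       x ^+ 3 - 2 * x ^+ 2 - 13 * x - 75 = 0 <-> x = alpha) /\
    `|Num.sqrt alpha - 247 / 100| < 5 / 1000 /\
    is_Omega (fun g : nat => (num_troplanar R g)%:R)
             (fun g : nat => Num.sqrt alpha ^+ g).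
Proof.
have [alpha bounds rootE] := cubic_root R; exists alpha; split; first exact: rootE.
set s := Num.sqrt alpha.
have s0 : 0 <= s by exact: sqrtr_ge0.
have sE : s ^+ 2 = alpha by rewrite sqr_sqrtr //; lra.
have sb : 2465 / 1000 < s < 2475 / 1000.
  by apply/andP; split; rewrite ltNge; apply/negP => h; rewrite expr2 in sE; nra.
split; first by rewrite ltr_norml; lra.
(* 1620 = 20 * 81: the factor 20 is that of codes_growth, and the caps account
   for at most s ^ 4 <= 3 ^ 4 *)
exists 1620; split; first by lra.
near=> g; have g3 : (3 <= g)%N by near: g; exists 3%N.
rewrite ger0_norm ?exprn_ge0 //.
have [n [e [gE gE']]] := genus_splitting g3.
have /(num_troplanar_growth e n) : 6 <= alpha <= 7 by lra.
rewrite -gE => /(_ (proj2 (rootE _) erefl)) growth.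
have -> : s ^+ g = alpha ^+ n * s ^+ (3 + e).
  by rewrite -sE -exprM -exprD -gE'.
have s81 : s ^+ (3 + e) <= 81.
  have -> : 81 = 3 ^+ 4 :> R by rewrite !exprS; lra.
  apply: (@le_trans _ _ (3 ^+ (3 + e))); first by apply: lerXn2r; rewrite ?nnegrE; lra.
  by apply: ler_weXn2l; [lra | case: (e)].
have := ler_pM (exprn_ge0 n _) (exprn_ge0 (3 + e) s0) growth s81.
by rewrite -sE => /(_ (sqr_ge0 s)); lra.
Unshelve. all: by end_near. Qed.
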